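(* In local coordinates $(q^1,q^2,u^1)$ on 3-dimensional de Sitter space, with the metric written as $ds^2=-\sin^2(u^1)\cos^2(q^2)(dq^1)^2+\sin^2(u^1)(dq^2)^2+(du^1)^2$, consider the electromagnetic field $\mathscr{F}=\mu\cos(q^2)\,dq^1\wedge dq^2$ ($\mu$ a constant) with potential $\mathscr{A}=-\mu\sin(q^2)\,dq^1$, and the Klein--Gordon equation $$\hat H\varphi=\Bigl[\partial_{u^1}^2+2\cot(u^1)\partial_{u^1}-\frac{1}{\sin^2u^1}\Bigl(\frac{1}{\cos^2q^2}\partial_{q^1}^2-\partial_{q^2}^2+\tan q^2\,\partial_{q^2}\Bigr)-\frac{2ie\mu\tan q^2}{\sin^2u^1\cos q^2}\partial_{q^1}+\frac{e^2\mu^2\tan^2q^2}{\sin^2u^1}+6\zeta+m^2\Bigr]\varphi=0 .$$ Its symmetry operators $$\hat X_1=\partial_{q^1},\quad \hat X_2=\sinh q^1\tan q^2\,\partial_{q^1}+\cosh q^1\,\partial_{q^2}+\frac{ie\mu\sinh q^1}{\cos q^2},\quad \hat X_3=\cosh q^1\tan q^2\,\partial_{q^1}+\sinh q^1\,\partial_{q^2}+\frac{ie\mu\cosh q^1}{\cos q^2}$$ together with $\hat X_0=ie$ form a Lie algebra isomorphic to $\mathfrak{so}(1,2)\oplus\mathbb R$. Choose the $\lambda$-representation corresponding to a continuous series of representations of $SO(1,2)$: $$\hat\ell_1=\lambda\partial_\lambda+iJ+\tfrac12,\quad \hat\ell_2=\tfrac12(\lambda^2+1)\partial_\lambda+(iJ+\tfrac12)\lambda,\quad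 \hat\ell_3=\tfrac12(\lambda^2-1)\partial_\lambda+(iJ+\tfrac12)\lambda,\qquad\lambda\in\mathbb R,\ J\in[0,+\infty);$$ these operators are skew-symmetric under the Lebesgue measure $d\lambda$ on $\mathbb R$. Then: (a) the general solution of the system $\hat X_A\varphi=-\hat\ell_A\varphi$, $A=1,2,3$, is $$\varphi_J(q^1,q^2,u^1,\lambda)=\Phi_J(v)\bigl[2\lambda\sin q^2+(e^{q^1}-\lambda^2e^{-q^1})\cos q^2\bigr]^{-iJ-\frac12}\left[\frac{\lambda e^{-q^1}\cos q^2+1-\sin q^2}{\cos q^2-\lambda e^{-q^1}(1-\sin q^2)}\right]^{ie\mu},\qquad v=u^1,$$ with $\Phi_J$ an arbitrary function; (b) substituting $\varphi_J$ into the Klein--Gordon equation gives the ordinary differential equation $$\Phi_J''(v)+2\cot(v)\,\Phi_J'(v)+\Bigl[m^2+6\zeta+\frac{J^2-e^2\mu^2+\frac14}{\sin^2v}\Bigr]\Phi_J(v)=0;$$ (c) two linearly independent solutions of this equation are expressed in terms of associated Legendre functions of the first and second kind: $$\Phi_J^{(1)}(v)=\frac1{\sqrt{\sin v}}\,P_\nu^\sigma(\cos v),\qquad \Phi_J^{(2)}(v)=\frac1{\sqrt{\sin v}}\,Q_\nu^\sigma(\cos v),$$ $$\nu=\sqrt{1+m^2+6\zeta}-\tfrac12,\qquad \sigma=\sqrt{e^2\mu^2-J^2}.$$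
   Context: The Klein--Gordon operator is $\hat H=g^{ab}D_aD_b+\zeta R+m^2$ with $D_a=\nabla_a-ie\mathscr{A}_a$, scalar curvature taken as $R=6$, mass $m$ and charge $e$ of the field quanta, and $\zeta=0$ or $\zeta=(n-1)/(4n)$ with $n=3$. Differential operators in $(q,u)$ and in $\lambda$ act on functions $\varphi(q,u,\lambda)$; a $\lambda$-representation is an operator-irreducible representation of the symmetry algebra by first-order operators $\hat\ell_A$ in auxiliary variables $\lambda$. $P_\nu^\sigma,Q_\nu^\sigma$ are the associated Legendre functions of the first and second kind. The chart is $x^1=\sin u^1\cosh q^1\cos q^2$, $x^2=\sin u^1\sin q^2$, $x^3=\cos u^1$, $x^0=-\sin u^1\sinh q^1\cos q^2$ on the hyperboloid $(x^0)^2-(x^1)^2-(x^2)^2-(x^3)^2=-1$. The construction of solutions is local.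
   Formalization: The isomorphism with so(1,2)⊕R is stated for e≠0 (at e=0, X_0 vanishes and it fails), and linear independence in (c) only when σ is not in ν+1+{0,1,2,...}, where P and Q are proportional (e.g. ν=1/2, σ=3/2). *)

(* Defs.v *)
From Stdlib Require Export Reals Factorial.
From Coquelicot Require Export Coquelicot.
Open Scope R_scope.

Definition CDerive (f : R -> C) (x : R) : C :=
  (Derive (fun t => Re (f t)) x, Derive (fun t => Im (f t)) x).

Definition ex_CDerive (f : R -> C) (x : R) : Prop :=
  ex_derive (V := C_R_NormedModule) f x.

Definition CDerive_n (f : R -> C) (n : nat) (x : R) : C :=
  (Derive_n (fun t => Re (f t)) n x, Derive_n (fun t => Im (f t)) n x).

Definition CInt (f : R -> C) (a b : R) : C :=
  (RInt (fun t => Re (f t)) a b, RInt (fun t => Im (f t)) a b).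

Definition CSeries (u : nat -> C) : C :=
  (Series (fun n => Re (u n)), Series (fun n => Im (u n))).

Definition CLim_seq (u : nat -> C) : C :=
  (real (Lim_seq (fun n => Re (u n))), real (Lim_seq (fun n => Im (u n)))).

Definition Cexp (z : C) : C := (exp (Re z) * cos (Im z), exp (Re z) * sin (Im z)).

Definition Ccos (z : C) : C := ((Cexp (Ci * z) + Cexp (- (Ci * z))) / 2)%C.
Definition Csin (z : C) : C := ((Cexp (Ci * z) - Cexp (- (Ci * z))) / (2 * Ci))%C.

(* Principal logarithm of a nonzero real number, and the corresponding
   complex power of a nonzero real base. *)
Definition Rlog (x : R) : C := (ln (Rabs x), if Rlt_dec x 0 then PI else 0).
Definition Rcpow (x : R) (w : C) : C := Cexp (w * Rlog x)%C.

Definition Rcsqrt (x : R) : C :=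
  if Rle_dec 0 x then RtoC (sqrt x) else (Ci * RtoC (sqrt (- x)))%C.

Definition smooth (f : R -> C) : Prop :=
  forall n x, ex_derive_n (fun t => Re (f t)) n x
           /\ ex_derive_n (fun t => Im (f t)) n x.

Fixpoint Cpoch (a : C) (n : nat) : C :=
  match n with
  | O => RtoC 1
  | S k => (Cpoch a k * (a + RtoC (INR k)))%C
  end.

(* Gauss: 1/Gamma(z) = lim z (z+1) ... (z+n) / (n! n^z), an entire function. *)
Definition rGamma (z : C) : C :=
  CLim_seq (fun n =>
    (Cpoch z (S n) / (RtoC (INR (fact n)) * Rcpow (INR n) z))%C).

(* Meaningful away from the poles 0, -1, -2, ... *)
Definition CGamma (z : C) : C := (/ rGamma z)%C.

Definition Hyp2F1 (a b c : C) (x : R) : C :=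
  CSeries (fun n =>
    (Cpoch a n * Cpoch b n / (Cpoch c n * RtoC (INR (fact n))) * RtoC (x ^ n))%C).

(* Even and odd solutions of the associated Legendre equation of degree nu and
   order sigma, and the Ferrers functions P and Q in terms of them
   (NIST DLMF 14.3.11-14.3.14).  Unlike the formula
     Q = pi / (2 sin(sigma pi)) * (cos(sigma pi) P^sigma - ... P^(-sigma)),
   this needs no limiting process for integer sigma: it is valid for all
   complex nu, sigma except where nu + sigma is a negative integer. *)
Definition legW1 (nu sigma : C) (x : R) : C :=
  (Rcpow 2 sigma / RtoC (sqrt PI)
   * (CGamma (nu / 2 + sigma / 2 + 1 / 2) * rGamma (nu / 2 - sigma / 2 + 1))
   * Rcpow (1 - x ^ 2) (- (sigma / 2))
   * Hyp2F1 (- (nu / 2) - sigma / 2) (nu / 2 - sigma / 2 + 1 / 2) (1 / 2) (x ^ 2))%C.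

Definition legW2 (nu sigma : C) (x : R) : C :=
  (Rcpow 2 (sigma + 1) / RtoC (sqrt PI)
   * (CGamma (nu / 2 + sigma / 2 + 1) * rGamma (nu / 2 - sigma / 2 + 1 / 2))
   * Rcpow (1 - x ^ 2) (- (sigma / 2)) * RtoC x
   * Hyp2F1 (1 / 2 - nu / 2 - sigma / 2) (nu / 2 - sigma / 2 + 1) (3 / 2) (x ^ 2))%C.

Definition LegendreP (nu sigma : C) (x : R) : C :=
  (Ccos ((nu + sigma) / 2 * RtoC PI) * legW1 nu sigma x
   + Csin ((nu + sigma) / 2 * RtoC PI) * legW2 nu sigma x)%C.

Definition LegendreQ (nu sigma : C) (x : R) : C :=
  (RtoC (PI / 2)
   * (Ccos ((nu + sigma) / 2 * RtoC PI) * legW2 nu sigma x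
      - Csin ((nu + sigma) / 2 * RtoC PI) * legW1 nu sigma x))%C.

Inductive coord := Q1 | Q2 | U1.

Definition coord_eqb (a b : coord) : bool :=
  match a, b with Q1, Q1 | Q2, Q2 | U1, U1 => true | _, _ => false end.

Definition rfield := R -> R -> R -> R.
Definition cfield := R -> R -> R -> C.

Definition chart (q1 q2 u : R) : Prop := - (PI / 2) < q2 < PI / 2 /\ 0 < u < PI.

Definition rpd (a : coord) (f : rfield) : rfield := fun q1 q2 u =>
  match a with
  | Q1 => Derive (fun t => f t q2 u) q1
  | Q2 => Derive (fun t => f q1 t u) q2
  | U1 => Derive (fun t => f q1 q2 t) u
  end.

Definition pd (a : coord) (f : cfield) : cfield := fun q1 q2 u =>
  match a with
  | Q1 => CDerive (fun t => f t q2 u) q1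
  | Q2 => CDerive (fun t => f q1 t u) q2
  | U1 => CDerive (fun t => f q1 q2 t) u
  end.

Definition ex_pd (a : coord) (f : cfield) (q1 q2 u : R) : Prop :=
  match a with
  | Q1 => ex_CDerive (fun t => f t q2 u) q1
  | Q2 => ex_CDerive (fun t => f q1 t u) q2
  | U1 => ex_CDerive (fun t => f q1 q2 t) u
  end.

Fixpoint chart_class (n : nat) (f : cfield) : Prop :=
  (forall q1 q2 u, chart q1 q2 u ->
     continuous (fun p : R * R * R => f (fst (fst p)) (snd (fst p)) (snd p))
                (q1, q2, u)) /\
  match n with
  | O => True
  | S k => forall a,
      (forall q1 q2 u, chart q1 q2 u -> ex_pd a f q1 q2 u) /\ chart_class k (pd a f)
  end.

Definition chart_smooth (f : cfield) : Prop := forall n, chart_class n f.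

Definition rsum3 (F : coord -> R) : R := F Q1 + F Q2 + F U1.
Definition csum3 (F : coord -> C) : C := (F Q1 + F Q2 + F U1)%C.

(* [embed i] is the ambient coordinate x^i. *)
Definition embed (i : nat) : rfield := fun q1 q2 u =>
  match i with
  | 0%nat => - (sin u * sinh q1 * cos q2)
  | 1%nat => sin u * cosh q1 * cos q2
  | 2%nat => sin u * sin q2
  | _ => cos u
  end.

(* The Minkowski metric diag(-1, 1, 1, 1) pulled back by the embedding. *)
Definition induced_metric (a b : coord) : rfield := fun q1 q2 u =>
  - (rpd a (embed 0) q1 q2 u * rpd b (embed 0) q1 q2 u)
  + rpd a (embed 1) q1 q2 u * rpd b (embed 1) q1 q2 u
  + rpd a (embed 2) q1 q2 u * rpd b (embed 2) q1 q2 u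
  + rpd a (embed 3) q1 q2 u * rpd b (embed 3) q1 q2 u.

Definition metric (a b : coord) : rfield := fun q1 q2 u =>
  match a, b with
  | Q1, Q1 => - ((sin u) ^ 2 * (cos q2) ^ 2)
  | Q2, Q2 => (sin u) ^ 2
  | U1, U1 => 1
  | _, _ => 0
  end.

Definition inv_metric (a b : coord) : rfield := fun q1 q2 u =>
  if coord_eqb a b then / metric a a q1 q2 u else 0.

Definition christoffel (c a b : coord) : rfield := fun q1 q2 u =>
  rsum3 (fun d => / 2 * inv_metric c d q1 q2 u *
    (rpd a (metric d b) q1 q2 u + rpd b (metric d a) q1 q2 u
     - rpd d (metric a b) q1 q2 u)).

(* F = mu cos(q^2) dq^1 /\ dq^2 has components F_{12} = - F_{21} = mu cos(q^2). *)
Definition potential (mu : R) (a : coord) : rfield := fun q1 q2 u =>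
  match a with Q1 => - (mu * sin q2) | _ => 0 end.

Definition em_field (mu : R) (a b : coord) : rfield := fun q1 q2 u =>
  match a, b with
  | Q1, Q2 => mu * cos q2
  | Q2, Q1 => - (mu * cos q2)
  | _, _ => 0
  end.

Definition operator := cfield -> cfield.

Definition Dcov (e mu : R) (a : coord) : operator := fun f q1 q2 u =>
  (pd a f q1 q2 u - Ci * RtoC e * RtoC (potential mu a q1 q2 u) * f q1 q2 u)%C.

(* D_a D_b f, where the outer D_a acts on the one-form D_b f. *)
Definition Dcov2 (e mu : R) (a b : coord) : operator := fun f q1 q2 u =>
  (pd a (Dcov e mu b f) q1 q2 u
   - csum3 (fun c => RtoC (christoffel c a b q1 q2 u) * Dcov e mu c f q1 q2 u)
   - Ci * RtoC e * RtoC (potential mu a q1 q2 u) * Dcov e mu b f q1 q2 u)%C.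

(* g^{ab} D_a D_b + zeta R + m^2 with R = 6. *)
Definition KG_covariant (e mu m zeta : R) : operator := fun f q1 q2 u =>
  (csum3 (fun a => csum3 (fun b =>
     RtoC (inv_metric a b q1 q2 u) * Dcov2 e mu a b f q1 q2 u))
   + RtoC (zeta * 6 + m ^ 2) * f q1 q2 u)%C.

Definition KG (e mu m zeta : R) : operator := fun f q1 q2 u =>
  (pd U1 (pd U1 f) q1 q2 u
   + RtoC (2 * (cos u / sin u)) * pd U1 f q1 q2 u
   - RtoC (1 / (sin u) ^ 2) *
       (RtoC (1 / (cos q2) ^ 2) * pd Q1 (pd Q1 f) q1 q2 u
        - pd Q2 (pd Q2 f) q1 q2 u
        + RtoC (tan q2) * pd Q2 f q1 q2 u)
   - 2 * Ci * RtoC (e * mu * tan q2 / ((sin u) ^ 2 * cos q2)) * pd Q1 f q1 q2 u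
   + RtoC (e ^ 2 * mu ^ 2 * (tan q2) ^ 2 / (sin u) ^ 2) * f q1 q2 u
   + RtoC (6 * zeta + m ^ 2) * f q1 q2 u)%C.

Inductive gen := G1 | G2 | G3.

Definition X0 (e : R) : operator := fun f q1 q2 u => (Ci * RtoC e * f q1 q2 u)%C.

Definition X (e mu : R) (A : gen) : operator := fun f q1 q2 u =>
  match A with
  | G1 => pd Q1 f q1 q2 u
  | G2 => (RtoC (sinh q1 * tan q2) * pd Q1 f q1 q2 u
           + RtoC (cosh q1) * pd Q2 f q1 q2 u
           + Ci * RtoC (e * mu * sinh q1 / cos q2) * f q1 q2 u)%C
  | G3 => (RtoC (cosh q1 * tan q2) * pd Q1 f q1 q2 u
           + RtoC (sinh q1) * pd Q2 f q1 q2 u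
           + Ci * RtoC (e * mu * cosh q1 / cos q2) * f q1 q2 u)%C
  end.

(* Operators are identified when they agree on smooth functions on the chart. *)
Definition op_eq (A B : operator) : Prop :=
  forall f, chart_smooth f ->
  forall q1 q2 u, chart q1 q2 u -> A f q1 q2 u = B f q1 q2 u.

Definition op_zero : operator := fun f q1 q2 u => RtoC 0.
Definition op_add (A B : operator) : operator :=
  fun f q1 q2 u => (A f q1 q2 u + B f q1 q2 u)%C.
Definition op_scal (c : R) (A : operator) : operator :=
  fun f q1 q2 u => (RtoC c * A f q1 q2 u)%C.
Definition op_comm (A B : operator) : operator :=
  fun f q1 q2 u => (A (B f) q1 q2 u - B (A f) q1 q2 u)%C.

Definition X_span (e mu c0 c1 c2 c3 : R) : operator :=
  op_add (op_scal c0 (X0 e))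
    (op_add (op_scal c1 (X e mu G1))
       (op_add (op_scal c2 (X e mu G2)) (op_scal c3 (X e mu G3)))).

Definition mat3 := gen -> gen -> R.
Definition sum_gen (F : gen -> R) : R := F G1 + F G2 + F G3.
Definition mat_mul (M N : mat3) : mat3 := fun i j => sum_gen (fun k => M i k * N k j).
Definition mat_bracket (M N : mat3) : mat3 := fun i j => mat_mul M N i j - mat_mul N M i j.
Definition mat_lin (a : R) (M : mat3) (b : R) (N : mat3) : mat3 :=
  fun i j => a * M i j + b * N i j.
Definition eta12 (i : gen) : R := match i with G1 => -1 | _ => 1 end.

(* M^T eta + eta M = 0 *)
Definition so12 (M : mat3) : Prop :=
  forall i j, M j i * eta12 j + eta12 i * M i j = 0.

(* The real span of X_0, ..., X_3 under the commutator is isomorphic, through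
   Psi, to so(1,2) + R; elements of the latter are pairs (M, s), with bracket
   [(M, s), (N, t)] = ([M, N], 0). *)
Definition iso_so12_R (e mu : R) : Prop :=
  exists Psi : mat3 -> R -> operator,
    (forall a M s b N t, so12 M -> so12 N ->
       op_eq (Psi (mat_lin a M b N) (a * s + b * t))
             (op_add (op_scal a (Psi M s)) (op_scal b (Psi N t)))) /\
    (forall M s N t, so12 M -> so12 N ->
       op_eq (op_comm (Psi M s) (Psi N t)) (Psi (mat_bracket M N) 0)) /\
    (forall M s, so12 M -> op_eq (Psi M s) op_zero ->
       (forall i j, M i j = 0) /\ s = 0) /\
    (forall M s, so12 M ->
       exists c0 c1 c2 c3, op_eq (Psi M s) (X_span e mu c0 c1 c2 c3)) /\
    (forall c0 c1 c2 c3,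
       exists M s, so12 M /\ op_eq (Psi M s) (X_span e mu c0 c1 c2 c3)).

Definition loperator := (R -> C) -> R -> C.

Definition ell (J : R) (A : gen) : loperator := fun f l =>
  match A with
  | G1 => (RtoC l * CDerive f l + (Ci * RtoC J + 1 / 2) * f l)%C
  | G2 => (RtoC ((l ^ 2 + 1) / 2) * CDerive f l
           + (Ci * RtoC J + 1 / 2) * RtoC l * f l)%C
  | G3 => (RtoC ((l ^ 2 - 1) / 2) * CDerive f l
           + (Ci * RtoC J + 1 / 2) * RtoC l * f l)%C
  end.

Definition lop_eq (A B : loperator) : Prop :=
  forall f, smooth f -> forall l, A f l = B f l.
Definition lop_comm (A B : loperator) : loperator :=
  fun f l => (A (B f) l - B (A f) l)%C.

(* On test functions (smooth, with support in [-r, r]) the integral with respect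
   to d lambda over R is the Riemann integral over [-r, r]. *)
Definition skew_symmetric (L : loperator) : Prop :=
  forall f g r, smooth f -> smooth g ->
    (forall l, r < Rabs l -> f l = RtoC 0 /\ g l = RtoC 0) ->
    CInt (fun l => (Cconj (f l) * L g l)%C) (- r) r
    = (- CInt (fun l => (Cconj (L f l) * g l)%C) (- r) r)%C.

Definition diff_op (N : nat) (d : nat -> R -> C) : loperator :=
  fun f l => sum_n (fun k => (d k l * CDerive_n f k l)%C) N.

(* Operator irreducibility: the only differential operators in lambda commuting
   with the representation are the scalars. *)
Definition operator_irreducible (L : gen -> loperator) : Prop :=
  forall N d, (forall k, smooth (d k)) ->
    (forall A, lop_eq (lop_comm (diff_op N d) (L A)) (fun f l => RtoC 0)) ->
    exists c : C, lop_eq (diff_op N d) (fun f l => (c * f l)%C).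

(* Principal continuous series of SO(1,2)_0 = PSL(2,R) on functions on the line:
   (pi_J(g) f)(l) = |c l + d|^(-1-2iJ) f((a l + b)/(c l + d)),
   where (a b; c d) is the inverse of g. *)
Definition principal_series (J a b c d : R) (f : R -> C) (l : R) : C :=
  (Rcpow (Rabs (c * l + d)) (- (1 + 2 * Ci * RtoC J))
   * f ((a * l + b) / (c * l + d))%R)%C.

(* The action of the one-parameter subgroup g_A(t); for A = G1, G2, G3 the
   matrix g_A(t)^(-1) is respectively diag(e^(t/2), e^(-t/2)), a rotation and a
   boost. *)
Definition one_param (J : R) (A : gen) (t : R) : loperator :=
  match A with
  | G1 => principal_series J (exp (t / 2)) 0 0 (exp (- (t / 2)))
  | G2 => principal_series J (cos (t / 2)) (sin (t / 2)) (- sin (t / 2)) (cos (t / 2))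
  | G3 => principal_series J (cosh (t / 2)) (- sinh (t / 2)) (- sinh (t / 2)) (cosh (t / 2))
  end.

Definition continuous_series (J : R) : Prop :=
  forall A f, smooth f -> forall l,
    is_derive (V := C_R_NormedModule) (fun t => one_param J A t f l) 0 (ell J A f l).

Definition base1 (q1 q2 l : R) : R :=
  2 * l * sin q2 + (exp q1 - l ^ 2 * exp (- q1)) * cos q2.

Definition base2 (q1 q2 l : R) : R :=
  (l * exp (- q1) * cos q2 + 1 - sin q2)
  / (cos q2 - l * exp (- q1) * (1 - sin q2)).

(* The points where the bases of the two powers are finite and nonzero:
   (numerator of base2) * (denominator of base2) = (1 - sin q2) e^(-q1) base1,
   so base1 <> 0 takes care of both. *)
Definition regular (q1 q2 u l : R) : Prop := chart q1 q2 u /\ base1 q1 q2 l <> 0.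

Definition kernel (e mu J q1 q2 l : R) : C :=
  (Rcpow (base1 q1 q2 l) (- (Ci * RtoC J) - 1 / 2)
   * Rcpow (base2 q1 q2 l) (Ci * RtoC (e * mu)))%C.

Definition phiJ (e mu J : R) (Phi : R -> C) (q1 q2 u l : R) : C :=
  (Phi u * kernel e mu J q1 q2 l)%C.

(* Open sets of points (q1, q2, u, l) of the regular set whose sections
   u = const are connected. *)
Definition admissible (D : R * R * R * R -> Prop) : Prop :=
  open D /\
  (forall q1 q2 u l, D (q1, q2, u, l) -> regular q1 q2 u l) /\
  (forall u (E : R * R * R -> Prop),
     open E ->
     open (fun p : R * R * R =>
             D (fst (fst p), snd (fst p), u, snd p) /\ ~ E p) ->
     (exists q1 q2 l, D (q1, q2, u, l) /\ E (q1, q2, l)) ->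
     forall q1 q2 l, D (q1, q2, u, l) -> E (q1, q2, l)).

(* phi has the first partial derivatives that occur, and
   X_A phi = - ell_A phi on D. *)
Definition solves_system (e mu J : R) (D : R * R * R * R -> Prop)
    (phi : R -> R -> R -> R -> C) : Prop :=
  forall q1 q2 u l, D (q1, q2, u, l) ->
    ex_pd Q1 (fun q1 q2 u => phi q1 q2 u l) q1 q2 u /\
    ex_pd Q2 (fun q1 q2 u => phi q1 q2 u l) q1 q2 u /\
    ex_CDerive (phi q1 q2 u) l /\
    forall A, X e mu A (fun q1 q2 u => phi q1 q2 u l) q1 q2 u
              = (- ell J A (phi q1 q2 u) l)%C.

Definition twice_diff (Phi : R -> C) (v : R) : Prop :=
  locally v (fun w => ex_CDerive Phi w) /\ ex_CDerive (CDerive Phi) v.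

Definition reduced_eq (e mu m zeta J : R) (Phi : R -> C) (v : R) : Prop :=
  (CDerive (CDerive Phi) v
   + RtoC (2 * (cos v / sin v)) * CDerive Phi v
   + RtoC (m ^ 2 + 6 * zeta + (J ^ 2 - e ^ 2 * mu ^ 2 + 1 / 4) / (sin v) ^ 2) * Phi v
   = RtoC 0)%C.

Definition solves_reduced (e mu m zeta J : R) (Phi : R -> C) : Prop :=
  forall v, 0 < v < PI -> twice_diff Phi v /\ reduced_eq e mu m zeta J Phi v.

Definition lin_indep (f g : R -> C) : Prop :=
  forall a b : C, (forall v, 0 < v < PI -> (a * f v + b * g v)%C = RtoC 0) ->
    a = RtoC 0 /\ b = RtoC 0.

Definition deg (m zeta : R) : R := sqrt (1 + m ^ 2 + 6 * zeta) - 1 / 2.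
Definition ord (e mu J : R) : C := Rcsqrt (e ^ 2 * mu ^ 2 - J ^ 2).

Definition Phi1 (e mu m zeta J : R) (v : R) : C :=
  (RtoC (1 / sqrt (sin v)) * LegendreP (RtoC (deg m zeta)) (ord e mu J) (cos v))%C.
Definition Phi2 (e mu m zeta J : R) (v : R) : C :=
  (RtoC (1 / sqrt (sin v)) * LegendreQ (RtoC (deg m zeta)) (ord e mu J) (cos v))%C.

(* Main.v *)
(* Every commutation relation is an identity between differential polynomials in
   an unknown function, checked by computing formal derivatives and comparing
   coefficients modulo cosh^2 = 1 + sinh^2 and sec^2 = 1 + tan^2.  For (a), the
   bases B1, B2 of the two powers satisfy dlog B2 = (polynomial) / B1, so the
   kernel solves the system, and the determinant of its principal part is
   - B1 / (2 cos q2): every solution divided by the kernel is locally constant in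
   (q1, q2, lambda).  For (c), writing Phi = (sin v)^(-s-1/2) H reduces the
   equation to the hypergeometric one in cos^2 v, with one even and one odd
   solution; P and Q are combinations of these with invertible matrix as soon as
   no factor 1/Gamma vanishes. *)
Require Import Defs.
From Stdlib Require Import Lra Lia FunctionalExtensionality ClassicalEpsilon.

(** * Differentiation of complex-valued functions of a real variable *)

(** The bases of the two powers may be negative. On nonzero reals the argument of the principal
    logarithm is locally constant, so one formula differentiates powers of either sign, and powers
    never vanish, so dividing by the kernel is always allowed.

    No equation of the system contains a derivative in u. Hence each section u = const is treated
    separately, [Phi] carries no regularity, and connected sections are what the domain has to
    provide.

    In (b) the angular part acts on the kernel as the scalar -a(a+1) + b^2, where a = -iJ - 1/2 and
    b = i e mu are the two exponents; this is J^2 + 1/4 - e^2 mu^2.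

    In (c) the order sigma is real or purely imaginary, and the even and odd solutions cover all
    cases at once. Since nu >= 1/2 and Re sigma >= 0, the Gamma arguments containing nu + sigma have
    positive real part; those containing nu - sigma meet a pole exactly when sigma = nu + 1 + k,
    which independence excludes. That 1/Gamma is nonzero elsewhere is derived from Gauss's limit,
    whose successive quotients are 1 + O(1/n^2). *)

Ltac eqR := match goal with |- @eq _ ?a ?b => change (@eq R a b) end.
Ltac eqC := match goal with |- @eq _ ?a ?b => change (@eq C a b) end.

(** Working componentwise makes the real differentiation lemmas available for both parts. *)
Definition is_CDerive (f : R -> C) (x : R) (l : C) : Prop :=
  is_derive (fun t => Re (f t)) x (Re l) /\ is_derive (fun t => Im (f t)) x (Im l).

(** The bridge to the derivative in the normed module C, in which [ex_CDerive] and
    [continuous_series] are stated. *)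
Lemma is_CDerive_iff (f : R -> C) (x : R) (l : C) :
  is_CDerive f x l <-> is_derive (V := C_R_NormedModule) f x l.
Proof.
  split.
  - intros [Hr Hi].
    (* Pairing is linear, so it is its own differential; it is then composed with the real and
       imaginary parts of [f]. *)
    assert (Hp : filterdiff (K := R_AbsRing) (U := prod_NormedModule R_AbsRing R_NormedModule R_NormedModule)
       (V := C_R_NormedModule)
       (fun c : R * R => (fst c, snd c) : C)
       (locally (Re (f x), Im (f x))) (fun c : R * R => (fst c, snd c) : C)).
    { apply (filterdiff_ext_lin _ (fun c => c)).
      - eapply filterdiff_ext; [ | apply filterdiff_id ].
        intros [a b]; reflexivity.
      - intros [a b]; reflexivity. }
    pose proof (filterdiff_comp'_2 _ _ _ _ _ _ (fun a b : R => (a, b) : C) Hr Hi Hp) as H.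
    unfold is_derive.
    eapply filterdiff_ext_lin.
    + eapply filterdiff_ext; [ | exact H ].
      intros y; symmetry; exact (surjective_pairing (f y)).
    + intros y; destruct l; reflexivity.
  - intros H; split.
    + pose proof (filterdiff_comp' f (fun c : C => Re c) x _ (fun c : C => Re c) H
        (filterdiff_linear _ (is_linear_fst (K := R_AbsRing) (U := R_NormedModule) (V := R_NormedModule)))) as H1.
      eapply filterdiff_ext_lin; [ exact H1 | intros y; reflexivity ].
    + pose proof (filterdiff_comp' f (fun c : C => Im c) x _ (fun c : C => Im c) H
        (filterdiff_linear _ (is_linear_snd (K := R_AbsRing) (U := R_NormedModule) (V := R_NormedModule)))) as H1.
      eapply filterdiff_ext_lin; [ exact H1 | intros y; reflexivity ].
Qed.

Lemma is_CDerive_unique f x l : is_CDerive f x l -> CDerive f x = l.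
Proof.
  intros [H1 H2]; unfold CDerive.
  apply injective_projections; simpl; now apply is_derive_unique.
Qed.

Lemma is_CDerive_ex f x l : is_CDerive f x l -> ex_CDerive f x.
Proof. intros H; exists l; now apply is_CDerive_iff. Qed.

Lemma ex_CDerive_correct f x : ex_CDerive f x -> is_CDerive f x (CDerive f x).
Proof.
  intros [l Hl]; apply is_CDerive_iff in Hl.
  now rewrite (is_CDerive_unique _ _ _ Hl).
Qed.

Lemma is_CDerive_eq f x l l' : is_CDerive f x l -> l = l' -> is_CDerive f x l'.
Proof. now intros H <-. Qed.

Lemma is_CDerive_ext_loc f g x l :
  locally x (fun t => f t = g t) -> is_CDerive f x l -> is_CDerive g x l.
Proof.
  intros H [H1 H2]; split.
  - apply is_derive_ext_loc with (2 := H1); revert H; apply filter_imp; now intros t ->.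
  - apply is_derive_ext_loc with (2 := H2); revert H; apply filter_imp; now intros t ->.
Qed.

Lemma is_CDerive_ext f g x l :
  (forall t, f t = g t) -> is_CDerive f x l -> is_CDerive g x l.
Proof. intros H; apply is_CDerive_ext_loc; now apply filter_forall. Qed.

Lemma CDerive_ext_loc f g x :
  locally x (fun t => f t = g t) -> CDerive f x = CDerive g x.
Proof.
  intros H; unfold CDerive; f_equal; apply Derive_ext_loc;
  revert H; apply filter_imp; now intros t ->.
Qed.

Lemma is_CDerive_const (c : C) x : is_CDerive (fun _ => c) x 0.
Proof. split; simpl; apply (is_derive_const (V := R_NormedModule)). Qed.

Lemma is_CDerive_RtoC (f : R -> R) x l :
  is_derive f x l -> is_CDerive (fun t => RtoC (f t)) x (RtoC l).
Proof. split; simpl; [ exact H | apply (is_derive_const (V := R_NormedModule)) ]. Qed.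

Lemma is_CDerive_plus f g x lf lg :
  is_CDerive f x lf -> is_CDerive g x lg ->
  is_CDerive (fun t => (f t + g t)%C) x (lf + lg)%C.
Proof.
  intros [H1 H2] [H3 H4]; split; simpl.
  - exact (is_derive_plus (V := R_NormedModule) _ _ _ _ _ H1 H3).
  - exact (is_derive_plus (V := R_NormedModule) _ _ _ _ _ H2 H4).
Qed.

Lemma is_derive_Rmult (f g : R -> R) x lf lg :
  is_derive f x lf -> is_derive g x lg ->
  is_derive (fun t => f t * g t) x (lf * g x + f x * lg).
Proof.
  intros H1 H2.
  apply (is_derive_mult f g x lf lg H1 H2); intros; apply Rmult_comm.
Qed.

Lemma is_CDerive_mult f g x lf lg :
  is_CDerive f x lf -> is_CDerive g x lg ->
  is_CDerive (fun t => (f t * g t)%C) x (lf * g x + f x * lg)%C.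
Proof.
  intros [H1 H2] [H3 H4]; split; simpl.
  - evar_last.
    + exact (is_derive_minus (V := R_NormedModule) _ _ _ _ _
        (is_derive_Rmult _ _ _ _ _ H1 H3) (is_derive_Rmult _ _ _ _ _ H2 H4)).
    + unfold minus, plus, opp; simpl; unfold Re, Im; ring.
  - evar_last.
    + exact (is_derive_plus (V := R_NormedModule) _ _ _ _ _
        (is_derive_Rmult _ _ _ _ _ H1 H4) (is_derive_Rmult _ _ _ _ _ H2 H3)).
    + unfold minus, plus, opp; simpl; unfold Re, Im; ring.
Qed.

Lemma is_CDerive_scal (c : C) f x l :
  is_CDerive f x l -> is_CDerive (fun t => (c * f t)%C) x (c * l)%C.
Proof.
  intros H; eapply is_CDerive_eq.
  - exact (is_CDerive_mult _ _ _ _ _ (is_CDerive_const c x) H).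
  - simpl; ring.
Qed.

Lemma is_CDerive_opp f x l :
  is_CDerive f x l -> is_CDerive (fun t => (- f t)%C) x (- l)%C.
Proof.
  intros H; apply is_CDerive_ext with (fun t => (- (1) * f t)%C).
  - intros t; ring.
  - eapply is_CDerive_eq; [ exact (is_CDerive_scal _ _ _ _ H) | ring ].
Qed.

Lemma is_CDerive_minus f g x lf lg :
  is_CDerive f x lf -> is_CDerive g x lg ->
  is_CDerive (fun t => (f t - g t)%C) x (lf - lg)%C.
Proof. intros H1 H2; apply is_CDerive_plus; [ exact H1 | now apply is_CDerive_opp ]. Qed.

Lemma is_CDerive_comp (f : R -> C) (g : R -> R) x lf lg :
  is_CDerive f (g x) lf -> is_derive g x lg ->
  is_CDerive (fun t => f (g t)) x (RtoC lg * lf)%C.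
Proof.
  intros [H1 H2] H; split.
  - evar_last; [ exact (is_derive_comp (V := R_NormedModule) (fun t => Re (f t)) g _ _ _ H1 H) | ].
    change (lg * fst lf = lg * fst lf - 0 * snd lf); ring.
  - evar_last; [ exact (is_derive_comp (V := R_NormedModule) (fun t => Im (f t)) g _ _ _ H2 H) | ].
    change (lg * snd lf = lg * snd lf + 0 * fst lf); ring.
Qed.

(** * Complex exponential, logarithm and powers of real bases *)

Lemma Cexp_plus z w : Cexp (z + w) = (Cexp z * Cexp w)%C.
Proof.
  unfold Cexp; apply injective_projections; simpl;
  rewrite exp_plus, ?cos_plus, ?sin_plus; unfold Re, Im; ring.
Qed.

Lemma Cexp_0 : Cexp 0 = 1.
Proof.
  unfold Cexp; simpl; rewrite exp_0, cos_0, sin_0.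
  apply injective_projections; simpl; ring.
Qed.

Lemma Cexp_neq_0 z : Cexp z <> 0.
Proof.
  intros H.
  assert (H1 : (Cexp (z + - z) = 0)%C) by (rewrite Cexp_plus, H; ring).
  replace (z + - z)%C with (RtoC 0) in H1 by ring.
  rewrite Cexp_0 in H1; apply RtoC_inj in H1; lra.
Qed.

Lemma is_CDerive_Cexp f x l :
  is_CDerive f x l -> is_CDerive (fun t => Cexp (f t)) x (l * Cexp (f x))%C.
Proof.
  intros [H1 H2].
  assert (He : is_derive (fun t => exp (Re (f t))) x (Re l * exp (Re (f x)))).
  { evar_last; [ exact (is_derive_comp (V := R_NormedModule) exp _ _ _ _ (is_derive_exp _) H1) | reflexivity ]. }
  assert (Hc : is_derive (fun t => cos (Im (f t))) x (Im l * - sin (Im (f x)))).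
  { evar_last; [ exact (is_derive_comp (V := R_NormedModule) cos _ _ _ _ (is_derive_cos _) H2) | reflexivity ]. }
  assert (Hs : is_derive (fun t => sin (Im (f t))) x (Im l * cos (Im (f x)))).
  { evar_last; [ exact (is_derive_comp (V := R_NormedModule) sin _ _ _ _ (is_derive_sin _) H2) | reflexivity ]. }
  split; simpl.
  - evar_last; [ exact (is_derive_Rmult _ _ _ _ _ He Hc) | ].
    unfold Re, Im; ring.
  - evar_last; [ exact (is_derive_Rmult _ _ _ _ _ He Hs) | ].
    unfold Re, Im; ring.
Qed.

Lemma is_derive_ln_Rabs x : x <> 0 -> is_derive (fun t => ln (Rabs t)) x (/ x).
Proof.
  intros Hx. destruct (Rlt_or_le x 0) as [H|H].
  - apply is_derive_ext_loc with (fun t => ln (- t)).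
    + assert (He : 0 < - x) by lra.
      exists (mkposreal _ He); intros y Hy.
      rewrite Rabs_left; auto.
      unfold ball in Hy; simpl in Hy; unfold AbsRing_ball, abs, minus, plus, opp in Hy; simpl in Hy.
      apply Rabs_def2 in Hy; lra.
    + auto_derive; [ lra | field; lra ].
  - apply is_derive_ext_loc with (fun t => ln t).
    + assert (He : 0 < x) by lra.
      exists (mkposreal _ He); intros y Hy.
      rewrite Rabs_right; auto.
      unfold ball in Hy; simpl in Hy; unfold AbsRing_ball, abs, minus, plus, opp in Hy; simpl in Hy.
      apply Rabs_def2 in Hy; lra.
    + auto_derive; [ lra | field; lra ].
Qed.

(** Near a nonzero point the sign does not change, so the imaginary part, 0 or pi, is locally
    constant and only ln |x| contributes. *)
Lemma is_CDerive_Rlog x : x <> 0 -> is_CDerive Rlog x (RtoC (/ x)).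
Proof.
  intros Hx; split; simpl.
  - now apply is_derive_ln_Rabs.
  - apply is_derive_ext_loc with (fun _ => if Rlt_dec x 0 then PI else 0).
    + assert (He : 0 < Rabs x) by now apply Rabs_pos_lt.
      exists (mkposreal _ He); intros y Hy.
      unfold ball in Hy; simpl in Hy; unfold AbsRing_ball, abs, minus, plus, opp in Hy; simpl in Hy.
      apply Rabs_def2 in Hy.
      destruct (Rlt_dec x 0), (Rlt_dec y 0); auto; exfalso.
      * rewrite Rabs_left in Hy; lra.
      * rewrite Rabs_right in Hy; lra.
    + apply (is_derive_const (V := R_NormedModule)).
Qed.

Lemma is_CDerive_Rcpow (g : R -> R) x lg w :
  is_derive g x lg -> g x <> 0 ->
  is_CDerive (fun t => Rcpow (g t) w) x (w * RtoC (lg / g x) * Rcpow (g x) w)%C.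
Proof.
  intros Hg H0; unfold Rcpow.
  eapply is_CDerive_eq.
  - apply is_CDerive_Cexp, is_CDerive_mult; [ apply is_CDerive_const | ].
    apply (is_CDerive_comp Rlog g); [ now apply is_CDerive_Rlog | exact Hg ].
  - simpl; unfold Rdiv; rewrite RtoC_mult; ring.
Qed.

Lemma Rcpow_neq_0 x w : Rcpow x w <> 0.
Proof. apply Cexp_neq_0. Qed.

Lemma Cmult_integral (x y : C) : (x * y)%C = 0 -> x = 0 \/ y = 0.
Proof.
  intros H; destruct (Ceq_dec x 0) as [E|E]; auto.
  destruct (Ceq_dec y 0) as [E'|E']; auto.
  exfalso; exact (Cmult_neq_0 _ _ E E' H).
Qed.

(** * The representation on functions of lambda *)

(** A function together with all its derivatives. Exhibiting the sequence proves smoothness and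
    computes [CDerive_n] at the same time. *)
Definition has_derivs (f : R -> C) (F : nat -> R -> C) : Prop :=
  (forall x, F 0%nat x = f x) /\ forall n x, is_CDerive (F n) x (F (S n) x).

Lemma has_derivs_Derive_n f F : has_derivs f F -> forall n x,
  Derive_n (fun t => Re (f t)) n x = Re (F n x) /\
  Derive_n (fun t => Im (f t)) n x = Im (F n x).
Proof.
  intros [H0 H] n; induction n as [|n IH]; intros x.
  - simpl; now rewrite H0.
  - destruct (H n x) as [H1 H2].
    simpl; split.
    + rewrite (Derive_ext _ (fun t => Re (F n t))); [ now apply is_derive_unique | ].
      intros t; apply IH.
    + rewrite (Derive_ext _ (fun t => Im (F n t))); [ now apply is_derive_unique | ].
      intros t; apply IH.
Qed.

Lemma has_derivs_smooth f F : has_derivs f F -> smooth f.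
Proof.
  intros HF n x; destruct n as [|n]; [ split; exact I | ].
  destruct (proj2 HF n x) as [H1 H2].
  pose proof (has_derivs_Derive_n f F HF n) as E.
  split; simpl.
  - exists (Re (F (S n) x)); eapply is_derive_ext; [ | exact H1 ]; intros t; symmetry; apply E.
  - exists (Im (F (S n) x)); eapply is_derive_ext; [ | exact H2 ]; intros t; symmetry; apply E.
Qed.

Lemma has_derivs_CDerive_n f F n x : has_derivs f F -> CDerive_n f n x = F n x.
Proof.
  intros HF; destruct (has_derivs_Derive_n f F HF n x) as [H1 H2].
  unfold CDerive_n; rewrite H1, H2; now destruct (F n x).
Qed.

Lemma smooth_has_derivs f : smooth f -> has_derivs f (CDerive_n f).
Proof.
  intros Hf; split.
  - intros x; unfold CDerive_n; simpl; now destruct (f x).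
  - intros n x; destruct (Hf (S n) x) as [H1 H2]; split; simpl;
      now apply (Derive_correct (Derive_n _ n)).
Qed.

Lemma CDerive_n_0 f x : CDerive_n f 0 x = f x.
Proof. unfold CDerive_n; simpl; now destruct (f x). Qed.

Lemma smooth_is_CDerive f x : smooth f -> is_CDerive f x (CDerive f x).
Proof.
  intros Hf; pose proof (proj2 (smooth_has_derivs f Hf) 0%nat x) as H.
  eapply is_CDerive_ext; [ | exact H ]; apply CDerive_n_0.
Qed.

Lemma has_derivs_CDerive f F : has_derivs f F -> has_derivs (CDerive f) (fun n => F (S n)).
Proof.
  intros [H0 H]; split; [ | intros n; apply (H (S n)) ].
  intros x; symmetry; apply is_CDerive_unique.
  eapply is_CDerive_ext; [ apply H0 | apply H ].
Qed.

Lemma smooth_CDerive f : smooth f -> smooth (CDerive f).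
Proof.
  intros Hf; exact (has_derivs_smooth _ _ (has_derivs_CDerive _ _ (smooth_has_derivs f Hf))).
Qed.

Lemma has_derivs_plus f F g G : has_derivs f F -> has_derivs g G ->
  has_derivs (fun x => f x + g x)%C (fun n x => F n x + G n x)%C.
Proof.
  intros [H0 H] [H0' H']; split.
  - intros x; now rewrite H0, H0'.
  - intros n x; now apply is_CDerive_plus.
Qed.

Lemma has_derivs_scal c f F : has_derivs f F ->
  has_derivs (fun x => c * f x)%C (fun n x => c * F n x)%C.
Proof.
  intros [H0 H]; split.
  - intros x; now rewrite H0.
  - intros n x; now apply is_CDerive_scal.
Qed.

(** Leibniz's rule for a linear factor: (x f)^(n) = x f^(n) + n f^(n-1). At n = 0 the term in
    [F (pred 0)] has coefficient 0. *)
Lemma has_derivs_mul_id f F : has_derivs f F ->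
  has_derivs (fun x => RtoC x * f x)%C
    (fun n x => RtoC x * F n x + RtoC (INR n) * F (pred n) x)%C.
Proof.
  intros [H0 H]; split.
  - intros x; rewrite H0; simpl; ring.
  - intros n x.
    assert (Hid : is_CDerive (fun t => RtoC t) x (RtoC 1)).
    { apply is_CDerive_RtoC, (is_derive_id (K := R_AbsRing)). }
    apply is_CDerive_eq with
      ((1 * F n x + RtoC x * F (S n) x) + RtoC (INR n) * F n x)%C.
    + apply is_CDerive_plus.
      * exact (is_CDerive_mult _ _ _ _ _ Hid (H n x)).
      * destruct n as [|n].
        -- eapply is_CDerive_ext; [ | eapply is_CDerive_eq; [ exact (is_CDerive_const 0%C x) | ] ].
           ++ intros t; simpl; ring.
           ++ simpl; ring.
        -- simpl pred; apply is_CDerive_scal, (H n x).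
    + rewrite S_INR, RtoC_plus; simpl pred; ring.
Qed.

Lemma smooth_ext f g : (forall x, f x = g x) -> smooth f -> smooth g.
Proof. intros E; replace g with f; auto; now apply functional_extensionality. Qed.

Lemma smooth_plus f g : smooth f -> smooth g -> smooth (fun x => f x + g x)%C.
Proof.
  intros Hf Hg.
  exact (has_derivs_smooth _ _ (has_derivs_plus _ _ _ _ (smooth_has_derivs _ Hf) (smooth_has_derivs _ Hg))).
Qed.

Lemma smooth_scal c f : smooth f -> smooth (fun x => c * f x)%C.
Proof.
  intros Hf; exact (has_derivs_smooth _ _ (has_derivs_scal c _ _ (smooth_has_derivs _ Hf))).
Qed.

Lemma smooth_mul_id f : smooth f -> smooth (fun x => RtoC x * f x)%C.
Proof.
  intros Hf; exact (has_derivs_smooth _ _ (has_derivs_mul_id _ _ (smooth_has_derivs _ Hf))).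
Qed.

(** Each [ell J A] has the form v d/dl + w v', where v is [ell_vec A], v' is [ell_div A] and w is
    [ell_weight J]: the Lie derivative along v on densities of weight w = iJ + 1/2. Commutators and
    skew-symmetry follow from this form for all three generators together. *)
Definition ell_vec (A : gen) (l : R) : R :=
  match A with G1 => l | G2 => (l ^ 2 + 1) / 2 | G3 => (l ^ 2 - 1) / 2 end.

Definition ell_div (A : gen) (l : R) : R :=
  match A with G1 => 1 | G2 => l | G3 => l end.

Definition ell_weight (J : R) : C := (Ci * RtoC J + 1 / 2)%C.

Lemma ell_expand J A f l :
  ell J A f l = (RtoC (ell_vec A l) * CDerive f l
                 + ell_weight J * RtoC (ell_div A l) * f l)%C.
Proof. destruct A; unfold ell, ell_vec, ell_div, ell_weight; try reflexivity; ring. Qed.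

Lemma is_derive_ell_vec A l : is_derive (fun t => ell_vec A t) l (ell_div A l).
Proof. destruct A; simpl; auto_derive; auto; field. Qed.

Definition ell_div' (A : gen) : R := match A with G1 => 0 | _ => 1 end.

Lemma is_derive_ell_div A l : is_derive (fun t => ell_div A t) l (ell_div' A).
Proof. destruct A; simpl; auto_derive; auto; field. Qed.

Lemma CDerive_ell J A f l : smooth f ->
  CDerive (ell J A f) l =
  (RtoC (ell_vec A l) * CDerive (CDerive f) l + RtoC (ell_div A l) * CDerive f l
   + ell_weight J * (RtoC (ell_div A l) * CDerive f l + RtoC (ell_div' A) * f l))%C.
Proof.
  intros Hf; apply is_CDerive_unique.
  apply is_CDerive_ext with
    (fun l => (RtoC (ell_vec A l) * CDerive f l
                 + ell_weight J * (RtoC (ell_div A l) * f l))%C).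
  { intros t; rewrite ell_expand; ring. }
  eapply is_CDerive_eq.
  - apply is_CDerive_plus.
    + apply is_CDerive_mult.
      * apply is_CDerive_RtoC, is_derive_ell_vec.
      * apply smooth_is_CDerive, smooth_CDerive, Hf.
    + apply is_CDerive_scal, is_CDerive_mult.
      * apply is_CDerive_RtoC, is_derive_ell_div.
      * apply smooth_is_CDerive, Hf.
  - simpl; ring.
Qed.

(** The commutator of two Lie derivatives is the Lie derivative along the bracket [c] of the vector
    fields. The left side of the second hypothesis is the derivative of [c]. *)
Lemma ell_comm J A B G (c := fun l => ell_vec A l * ell_div B l - ell_vec B l * ell_div A l) :
  (forall l, c l = ell_vec G l) ->
  (forall l, ell_vec A l * ell_div' B - ell_vec B l * ell_div' A = ell_div G l) ->
  lop_eq (lop_comm (ell J A) (ell J B)) (ell J G).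
Proof.
  intros H1 H2 f Hf l; unfold lop_comm.
  rewrite !ell_expand, !CDerive_ell by exact Hf.
  rewrite <- H1, <- H2; unfold c.
  rewrite !RtoC_minus, !RtoC_mult; ring.
Qed.

Lemma ell_comm_12 J : lop_eq (lop_comm (ell J G1) (ell J G2)) (ell J G3).
Proof. apply ell_comm; intros l; simpl; field. Qed.
Lemma ell_comm_13 J : lop_eq (lop_comm (ell J G1) (ell J G3)) (ell J G2).
Proof. apply ell_comm; intros l; simpl; field. Qed.
Lemma ell_comm_23 J : lop_eq (lop_comm (ell J G2) (ell J G3)) (ell J G1).
Proof. apply ell_comm; intros l; simpl; field. Qed.

Lemma smooth_ell J A f : smooth f -> smooth (ell J A f).
Proof.
  intros Hf; pose proof (smooth_CDerive f Hf) as Hf'.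
  (* The values s = 1/2 and s = -1/2 give [ell J G2] and [ell J G3]. *)
  assert (Hs : forall s : C, smooth (fun l => RtoC l * (RtoC l * (/ 2 * CDerive f l))
              + (s * CDerive f l) + ell_weight J * (RtoC l * f l))%C).
  { intros s.
    exact (smooth_plus _ _ (smooth_plus _ _
      (smooth_mul_id _ (smooth_mul_id _ (smooth_scal (/ 2) _ Hf'))) (smooth_scal s _ Hf'))
      (smooth_scal (ell_weight J) _ (smooth_mul_id _ Hf))). }
  destruct A.
  - exact (smooth_plus _ _ (smooth_mul_id _ Hf') (smooth_scal _ _ Hf)).
  - eapply smooth_ext; [ | exact (Hs (/ 2)%C) ].
    intros x; simpl; unfold ell_weight, Rdiv; rewrite RtoC_mult, RtoC_plus, RtoC_inv, !RtoC_mult by lra; ring.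
  - eapply smooth_ext; [ | exact (Hs (- / 2)%C) ].
    intros x; simpl; unfold ell_weight, Rdiv; rewrite RtoC_mult, RtoC_minus, RtoC_inv, !RtoC_mult by lra; ring.
Qed.

Lemma ell_diff J f l : (ell J G2 f l - ell J G3 f l)%C = CDerive f l.
Proof.
  rewrite !ell_expand; simpl.
  replace (RtoC ((l * (l * 1) + 1) / 2)) with (RtoC ((l * (l * 1) - 1) / 2) + 1)%C; [ ring | ].
  rewrite <- RtoC_plus; f_equal; field.
Qed.

(** * Operator irreducibility through symbols of differential operators *)

Lemma sum_n_C_ext (a b : nat -> C) N : (forall k, (k <= N)%nat -> a k = b k) -> sum_n a N = sum_n b N.
Proof. apply sum_n_ext_loc. Qed.

Lemma sum_n_C_plus (a b : nat -> C) N :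
  sum_n (fun k => (a k + b k)%C) N = (sum_n a N + sum_n b N)%C.
Proof. exact (sum_n_plus (G := C_AbelianMonoid) a b N). Qed.

Lemma sum_n_C_scal (c : C) (a : nat -> C) N :
  sum_n (fun k => (c * a k)%C) N = (c * sum_n a N)%C.
Proof. exact (sum_n_mult_l (K := C_Ring) c a N). Qed.

Lemma sum_n_C_S (a : nat -> C) N : sum_n a (S N) = (sum_n a N + a (S N))%C.
Proof. exact (sum_Sn (G := C_AbelianMonoid) a N). Qed.

Lemma diff_op_plus N d f g : smooth f -> smooth g -> forall l,
  diff_op N d (fun x => f x + g x)%C l = (diff_op N d f l + diff_op N d g l)%C.
Proof.
  intros Hf Hg l; unfold diff_op; rewrite <- sum_n_C_plus.
  apply sum_n_C_ext; intros k _.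
  rewrite (has_derivs_CDerive_n _ _ k l
    (has_derivs_plus _ _ _ _ (smooth_has_derivs _ Hf) (smooth_has_derivs _ Hg))); ring.
Qed.

Lemma diff_op_scal N d c f : smooth f -> forall l,
  diff_op N d (fun x => c * f x)%C l = (c * diff_op N d f l)%C.
Proof.
  intros Hf l; unfold diff_op; rewrite <- sum_n_C_scal.
  apply sum_n_C_ext; intros k _.
  rewrite (has_derivs_CDerive_n _ _ k l (has_derivs_scal c _ _ (smooth_has_derivs _ Hf))); ring.
Qed.

(* Eliminating the top coefficient by comparing the values at s and 2 s. *)
Lemma poly_zero N (c : nat -> C) :
  (forall s : R, sum_n (fun k => (c k * RtoC (s ^ k))%C) N = RtoC 0) ->
  forall k, (k <= N)%nat -> c k = 0.
Proof.
  revert c; induction N as [|N IH]; intros c H k Hk.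
  - specialize (H 1); rewrite sum_O in H; replace k with 0%nat by lia.
    simpl in H; rewrite <- H; ring.
  - assert (Hlow : forall k, (k <= N)%nat -> c k = 0).
    { intros j Hj.
      (* The value at 2s minus 2^(N+1) times the value at s is a polynomial of degree at most N with
         these coefficients; the factor 2^j - 2^(N+1) is nonzero for j <= N. *)
      assert (E : (c j * RtoC (2 ^ j - 2 ^ S N))%C = 0).
      { apply (IH (fun j => (c j * RtoC (2 ^ j - 2 ^ S N))%C)); [ | exact Hj ].
        intros s; pose proof (H s) as E1; pose proof (H (2 * s)) as E2.
        rewrite sum_n_C_S in E1, E2.
        replace (RtoC 0) with
          ((RtoC 0) - RtoC (2 ^ S N) * (RtoC 0))%C by ring.
        rewrite <- E2 at 1; rewrite <- E1.
        transitivity (sum_n (fun k => (c k * RtoC ((2 * s) ^ k) +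
            (- RtoC (2 ^ S N)) * (c k * RtoC (s ^ k)))%C) N).
        - apply sum_n_C_ext; intros i _.
          rewrite Rpow_mult_distr, RtoC_minus, RtoC_mult; ring.
        - rewrite sum_n_C_plus, sum_n_C_scal, Rpow_mult_distr, RtoC_mult; eqC; ring. }
      apply Cmult_integral in E; destruct E as [E|E]; auto.
      apply RtoC_inj in E.
      assert (2 ^ j < 2 ^ S N) by (apply Rlt_pow; [ lra | lia ]); lra. }
    destruct (Nat.eq_dec k (S N)) as [->|Hne]; [ | apply Hlow; lia ].
    pose proof (H 1) as E; rewrite sum_n_C_S in E.
    rewrite (sum_n_C_ext _ (fun k => (0 * RtoC 1)%C)) in E.
    2:{ intros i Hi; rewrite Hlow by lia; rewrite pow1; ring. }
    rewrite sum_n_C_scal, pow1 in E.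
    rewrite <- E; ring.
Qed.

Lemma has_derivs_exp (s : R) :
  has_derivs (fun x => RtoC (exp (s * x))) (fun n x => RtoC (s ^ n) * RtoC (exp (s * x)))%C.
Proof.
  split.
  - intros x; simpl; ring.
  - intros n x; eapply is_CDerive_eq.
    + apply is_CDerive_scal, is_CDerive_RtoC.
      instantiate (1 := s * exp (s * x)); auto_derive; auto; ring.
    + simpl; rewrite !RtoC_mult; ring.
Qed.

Lemma RtoC_exp_neq_0 x : RtoC (exp x) <> 0.
Proof. intros H; apply RtoC_inj in H; pose proof (exp_pos x); lra. Qed.

Lemma is_CDerive_sum_n (F : nat -> R -> C) (L : nat -> C) x N :
  (forall k, (k <= N)%nat -> is_CDerive (F k) x (L k)) ->
  is_CDerive (fun t => sum_n (fun k => F k t) N) x (sum_n L N).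
Proof.
  induction N as [|N IH]; intros H.
  - rewrite sum_O; eapply is_CDerive_ext; [ | apply H; lia ].
    intros t; now rewrite sum_O.
  - rewrite sum_n_C_S; eapply is_CDerive_ext.
    + intros t; symmetry; apply sum_n_C_S.
    + apply is_CDerive_plus; [ apply IH; intros; apply H; lia | apply H; lia ].
Qed.

Lemma CDerive_0_const (f : R -> C) :
  (forall x, is_CDerive f x 0) -> forall x y, f x = f y.
Proof.
  intros H x y; apply injective_projections.
  - destruct (Rtotal_order x y) as [Hxy|[->|Hxy]]; auto;
    [ | symmetry ]; apply (eq_is_derive (V := R_NormedModule) (fun t => fst (f t))); auto;
    intros t _; apply (proj1 (H t)).
  - destruct (Rtotal_order x y) as [Hxy|[->|Hxy]]; auto;
    [ | symmetry ]; apply (eq_is_derive (V := R_NormedModule) (fun t => snd (f t))); auto;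
    intros t _; apply (proj2 (H t)).
Qed.

(* Commuting with [ell G2 - ell G3] (a derivation in l) makes the coefficients
   constant, and commuting with the Euler operator [ell G1] then kills all those
   of positive order; both are read off the symbol by testing on e^(s l). *)
Lemma ell_irreducible J : operator_irreducible (ell J).
Proof.
  intros N d Hd Hcomm.
  assert (HD : forall f, smooth f -> forall l,
     diff_op N d (CDerive f) l = CDerive (diff_op N d f) l).
  { intros f Hf l.
    pose proof (Hcomm G2 f Hf l) as E2; pose proof (Hcomm G3 f Hf l) as E3.
    unfold lop_comm in E2, E3.
    replace (CDerive f) with (fun x => ell J G2 f x + - (1) * ell J G3 f x)%C.
    2:{ apply functional_extensionality; intros x; rewrite <- (ell_diff J f x); ring. }
    rewrite (diff_op_plus N d _ _ (smooth_ell J G2 f Hf) (smooth_scal (- (1)) _ (smooth_ell J G3 f Hf))).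
    rewrite (diff_op_scal N d (- (1)) _ (smooth_ell J G3 f Hf)).
    rewrite <- (ell_diff J (diff_op N d f) l).
    assert (E : forall a b c g : C, (a - b)%C = 0 -> (c - g)%C = 0 -> (a + - (1) * c)%C = (b - g)%C).
    { intros a b c g Ha Hc; replace a with ((a - b) + b)%C by ring.
      replace c with ((c - g) + g)%C by ring; rewrite Ha, Hc; ring. }
    now apply E. }
  set (g := fun s x : R => RtoC (exp (s * x))).
  assert (Hg : forall s, smooth (g s)) by (intros s; exact (has_derivs_smooth _ _ (has_derivs_exp s))).
  assert (Hgn : forall s n x, CDerive_n (g s) n x = (RtoC (s ^ n) * g s x)%C).
  { intros s n x; exact (has_derivs_CDerive_n _ _ n x (has_derivs_exp s)). }
  assert (HDg : forall s l, diff_op N d (g s) l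
      = (sum_n (fun k => d k l * RtoC (s ^ k))%C N * g s l)%C).
  { intros s l; unfold diff_op; rewrite Cmult_comm, <- sum_n_C_scal.
    apply sum_n_C_ext; intros k _; rewrite Hgn; ring. }
  assert (Hg1 : forall s, CDerive (g s) = (fun x => RtoC s * g s x)%C).
  { intros s; apply functional_extensionality; intros x.
    pose proof (Hgn s 1%nat x) as E; simpl pow in E; rewrite Rmult_1_r in E; exact E. }
  assert (Hconst : forall k, (k <= N)%nat -> forall l, is_CDerive (d k) l 0).
  { intros k Hk l.
    assert (E : CDerive (d k) l = 0).
    (* On e^(sl), D(f') and (Df)' share the term s times the symbol; what remains is the symbol with
       coefficients d_k'. *)
    { apply (poly_zero N (fun k => CDerive (d k) l)); auto; intros s.
      assert (E1 : CDerive (diff_op N d (g s)) l =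
         (sum_n (fun k => CDerive (d k) l * RtoC (s ^ k))%C N * g s l
          + sum_n (fun k => d k l * RtoC (s ^ k))%C N * (RtoC s * g s l))%C).
      { apply is_CDerive_unique; eapply is_CDerive_ext; [ intros t; symmetry; apply HDg | ].
        apply is_CDerive_mult.
        - apply (is_CDerive_sum_n (fun k t => (d k t * RtoC (s ^ k))%C)); intros j _.
          eapply is_CDerive_eq.
          + apply is_CDerive_mult; [ apply smooth_is_CDerive, Hd | apply is_CDerive_const ].
          + simpl; ring.
        - pose proof (smooth_is_CDerive _ l (Hg s)) as E; rewrite Hg1 in E; exact E. }
      pose proof (HD (g s) (Hg s) l) as E2.
      rewrite E1, Hg1, diff_op_scal, HDg in E2 by apply Hg.
      assert (E3 : (sum_n (fun k => CDerive (d k) l * RtoC (s ^ k))%C N * g s l)%C = 0).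
      { match goal with |- ?u = _ => match type of E2 with _ = (_ + ?w)%C =>
          replace u with ((u + w) - w)%C by ring; rewrite <- E2; ring end end. }
      apply Cmult_integral in E3; destruct E3 as [E3|E3]; auto.
      exfalso; exact (RtoC_exp_neq_0 _ E3). }
    rewrite <- E; apply smooth_is_CDerive, Hd. }
  assert (Hzero : forall k, (1 <= k <= N)%nat -> forall l, d k l = 0).
  { intros k Hk l.
    assert (E : (RtoC (INR k) * d k l)%C = 0).
    { apply (poly_zero N (fun k => RtoC (INR k) * d k l)%C); [ | lia ]; intros s.
      pose proof (Hcomm G1 (g s) (Hg s) l) as E; unfold lop_comm in E.
      rewrite (ell_expand J G1 (diff_op N d (g s)) l) in E.
      rewrite <- HD in E by apply Hg.
      replace (ell J G1 (g s)) with
        (fun x => (RtoC s * (RtoC x * g s x)) + ell_weight J * g s x)%C in E.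
      2:{ apply functional_extensionality; intros x; rewrite ell_expand, Hg1; simpl; ring. }
      rewrite (diff_op_plus N d _ _ (smooth_scal (RtoC s) _ (smooth_mul_id _ (Hg s)))
        (smooth_scal (ell_weight J) _ (Hg s))) in E.
      rewrite (diff_op_scal N d (RtoC s) _ (smooth_mul_id _ (Hg s))),
        (diff_op_scal N d (ell_weight J) _ (Hg s)), Hg1,
        (diff_op_scal N d (RtoC s) _ (Hg s)) in E.
      (* Moving the factor l out of D adds the s-derivative of the symbol; multiplied by s it
         becomes the sum of k d_k s^k. *)
      assert (E1 : (RtoC s * diff_op N d (fun x => RtoC x * g s x) l)%C =
        (RtoC s * RtoC l * diff_op N d (g s) l
         + sum_n (fun k => RtoC (INR k) * d k l * RtoC (s ^ k))%C N * g s l)%C).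
      { unfold diff_op; rewrite (Cmult_comm (sum_n _ _) (g s l)), <- !sum_n_C_scal, <- sum_n_C_plus.
        apply sum_n_C_ext; intros j _.
        change (CDerive_n (fun x => RtoC x * g s x)%C j l) with
          (CDerive_n (fun x => RtoC x * RtoC (exp (s * x)))%C j l).
        rewrite (has_derivs_CDerive_n _ _ j l (has_derivs_mul_id _ _ (has_derivs_exp s))).
        rewrite Hgn; unfold g; destruct j; simpl pred; [ simpl; ring | ].
        change (s ^ S j) with (s * s ^ j); rewrite !RtoC_mult; ring. }
      rewrite E1 in E; simpl in E.
      assert (E3 : (sum_n (fun k => RtoC (INR k) * d k l * RtoC (s ^ k))%C N * g s l)%C = 0).
      { rewrite <- E; ring. }
      apply Cmult_integral in E3; destruct E3 as [E3|E3]; auto.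
      exfalso; exact (RtoC_exp_neq_0 _ E3). }
    apply Cmult_integral in E; destruct E as [E|E]; auto.
    apply RtoC_inj in E; apply (not_0_INR k) in E; [ easy | lia ]. }
  exists (d 0%nat 0); intros f Hf l; unfold diff_op.
  assert (E : forall M, (M <= N)%nat ->
     sum_n (fun k => d k l * CDerive_n f k l)%C M = (d 0%nat 0 * f l)%C).
  { induction M as [|M IH]; intros HM.
    - rewrite sum_O, CDerive_n_0; f_equal.
      apply (CDerive_0_const (d 0%nat)); intros x; apply Hconst; lia.
    - rewrite sum_n_C_S, IH, (Hzero (S M)) by lia; eqC; ring. }
  now apply E.
Qed.

(** * Infinitesimal action of the principal series *)

Lemma is_derive_cosh x : is_derive cosh x (sinh x).
Proof. apply is_derive_Reals, derivable_pt_lim_cosh. Qed.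

Lemma is_derive_sinh x : is_derive sinh x (cosh x).
Proof. apply is_derive_Reals, derivable_pt_lim_sinh. Qed.

Lemma is_derive_Rcomp (f g : R -> R) x lf lg :
  is_derive f (g x) lf -> is_derive g x lg -> is_derive (fun t => f (g t)) x (lg * lf).
Proof. intros Hf Hg; exact (is_derive_comp (V := R_NormedModule) f g x lf lg Hf Hg). Qed.

(** One computation for any differentiable curve of matrices through the identity, later applied to
    the three one-parameter subgroups. The Moebius action contributes the vector field a'l + b' -
    l(c'l + d'), the multiplier the term of order 0. *)
Lemma is_derive_principal_series J (a b c d : R -> R) a' b' c' d' f l :
  smooth f ->
  is_derive a 0 a' -> is_derive b 0 b' -> is_derive c 0 c' -> is_derive d 0 d' ->
  a 0 = 1 -> b 0 = 0 -> c 0 = 0 -> d 0 = 1 ->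
  is_CDerive (fun t => principal_series J (a t) (b t) (c t) (d t) f l) 0
    (RtoC (a' * l + b' - l * (c' * l + d')) * CDerive f l
     - (1 + 2 * Ci * RtoC J) * RtoC (c' * l + d') * f l)%C.
Proof.
  intros Hf Ha Hb Hc Hd Ea Eb Ec Ed; unfold principal_series.
  assert (Hden : is_derive (fun t => c t * l + d t) 0 (c' * l + d')).
  { evar_last.
    - exact (is_derive_plus (V := R_NormedModule) _ _ _ _ _
        (is_derive_Rmult _ _ _ _ _ Hc (is_derive_const (V := R_NormedModule) l 0)) Hd).
    - unfold plus, zero; simpl; ring. }
  assert (Hnum : is_derive (fun t => a t * l + b t) 0 (a' * l + b')).
  { evar_last.
    - exact (is_derive_plus (V := R_NormedModule) _ _ _ _ _
        (is_derive_Rmult _ _ _ _ _ Ha (is_derive_const (V := R_NormedModule) l 0)) Hb).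
    - unfold plus, zero; simpl; ring. }
  assert (E0 : c 0 * l + d 0 = 1) by (rewrite Ec, Ed; ring).
  assert (E1 : (a 0 * l + b 0) / (c 0 * l + d 0) = l) by (rewrite E0, Ea, Eb; field).
  eapply is_CDerive_eq.
  - apply is_CDerive_mult.
    + apply is_CDerive_Rcpow.
      * apply is_derive_Rabs; [ exact Hden | rewrite E0; lra ].
      * rewrite E0, Rabs_R1; lra.
    + apply (is_CDerive_comp f).
      * apply smooth_is_CDerive, Hf.
      * apply is_derive_div; [ exact Hnum | exact Hden | rewrite E0; lra ].
  - cbv beta; rewrite E1, E0, Rabs_R1, sign_eq_1 by lra.
    unfold Rcpow, Rlog; rewrite Rabs_R1, ln_1; destruct (Rlt_dec 1 0) as [H|_]; [ lra | ].
    change ((0, 0) : C) with (RtoC 0); rewrite Cmult_0_r, Cexp_0.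
    replace (1 * (c' * l + d') / 1) with (c' * l + d') by field.
    replace (((a' * l + b') * 1 - (a 0 * l + b 0) * (c' * l + d')) / 1 ^ 2)
      with (a' * l + b' - l * (c' * l + d')) by (rewrite Ea, Eb; field).
    ring.
Qed.

Lemma ell_continuous_series J : continuous_series J.
Proof.
  intros A f Hf l; apply is_CDerive_iff; rewrite ell_expand.
  assert (Hh : is_derive (fun t : R => t / 2) 0 (/ 2)) by (auto_derive; auto; field).
  destruct A; simpl one_param.
  - eapply is_CDerive_eq.
    + apply (is_derive_principal_series J (fun t => exp (t / 2)) (fun _ => 0) (fun _ => 0)
        (fun t => exp (- (t / 2))) (1 / 2) 0 0 (- (1 / 2))); auto.
      * auto_derive; auto; replace (0 * / 2) with 0 by ring; rewrite exp_0; field.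
      * apply (is_derive_const (V := R_NormedModule)).
      * apply (is_derive_const (V := R_NormedModule)).
      * auto_derive; auto; replace (- (0 * / 2)) with 0 by ring; rewrite exp_0; field.
      * replace (0 / 2) with 0 by field; apply exp_0.
      * replace (- (0 / 2)) with 0 by field; apply exp_0.
    + simpl; unfold ell_weight.
      replace (1 / 2 * l + 0 - l * (0 * l + - (1 / 2))) with l by field.
      replace (RtoC (0 * l + - (1 / 2))) with (- (1 / 2))%C.
      2:{ apply injective_projections; simpl; field. }
      field.
  - eapply is_CDerive_eq.
    + apply (is_derive_principal_series J (fun t => cos (t / 2)) (fun t => sin (t / 2))
        (fun t => - sin (t / 2)) (fun t => cos (t / 2)) 0 (1 / 2) (- (1 / 2)) 0); auto;
      try (auto_derive; auto; replace (0 * / 2) with 0 by ring; rewrite ?cos_0, ?sin_0; field);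
      replace (0 / 2) with 0 by field; rewrite ?cos_0, ?sin_0; ring.
    + simpl; unfold ell_weight.
      replace (0 * l + 1 / 2 - l * (- (1 / 2) * l + 0)) with ((l * (l * 1) + 1) / 2) by field.
      replace (RtoC (- (1 / 2) * l + 0)) with (- (1 / 2) * RtoC l)%C.
      2:{ apply injective_projections; simpl; field. }
      field.
  - eapply is_CDerive_eq.
    + apply (is_derive_principal_series J (fun t => cosh (t / 2)) (fun t => - sinh (t / 2))
        (fun t => - sinh (t / 2)) (fun t => cosh (t / 2)) 0 (- (1 / 2)) (- (1 / 2)) 0); auto.
      * evar_last; [ apply (is_derive_Rcomp cosh); [ apply is_derive_cosh | exact Hh ] | ].
        replace (0 / 2) with 0 by field; rewrite sinh_0; ring.
      * evar_last; [ apply (is_derive_opp (V := R_NormedModule)), (is_derive_Rcomp sinh);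
          [ apply is_derive_sinh | exact Hh ] | ].
        replace (0 / 2) with 0 by field; rewrite cosh_0; unfold opp; simpl; field.
      * evar_last; [ apply (is_derive_opp (V := R_NormedModule)), (is_derive_Rcomp sinh);
          [ apply is_derive_sinh | exact Hh ] | ].
        replace (0 / 2) with 0 by field; rewrite cosh_0; unfold opp; simpl; field.
      * evar_last; [ apply (is_derive_Rcomp cosh); [ apply is_derive_cosh | exact Hh ] | ].
        replace (0 / 2) with 0 by field; rewrite sinh_0; ring.
      * replace (0 / 2) with 0 by field; apply cosh_0.
      * replace (0 / 2) with 0 by field; rewrite sinh_0; ring.
      * replace (0 / 2) with 0 by field; rewrite sinh_0; ring.
      * replace (0 / 2) with 0 by field; apply cosh_0.
    + simpl; unfold ell_weight.
      replace (0 * l + - (1 / 2) - l * (- (1 / 2) * l + 0)) with ((l * (l * 1) - 1) / 2) by field.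
      replace (RtoC (- (1 / 2) * l + 0)) with (- (1 / 2) * RtoC l)%C.
      2:{ apply injective_projections; simpl; field. }
      field.
Qed.

(** * Skew-symmetry by integration by parts *)

Lemma is_CDerive_conj f x l : is_CDerive f x l -> is_CDerive (fun t => Cconj (f t)) x (Cconj l).
Proof.
  intros [H1 H2]; split; simpl; [ exact H1 | ].
  exact (is_derive_opp (V := R_NormedModule) _ _ _ H2).
Qed.

(** One-sided continuity: s, which is 1 or -1, selects the side on which [h] is known to vanish. *)
Lemma limit_zero (h : R -> R) x l s : is_derive h x l -> s * s = 1 ->
  (forall d, 0 < d -> h (x + s * d) = 0) -> h x = 0.
Proof.
  intros Hd Hs Hz.
  assert (Hc : continuous h x) by (apply (ex_derive_continuous (V := R_NormedModule)); now exists l).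
  destruct (Req_dec (h x) 0) as [E|E]; auto; exfalso.
  apply Rabs_pos_lt in E.
  destruct (proj1 (filterlim_locally h (h x)) Hc (mkposreal _ E)) as [d Hd'].
  pose proof (cond_pos d) as Hp.
  specialize (Hd' (x + s * (d / 2))).
  assert (Hb : ball x d (x + s * (d / 2))).
  { change (Rabs (x + s * (d / 2) + - x) < d).
    replace (x + s * (d / 2) + - x) with (s * (d / 2)) by ring.
    assert (Rabs s = 1).
    { assert (Rabs s * Rabs s = 1) by (rewrite <- Rabs_mult, Hs; apply Rabs_R1).
      pose proof (Rabs_pos s); nra. }
    rewrite Rabs_mult, H, Rabs_right; lra. }
  specialize (Hd' Hb); change (Rabs (h (x + s * (d / 2)) + - h x) < Rabs (h x)) in Hd'.
  rewrite Hz, Rplus_0_l, Rabs_Ropp in Hd' by lra; lra.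
Qed.

(** Test functions are only assumed to vanish strictly outside [-r, r]; the boundary term needs the
    endpoints as well. *)
Lemma smooth_boundary_zero f r x : smooth f ->
  (forall l, r < Rabs l -> f l = 0) -> x = r \/ x = - r -> f x = 0.
Proof.
  intros Hf Hz Hx.
  (* If r < 0, every point is outside and the hypothesis applies at x itself. *)
  destruct (Rlt_or_le r 0) as [Hr|Hr].
  { apply Hz; destruct Hx as [->| ->]; [ | rewrite Rabs_Ropp ]; pose proof (Rabs_pos r); lra. }
  assert (Hs : exists s, s * s = 1 /\ forall d, 0 < d -> r < Rabs (x + s * d)).
  { destruct Hx as [->| ->]; [ exists 1 | exists (- (1)) ]; split; try ring; intros d Hd.
    - rewrite Rabs_right; lra.
    - rewrite Rabs_left; lra. }
  destruct Hs as [s [Hs Hs']].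
  destruct (smooth_is_CDerive f x Hf) as [H1 H2].
  apply injective_projections.
  - apply (limit_zero (fun t => Re (f t)) x _ s H1 Hs).
    intros d Hd; now rewrite Hz by auto.
  - apply (limit_zero (fun t => Im (f t)) x _ s H2 Hs).
    intros d Hd; now rewrite Hz by auto.
Qed.

Lemma RInt_opp_of_derive (h1 h2 W : R -> R) a b :
  (forall x, ex_derive h1 x) -> (forall x, ex_derive h2 x) ->
  (forall x, is_derive W x (h1 x + h2 x)) -> W a = W b ->
  RInt h1 a b = - RInt h2 a b.
Proof.
  intros H1 H2 HW E.
  assert (C1 : forall x, continuous h1 x) by (intros x; now apply (ex_derive_continuous (V := R_NormedModule))).
  assert (C2 : forall x, continuous h2 x) by (intros x; now apply (ex_derive_continuous (V := R_NormedModule))).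
  assert (I1 : ex_RInt h1 a b) by (apply (ex_RInt_continuous (V := R_CompleteNormedModule)); auto).
  assert (I2 : ex_RInt h2 a b) by (apply (ex_RInt_continuous (V := R_CompleteNormedModule)); auto).
  assert (I : is_RInt (fun x => h1 x + h2 x) a b (W b - W a)).
  { apply (is_RInt_derive (V := R_CompleteNormedModule)); auto.
    intros x _; exact (continuous_plus (V := R_NormedModule) h1 h2 x (C1 x) (C2 x)). }
  apply (is_RInt_unique (V := R_CompleteNormedModule)) in I.
  pose proof (RInt_plus (V := R_CompleteNormedModule) h1 h2 a b I1 I2) as E2.
  change (RInt (fun x => h1 x + h2 x) a b = RInt h1 a b + RInt h2 a b) in E2.
  rewrite I in E2; lra.
Qed.

Lemma is_CDerive_ex_Re f x l : is_CDerive f x l -> ex_derive (fun t => Re (f t)) x.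
Proof. intros [H _]; eexists; exact H. Qed.

Lemma is_CDerive_ex_Im f x l : is_CDerive f x l -> ex_derive (fun t => Im (f t)) x.
Proof. intros [_ H]; eexists; exact H. Qed.

Lemma Cconj_RtoC x : Cconj (RtoC x) = RtoC x.
Proof. apply injective_projections; simpl; ring. Qed.

(** The sum of the two integrands is the derivative of v conj(f) g, because the weight satisfies w +
    conj(w) = 1. This is where the real part 1/2 enters. *)
Lemma ell_skew J A : skew_symmetric (ell J A).
Proof.
  intros f g r Hf Hg Hz.
  set (W := fun l => (RtoC (ell_vec A l) * (Cconj (f l) * g l))%C).
  set (h1 := fun l => (Cconj (f l) * ell J A g l)%C).
  set (h2 := fun l => (Cconj (ell J A f l) * g l)%C).
  assert (HW : forall l, is_CDerive W l (h1 l + h2 l)%C).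
  { intros l; eapply is_CDerive_eq.
    - apply is_CDerive_mult; [ apply is_CDerive_RtoC, is_derive_ell_vec | ].
      apply is_CDerive_mult; [ apply is_CDerive_conj | ]; apply smooth_is_CDerive; auto.
    - unfold h1, h2; rewrite !ell_expand, Cplus_conj, !Cmult_conj, !Cconj_RtoC.
      replace (Cconj (ell_weight J)) with (1 - ell_weight J)%C; [ ring | ].
      unfold ell_weight; apply injective_projections; simpl; field. }
  assert (D1 : forall l, exists d, is_CDerive h1 l d).
  { intros l; eexists; apply is_CDerive_mult;
      [ apply is_CDerive_conj | ]; apply smooth_is_CDerive; auto; now apply smooth_ell. }
  assert (D2 : forall l, exists d, is_CDerive h2 l d).
  { intros l; eexists; apply is_CDerive_mult;
      [ apply is_CDerive_conj | ]; apply smooth_is_CDerive; auto; now apply smooth_ell. }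
  assert (E : W (- r) = W r).
  { unfold W; rewrite !(smooth_boundary_zero f r) by (auto; intros; now apply Hz).
    apply injective_projections; simpl; ring. }
  unfold CInt; apply injective_projections; simpl.
  - apply (RInt_opp_of_derive (fun l => Re (h1 l)) (fun l => Re (h2 l)) (fun l => Re (W l))).
    + intros l; destruct (D1 l); eapply is_CDerive_ex_Re; eauto.
    + intros l; destruct (D2 l); eapply is_CDerive_ex_Re; eauto.
    + intros l; apply (proj1 (HW l)).
    + now rewrite E.
  - apply (RInt_opp_of_derive (fun l => Im (h1 l)) (fun l => Im (h2 l)) (fun l => Im (W l))).
    + intros l; destruct (D1 l); eapply is_CDerive_ex_Im; eauto.
    + intros l; destruct (D2 l); eapply is_CDerive_ex_Im; eauto.
    + intros l; apply (proj2 (HW l)).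
    + now rewrite E.
Qed.

(** * Differential polynomials on the chart *)

Lemma locally_R_between (P : R -> Prop) (a b x : R) :
  a < x < b -> (forall t, a < t < b -> P t) -> locally x P.
Proof.
  intros Hx H.
  assert (He : 0 < Rmin (x - a) (b - x)) by (apply Rmin_pos; lra).
  exists (mkposreal _ He); intros y Hy; apply H.
  change (Rabs (y + - x) < Rmin (x - a) (b - x)) in Hy.
  pose proof (Rmin_l (x - a) (b - x)); pose proof (Rmin_r (x - a) (b - x)).
  apply Rabs_def2 in Hy; lra.
Qed.

Definition slice (a : coord) (f : cfield) (q1 q2 u : R) : R -> C :=
  match a with
  | Q1 => fun t => f t q2 u
  | Q2 => fun t => f q1 t u
  | U1 => fun t => f q1 q2 t
  end.

Definition at_coord (a : coord) (q1 q2 u : R) : R :=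
  match a with Q1 => q1 | Q2 => q2 | U1 => u end.

Definition is_pd (a : coord) (f : cfield) (q1 q2 u : R) (l : C) : Prop :=
  is_CDerive (slice a f q1 q2 u) (at_coord a q1 q2 u) l.

Lemma is_pd_unique a f q1 q2 u l : is_pd a f q1 q2 u l -> pd a f q1 q2 u = l.
Proof. destruct a; apply is_CDerive_unique. Qed.

Lemma ex_pd_correct a f q1 q2 u : ex_pd a f q1 q2 u -> is_pd a f q1 q2 u (pd a f q1 q2 u).
Proof. destruct a; exact (ex_CDerive_correct _ _). Qed.

Lemma is_pd_ex a f q1 q2 u l : is_pd a f q1 q2 u l -> ex_pd a f q1 q2 u.
Proof. destruct a; exact (is_CDerive_ex _ _ _). Qed.

(** The identities used have denominators cos q2 and sin u and hold only on the chart. As the chart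
    is open, they can still be differentiated ([pd_chart_eq]). *)
Definition chart_eq (f g : cfield) : Prop :=
  forall q1 q2 u, chart q1 q2 u -> f q1 q2 u = g q1 q2 u.

Lemma chart_eq_slice a f g q1 q2 u : chart_eq f g -> chart q1 q2 u ->
  locally (at_coord a q1 q2 u) (fun t => slice a f q1 q2 u t = slice a g q1 q2 u t).
Proof.
  intros H Hc; destruct a; simpl.
  - apply filter_forall; intros t; apply H; exact Hc.
  - apply locally_R_between with (- (PI / 2)) (PI / 2); [ apply Hc | ].
    intros t Ht; apply H; split; [ exact Ht | apply Hc ].
  - apply locally_R_between with 0 PI; [ apply Hc | ].
    intros t Ht; apply H; split; [ apply Hc | exact Ht ].
Qed.

Lemma pd_chart_eq a f g : chart_eq f g -> chart_eq (pd a f) (pd a g).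
Proof.
  intros H q1 q2 u Hc.
  pose proof (CDerive_ext_loc _ _ _ (chart_eq_slice a f g q1 q2 u H Hc)) as E.
  destruct a; exact E.
Qed.

Lemma chart_eq_sym f g : chart_eq f g -> chart_eq g f.
Proof. intros H q1 q2 u Hc; symmetry; now apply H. Qed.

Lemma chart_eq_trans f g h : chart_eq f g -> chart_eq g h -> chart_eq f h.
Proof. intros H1 H2 q1 q2 u Hc; rewrite H1 by exact Hc; now apply H2. Qed.

Lemma chart_smooth_pd a f : chart_smooth f -> chart_smooth (pd a f).
Proof. intros H n; apply (proj2 (H (S n)) a). Qed.

Lemma chart_smooth_ex a f q1 q2 u : chart_smooth f -> chart q1 q2 u -> ex_pd a f q1 q2 u.
Proof. intros H; apply (proj2 (H 1%nat) a). Qed.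

Lemma chart_smooth_continuous f q1 q2 u : chart_smooth f -> chart q1 q2 u ->
  forall eps : posreal, exists d : posreal, forall x y z,
    Rabs (x - q1) < d -> Rabs (y - q2) < d -> Rabs (z - u) < d ->
    Rabs (Re (f x y z) - Re (f q1 q2 u)) < eps /\
    Rabs (Im (f x y z) - Im (f q1 q2 u)) < eps.
Proof.
  intros H Hc eps; pose proof (proj1 (H 0%nat) q1 q2 u Hc) as Hf.
  destruct (proj1 (filterlim_locally _ _) Hf eps) as [d Hd].
  exists d; intros x y z Hx Hy Hz.
  exact (Hd (x, y, z) (conj (conj Hx Hy) Hz)).
Qed.

Lemma Schwarz_C (s : R -> R -> C) x0 y0 :
  locally_2d (fun x y =>
    ex_CDerive (fun t => s t y) x /\ ex_CDerive (fun t => s x t) y /\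
    ex_CDerive (fun t => CDerive (fun z => s t z) y) x /\
    ex_CDerive (fun t => CDerive (fun z => s z t) x) y) x0 y0 ->
  (forall eps : posreal, locally_2d (fun x y =>
    Rabs (Re (CDerive (fun t => CDerive (fun z => s t z) y) x)
          - Re (CDerive (fun t => CDerive (fun z => s t z) y0) x0)) < eps /\
    Rabs (Im (CDerive (fun t => CDerive (fun z => s t z) y) x)
          - Im (CDerive (fun t => CDerive (fun z => s t z) y0) x0)) < eps) x0 y0) ->
  (forall eps : posreal, locally_2d (fun x y =>
    Rabs (Re (CDerive (fun t => CDerive (fun z => s z t) x) y)
          - Re (CDerive (fun t => CDerive (fun z => s z t) x0) y0)) < eps /\
    Rabs (Im (CDerive (fun t => CDerive (fun z => s z t) x) y)
          - Im (CDerive (fun t => CDerive (fun z => s z t) x0) y0)) < eps) x0 y0) ->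
  CDerive (fun t => CDerive (fun z => s t z) y0) x0
  = CDerive (fun t => CDerive (fun z => s z t) x0) y0.
Proof.
  intros Hex Hc1 Hc2; apply injective_projections; simpl.
  - apply (Schwarz (fun x y => Re (s x y))).
    + revert Hex; apply locally_2d_impl, locally_2d_forall.
      intros x y (H1 & H2 & H3 & H4).
      repeat split.
      * exact (is_CDerive_ex_Re _ _ _ (ex_CDerive_correct _ _ H1)).
      * exact (is_CDerive_ex_Re _ _ _ (ex_CDerive_correct _ _ H2)).
      * exact (is_CDerive_ex_Re _ _ _ (ex_CDerive_correct _ _ H3)).
      * exact (is_CDerive_ex_Re _ _ _ (ex_CDerive_correct _ _ H4)).
    + intros eps; generalize (Hc1 eps); apply locally_2d_impl, locally_2d_forall.
      intros x y [H _]; exact H.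
    + intros eps; generalize (Hc2 eps); apply locally_2d_impl, locally_2d_forall.
      intros x y [H _]; exact H.
  - apply (Schwarz (fun x y => Im (s x y))).
    + revert Hex; apply locally_2d_impl, locally_2d_forall.
      intros x y (H1 & H2 & H3 & H4).
      repeat split.
      * exact (is_CDerive_ex_Im _ _ _ (ex_CDerive_correct _ _ H1)).
      * exact (is_CDerive_ex_Im _ _ _ (ex_CDerive_correct _ _ H2)).
      * exact (is_CDerive_ex_Im _ _ _ (ex_CDerive_correct _ _ H3)).
      * exact (is_CDerive_ex_Im _ _ _ (ex_CDerive_correct _ _ H4)).
    + intros eps; generalize (Hc1 eps); apply locally_2d_impl, locally_2d_forall.
      intros x y [_ H]; exact H.
    + intros eps; generalize (Hc2 eps); apply locally_2d_impl, locally_2d_forall.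
      intros x y [_ H]; exact H.
Qed.

Lemma chart_box q1 q2 u : chart q1 q2 u -> exists d : posreal, forall x y z,
  Rabs (x - q1) < d -> Rabs (y - q2) < d -> Rabs (z - u) < d -> chart x y z.
Proof.
  intros [H1 H2].
  assert (He : 0 < Rmin (Rmin (q2 + PI / 2) (PI / 2 - q2)) (Rmin u (PI - u))).
  { repeat apply Rmin_pos; lra. }
  exists (mkposreal _ He); intros x y z Hx Hy Hz; simpl in *.
  pose proof (Rmin_l (Rmin (q2 + PI / 2) (PI / 2 - q2)) (Rmin u (PI - u))).
  pose proof (Rmin_r (Rmin (q2 + PI / 2) (PI / 2 - q2)) (Rmin u (PI - u))).
  pose proof (Rmin_l (q2 + PI / 2) (PI / 2 - q2)); pose proof (Rmin_r (q2 + PI / 2) (PI / 2 - q2)).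
  pose proof (Rmin_l u (PI - u)); pose proof (Rmin_r u (PI - u)).
  apply Rabs_def2 in Hy, Hz; split; lra.
Qed.

Lemma Rabs_minus_same x (d : posreal) : Rabs (x - x) < d.
Proof. rewrite Rminus_diag_eq, Rabs_R0 by reflexivity; apply cond_pos. Qed.

(** Schwarz's theorem in each coordinate plane, the third coordinate being frozen. *)
Lemma pd_comm a b f : chart_smooth f -> chart_eq (pd a (pd b f)) (pd b (pd a f)).
Proof.
  assert (H12 : forall f, chart_smooth f -> chart_eq (pd Q1 (pd Q2 f)) (pd Q2 (pd Q1 f))).
  { intros g Hg q1 q2 u Hc; destruct (chart_box _ _ _ Hc) as [d Hd].
    apply (Schwarz_C (fun x y => g x y u)).
    - exists d; intros x y Hx Hy; assert (Hxy : chart x y u) by (apply Hd; auto using Rabs_minus_same).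
      split; [ | split; [ | split ] ].
      + exact (chart_smooth_ex Q1 _ _ _ _ Hg Hxy).
      + exact (chart_smooth_ex Q2 _ _ _ _ Hg Hxy).
      + exact (chart_smooth_ex Q1 _ _ _ _ (chart_smooth_pd Q2 _ Hg) Hxy).
      + exact (chart_smooth_ex Q2 _ _ _ _ (chart_smooth_pd Q1 _ Hg) Hxy).
    - intros eps; destruct (chart_smooth_continuous _ _ _ _
        (chart_smooth_pd Q1 _ (chart_smooth_pd Q2 _ Hg)) Hc eps) as [d' Hd'].
      exists d'; intros x y Hx Hy; exact (Hd' x y u Hx Hy (Rabs_minus_same u d')).
    - intros eps; destruct (chart_smooth_continuous _ _ _ _
        (chart_smooth_pd Q2 _ (chart_smooth_pd Q1 _ Hg)) Hc eps) as [d' Hd'].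
      exists d'; intros x y Hx Hy; exact (Hd' x y u Hx Hy (Rabs_minus_same u d')). }
  assert (H13 : forall f, chart_smooth f -> chart_eq (pd Q1 (pd U1 f)) (pd U1 (pd Q1 f))).
  { intros g Hg q1 q2 u Hc; destruct (chart_box _ _ _ Hc) as [d Hd].
    apply (Schwarz_C (fun x y => g x q2 y)).
    - exists d; intros x y Hx Hy; assert (Hxy : chart x q2 y) by (apply Hd; auto using Rabs_minus_same).
      split; [ | split; [ | split ] ].
      + exact (chart_smooth_ex Q1 _ _ _ _ Hg Hxy).
      + exact (chart_smooth_ex U1 _ _ _ _ Hg Hxy).
      + exact (chart_smooth_ex Q1 _ _ _ _ (chart_smooth_pd U1 _ Hg) Hxy).
      + exact (chart_smooth_ex U1 _ _ _ _ (chart_smooth_pd Q1 _ Hg) Hxy).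
    - intros eps; destruct (chart_smooth_continuous _ _ _ _
        (chart_smooth_pd Q1 _ (chart_smooth_pd U1 _ Hg)) Hc eps) as [d' Hd'].
      exists d'; intros x y Hx Hy; exact (Hd' x q2 y Hx (Rabs_minus_same q2 d') Hy).
    - intros eps; destruct (chart_smooth_continuous _ _ _ _
        (chart_smooth_pd U1 _ (chart_smooth_pd Q1 _ Hg)) Hc eps) as [d' Hd'].
      exists d'; intros x y Hx Hy; exact (Hd' x q2 y Hx (Rabs_minus_same q2 d') Hy). }
  assert (H23 : forall f, chart_smooth f -> chart_eq (pd Q2 (pd U1 f)) (pd U1 (pd Q2 f))).
  { intros g Hg q1 q2 u Hc; destruct (chart_box _ _ _ Hc) as [d Hd].
    apply (Schwarz_C (fun x y => g q1 x y)).
    - exists d; intros x y Hx Hy; assert (Hxy : chart q1 x y) by (apply Hd; auto using Rabs_minus_same).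
      split; [ | split; [ | split ] ].
      + exact (chart_smooth_ex Q2 _ _ _ _ Hg Hxy).
      + exact (chart_smooth_ex U1 _ _ _ _ Hg Hxy).
      + exact (chart_smooth_ex Q2 _ _ _ _ (chart_smooth_pd U1 _ Hg) Hxy).
      + exact (chart_smooth_ex U1 _ _ _ _ (chart_smooth_pd Q2 _ Hg) Hxy).
    - intros eps; destruct (chart_smooth_continuous _ _ _ _
        (chart_smooth_pd Q2 _ (chart_smooth_pd U1 _ Hg)) Hc eps) as [d' Hd'].
      exists d'; intros x y Hx Hy; exact (Hd' q1 x y (Rabs_minus_same q1 d') Hx Hy).
    - intros eps; destruct (chart_smooth_continuous _ _ _ _
        (chart_smooth_pd U1 _ (chart_smooth_pd Q2 _ Hg)) Hc eps) as [d' Hd'].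
      exists d'; intros x y Hx Hy; exact (Hd' q1 x y (Rabs_minus_same q1 d') Hx Hy). }
  intros Hf; destruct a, b; try (intros q1 q2 u _; reflexivity); auto using chart_eq_sym.
Qed.

(* [At_f i j k] stands for the derivative of orders i, j, k in q1, q2, u of the
   unknown function. *)
Inductive atom :=
  | At_ch | At_sh | At_sin | At_cos | At_tan | At_sec | At_cot | At_csc
  | At_f (i j k : nat).

(** Polynomials in the atoms are closed under all three derivations: with tan, sec, cot and csc as
    separate atoms no quotient ever arises. Products of operators become terms whose derivatives are
    computed, and [ring] can finish. *)
Inductive dexpr :=
  | Atom (x : atom) | Const (c : C) | Add (s t : dexpr) | Mul (s t : dexpr).

Definition atom_val (f : cfield) (x : atom) : cfield := fun q1 q2 u =>
  match x with
  | At_ch => RtoC (cosh q1)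
  | At_sh => RtoC (sinh q1)
  | At_sin => RtoC (sin q2)
  | At_cos => RtoC (cos q2)
  | At_tan => RtoC (tan q2)
  | At_sec => RtoC (/ cos q2)
  | At_cot => RtoC (cos u / sin u)
  | At_csc => RtoC (/ sin u)
  | At_f i j k => Nat.iter i (pd Q1) (Nat.iter j (pd Q2) (Nat.iter k (pd U1) f)) q1 q2 u
  end.

Fixpoint dval (f : cfield) (s : dexpr) : cfield := fun q1 q2 u =>
  match s with
  | Atom x => atom_val f x q1 q2 u
  | Const c => c
  | Add s t => (dval f s q1 q2 u + dval f t q1 q2 u)%C
  | Mul s t => (dval f s q1 q2 u * dval f t q1 q2 u)%C
  end.

Definition atom_d (a : coord) (x : atom) : dexpr :=
  match a, x with
  | Q1, At_ch => Atom At_sh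
  | Q1, At_sh => Atom At_ch
  | Q2, At_sin => Atom At_cos
  | Q2, At_cos => Mul (Const (- (1))) (Atom At_sin)
  | Q2, At_tan => Mul (Atom At_sec) (Atom At_sec)
  | Q2, At_sec => Mul (Atom At_tan) (Atom At_sec)
  | U1, At_cot => Mul (Const (- (1))) (Mul (Atom At_csc) (Atom At_csc))
  | U1, At_csc => Mul (Const (- (1))) (Mul (Atom At_cot) (Atom At_csc))
  | Q1, At_f i j k => Atom (At_f (S i) j k)
  | Q2, At_f i j k => Atom (At_f i (S j) k)
  | U1, At_f i j k => Atom (At_f i j (S k))
  | _, _ => Const 0
  end.

Fixpoint ddiff (a : coord) (s : dexpr) : dexpr :=
  match s with
  | Atom x => atom_d a x
  | Const _ => Const 0
  | Add s t => Add (ddiff a s) (ddiff a t)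
  | Mul s t => Add (Mul (ddiff a s) t) (Mul s (ddiff a t))
  end.

Lemma chart_smooth_iter a n f : chart_smooth f -> chart_smooth (Nat.iter n (pd a) f).
Proof. intros Hf; induction n; simpl; auto using chart_smooth_pd. Qed.

Lemma pd_iter_comm a b n f : chart_smooth f ->
  chart_eq (pd a (Nat.iter n (pd b) f)) (Nat.iter n (pd b) (pd a f)).
Proof.
  intros Hf; induction n as [|n IH]; simpl; [ now intros q1 q2 u _ | ].
  eapply chart_eq_trans; [ apply pd_comm, chart_smooth_iter, Hf | now apply pd_chart_eq ].
Qed.

Lemma iter_chart_eq b n f g : chart_eq f g -> chart_eq (Nat.iter n (pd b) f) (Nat.iter n (pd b) g).
Proof. intros H; induction n; simpl; auto using pd_chart_eq. Qed.

Lemma chart_cos q1 q2 u : chart q1 q2 u -> 0 < cos q2.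
Proof. intros [H _]; apply cos_gt_0; lra. Qed.

Lemma chart_sin q1 q2 u : chart q1 q2 u -> 0 < sin u.
Proof. intros [_ H]; apply sin_gt_0; lra. Qed.

Lemma is_derive_tan_sec x : cos x <> 0 -> is_derive tan x (/ cos x * / cos x).
Proof.
  intros H; unfold tan; evar_last.
  - apply is_derive_div; [ apply is_derive_sin | apply is_derive_cos | exact H ].
  - pose proof (sin2_cos2 x) as E; unfold Rsqr in E.
    assert (E' : sin x * sin x = 1 - cos x * cos x) by lra.
    simpl; field_simplify; auto.
    replace (sin x ^ 2) with (1 - cos x * cos x) by (rewrite <- E'; ring).
    field; auto.
Qed.

Lemma is_derive_cot x : sin x <> 0 -> is_derive (fun t => cos t / sin t) x (- (/ sin x * / sin x)).
Proof.
  intros H; evar_last.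
  - apply is_derive_div; [ apply is_derive_cos | apply is_derive_sin | exact H ].
  - pose proof (sin2_cos2 x) as E; unfold Rsqr in E.
    assert (E' : cos x * cos x = 1 - sin x * sin x) by lra.
    simpl; field_simplify; auto.
    replace (cos x ^ 2) with (1 - sin x * sin x) by (rewrite <- E'; ring).
    field; auto.
Qed.

(** Mixed derivatives are kept in the normal order q1, q2, u from the outside in. A new derivative
    in q2 or u has to be moved inwards past the outer ones. *)
Lemma is_pd_iter a i j k f q1 q2 u : chart_smooth f -> chart q1 q2 u ->
  is_pd a (Nat.iter i (pd Q1) (Nat.iter j (pd Q2) (Nat.iter k (pd U1) f))) q1 q2 u
    (dval f (atom_d a (At_f i j k)) q1 q2 u).
Proof.
  intros Hf Hc.
  set (f3 := Nat.iter k (pd U1) f); set (f2 := Nat.iter j (pd Q2) f3).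
  assert (H3 : chart_smooth f3) by now apply chart_smooth_iter.
  assert (H2 : chart_smooth f2) by now apply chart_smooth_iter.
  assert (H1 : chart_smooth (Nat.iter i (pd Q1) f2)) by now apply chart_smooth_iter.
  eapply is_CDerive_eq; [ exact (ex_pd_correct a _ _ _ _ (chart_smooth_ex a _ _ _ _ H1 Hc)) | ].
  destruct a.
  - reflexivity.
  - exact (pd_iter_comm Q2 Q1 i f2 H2 q1 q2 u Hc).
  - transitivity (Nat.iter i (pd Q1) (pd U1 f2) q1 q2 u).
    + exact (pd_iter_comm U1 Q1 i f2 H2 q1 q2 u Hc).
    + exact (iter_chart_eq Q1 i _ _ (pd_iter_comm U1 Q2 j f3 H3) q1 q2 u Hc).
Qed.

Lemma is_pd_atom a x f q1 q2 u : chart_smooth f -> chart q1 q2 u ->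
  is_pd a (atom_val f x) q1 q2 u (dval f (atom_d a x) q1 q2 u).
Proof.
  intros Hf Hc.
  pose proof (Rgt_not_eq _ _ (chart_cos _ _ _ Hc)) as Hcos.
  pose proof (Rgt_not_eq _ _ (chart_sin _ _ _ Hc)) as Hsin.
  destruct x as [ | | | | | | | |i j k]; [ .. | exact (is_pd_iter a i j k f q1 q2 u Hf Hc) ];
    destruct a; try exact (is_CDerive_const _ _).
  - exact (is_CDerive_RtoC _ _ _ (is_derive_cosh q1)).
  - exact (is_CDerive_RtoC _ _ _ (is_derive_sinh q1)).
  - exact (is_CDerive_RtoC _ _ _ (is_derive_sin q2)).
  - eapply is_CDerive_eq; [ exact (is_CDerive_RtoC _ _ _ (is_derive_cos q2)) | ].
    apply injective_projections; simpl; ring.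
  - eapply is_CDerive_eq; [ exact (is_CDerive_RtoC _ _ _ (is_derive_tan_sec q2 Hcos)) | ].
    apply injective_projections; simpl; ring.
  - eapply is_CDerive_eq;
      [ exact (is_CDerive_RtoC _ _ _ (is_derive_inv cos q2 _ (is_derive_cos q2) Hcos)) | ].
    apply injective_projections; simpl; unfold tan; field; exact Hcos.
  - eapply is_CDerive_eq; [ exact (is_CDerive_RtoC _ _ _ (is_derive_cot u Hsin)) | ].
    apply injective_projections; simpl; ring.
  - eapply is_CDerive_eq;
      [ exact (is_CDerive_RtoC _ _ _ (is_derive_inv sin u _ (is_derive_sin u) Hsin)) | ].
    apply injective_projections; simpl; field; exact Hsin.
Qed.

Lemma is_pd_dval a s f q1 q2 u : chart_smooth f -> chart q1 q2 u ->
  is_pd a (dval f s) q1 q2 u (dval f (ddiff a s) q1 q2 u).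
Proof.
  intros Hf Hc; induction s as [x|c|s IHs t IHt|s IHs t IHt].
  - now apply is_pd_atom.
  - destruct a; exact (is_CDerive_const c _).
  - destruct a; exact (is_CDerive_plus _ _ _ _ _ IHs IHt).
  - destruct a; exact (is_CDerive_mult _ _ _ _ _ IHs IHt).
Qed.

Lemma pd_dval a s f : chart_smooth f -> chart_eq (pd a (dval f s)) (dval f (ddiff a s)).
Proof. intros Hf q1 q2 u Hc; now apply is_pd_unique, is_pd_dval. Qed.

(** * The operators as formal differential polynomials, and their commutators *)

Definition Neg (s : dexpr) : dexpr := Mul (Const (- (1))) s.

Definition X_formal (e mu : R) (A : gen) (s : dexpr) : dexpr :=
  let c := Const (Ci * RtoC e * RtoC mu) in
  match A with
  | G1 => ddiff Q1 s
  | G2 => Add (Add (Mul (Mul (Atom At_sh) (Atom At_tan)) (ddiff Q1 s))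
                   (Mul (Atom At_ch) (ddiff Q2 s)))
              (Mul (Mul c (Mul (Atom At_sh) (Atom At_sec))) s)
  | G3 => Add (Add (Mul (Mul (Atom At_ch) (Atom At_tan)) (ddiff Q1 s))
                   (Mul (Atom At_sh) (ddiff Q2 s)))
              (Mul (Mul c (Mul (Atom At_ch) (Atom At_sec))) s)
  end.

Definition KG_formal (e mu m zeta : R) (s : dexpr) : dexpr :=
  let csc2 := Mul (Atom At_csc) (Atom At_csc) in
  let em := Const (RtoC e * RtoC mu) in
  Add (ddiff U1 (ddiff U1 s))
  (Add (Mul (Mul (Const 2) (Atom At_cot)) (ddiff U1 s))
  (Add (Neg (Mul csc2 (Add (Mul (Mul (Atom At_sec) (Atom At_sec)) (ddiff Q1 (ddiff Q1 s)))
         (Add (Neg (ddiff Q2 (ddiff Q2 s))) (Mul (Atom At_tan) (ddiff Q2 s))))))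
  (Add (Neg (Mul (Const (2 * Ci)) (Mul (Mul em (Mul (Atom At_tan) (Mul csc2 (Atom At_sec))))
          (ddiff Q1 s))))
  (Add (Mul (Mul (Mul em em) (Mul (Mul (Atom At_tan) (Atom At_tan)) csc2)) s)
       (Mul (Const (RtoC (6 * zeta + m ^ 2))) s))))).

Lemma X_chart_eq e mu A f g : chart_eq f g -> chart_eq (X e mu A f) (X e mu A g).
Proof.
  intros H q1 q2 u Hc.
  pose proof (pd_chart_eq Q1 f g H q1 q2 u Hc) as E1.
  pose proof (pd_chart_eq Q2 f g H q1 q2 u Hc) as E2.
  pose proof (H q1 q2 u Hc) as E0.
  destruct A; unfold X; rewrite ?E1, ?E2, ?E0; reflexivity.
Qed.

Lemma KG_chart_eq e mu m zeta f g : chart_eq f g -> chart_eq (KG e mu m zeta f) (KG e mu m zeta g).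
Proof.
  intros H q1 q2 u Hc.
  unfold KG.
  rewrite (pd_chart_eq Q1 f g H q1 q2 u Hc), (pd_chart_eq Q2 f g H q1 q2 u Hc),
    (pd_chart_eq U1 f g H q1 q2 u Hc), (H q1 q2 u Hc),
    (pd_chart_eq Q1 _ _ (pd_chart_eq Q1 f g H) q1 q2 u Hc),
    (pd_chart_eq Q2 _ _ (pd_chart_eq Q2 f g H) q1 q2 u Hc),
    (pd_chart_eq U1 _ _ (pd_chart_eq U1 f g H) q1 q2 u Hc).
  reflexivity.
Qed.

Lemma pd2_dval a b s f : chart_smooth f ->
  chart_eq (pd a (pd b (dval f s))) (dval f (ddiff a (ddiff b s))).
Proof.
  intros Hf; eapply chart_eq_trans; [ apply pd_chart_eq, pd_dval, Hf | apply pd_dval, Hf ].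
Qed.

Lemma X_dval e mu A s f : chart_smooth f ->
  chart_eq (X e mu A (dval f s)) (dval f (X_formal e mu A s)).
Proof.
  intros Hf q1 q2 u Hc.
  pose proof (pd_dval Q1 s f Hf q1 q2 u Hc) as E1.
  pose proof (pd_dval Q2 s f Hf q1 q2 u Hc) as E2.
  destruct A; unfold X; rewrite ?E1, ?E2; [ reflexivity | | ];
    simpl dval; unfold Rdiv; rewrite !RtoC_mult; ring.
Qed.

Lemma KG_dval e mu m zeta s f : chart_smooth f ->
  chart_eq (KG e mu m zeta (dval f s)) (dval f (KG_formal e mu m zeta s)).
Proof.
  intros Hf q1 q2 u Hc; unfold KG.
  rewrite (pd_dval Q1 s f Hf q1 q2 u Hc), (pd_dval Q2 s f Hf q1 q2 u Hc),
    (pd_dval U1 s f Hf q1 q2 u Hc), (pd2_dval Q1 Q1 s f Hf q1 q2 u Hc),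
    (pd2_dval Q2 Q2 s f Hf q1 q2 u Hc), (pd2_dval U1 U1 s f Hf q1 q2 u Hc).
  pose proof (Rgt_not_eq _ _ (chart_cos _ _ _ Hc)) as Hcos.
  pose proof (Rgt_not_eq _ _ (chart_sin _ _ _ Hc)) as Hsin.
  replace (1 / sin u ^ 2) with (/ sin u * / sin u) by (field; auto).
  replace (1 / cos q2 ^ 2) with (/ cos q2 * / cos q2) by (field; auto).
  replace (e * mu * tan q2 / (sin u ^ 2 * cos q2))
    with (e * mu * (tan q2 * (/ sin u * / sin u * / cos q2))) by (field; auto).
  replace (e ^ 2 * mu ^ 2 * tan q2 ^ 2 / sin u ^ 2)
    with (e * mu * (e * mu) * (tan q2 * tan q2 * (/ sin u * / sin u))) by (field; auto).
  unfold KG_formal, Neg; cbn [dval atom_val]; rewrite !RtoC_mult; ring.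
Qed.

Definition unknown : dexpr := Atom (At_f 0 0 0).

Lemma X_unknown e mu A f : chart_smooth f ->
  chart_eq (X e mu A f) (dval f (X_formal e mu A unknown)).
Proof. exact (X_dval e mu A unknown f). Qed.

Lemma KG_unknown e mu m zeta f : chart_smooth f ->
  chart_eq (KG e mu m zeta f) (dval f (KG_formal e mu m zeta unknown)).
Proof. exact (KG_dval e mu m zeta unknown f). Qed.

Lemma X0_unknown e f : chart_eq (X0 e f) (dval f (Mul (Const (Ci * RtoC e)) unknown)).
Proof. intros q1 q2 u _; reflexivity. Qed.

Lemma cosh_sinh_C x : (RtoC (cosh x) * RtoC (cosh x) = 1 + RtoC (sinh x) * RtoC (sinh x))%C.
Proof.
  rewrite <- !RtoC_mult, <- RtoC_plus; f_equal.
  unfold cosh, sinh; assert (E : exp x * exp (- x) = 1) by (rewrite <- exp_plus, Rplus_opp_r; apply exp_0).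
  nra.
Qed.

Lemma sec_tan_C x : cos x <> 0 ->
  (RtoC (/ cos x) * RtoC (/ cos x) = 1 + RtoC (tan x) * RtoC (tan x))%C.
Proof.
  intros H; rewrite <- !RtoC_mult, <- RtoC_plus; f_equal.
  pose proof (sin2_cos2 x) as E; unfold Rsqr in E.
  unfold tan; apply Rmult_eq_reg_r with (cos x * cos x); [ | now apply Rmult_integral_contrapositive ].
  field_simplify; auto; lra.
Qed.

(* Leaves the relations [Esec] and [Ech] for [ring]. *)
Ltac abstract_derivatives Hc :=
  pose proof (sec_tan_C _ (Rgt_not_eq _ _ (chart_cos _ _ _ Hc))) as Esec;
  match goal with |- context [RtoC (cosh ?x)] => pose proof (cosh_sinh_C x) as Ech | _ => idtac end;
  repeat match goal with |- context [Nat.iter ?i ?a ?g ?x ?y ?z] =>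
    let w := fresh "w" in set (w := Nat.iter i a g x y z) in *; clearbody w end.

Lemma X_comm e mu A B f q1 q2 u : chart_smooth f -> chart q1 q2 u ->
  op_comm (X e mu A) (X e mu B) f q1 q2 u =
  (dval f (X_formal e mu A (X_formal e mu B unknown)) q1 q2 u
   - dval f (X_formal e mu B (X_formal e mu A unknown)) q1 q2 u)%C.
Proof.
  intros Hf Hc; unfold op_comm.
  assert (H : forall A B, X e mu A (X e mu B f) q1 q2 u
     = dval f (X_formal e mu A (X_formal e mu B unknown)) q1 q2 u).
  { intros A' B'; rewrite (X_chart_eq e mu A' _ _ (X_unknown e mu B' f Hf) q1 q2 u Hc).
    now apply X_dval. }
  now rewrite !H.
Qed.

Lemma X_comm_12 e mu : op_eq (op_comm (X e mu G1) (X e mu G2)) (X e mu G3).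
Proof.
  intros f Hf q1 q2 u Hc; rewrite X_comm by assumption.
  rewrite (X_unknown e mu G3 f Hf q1 q2 u Hc).
  cbn [dval ddiff atom_d atom_val X_formal unknown].
  abstract_derivatives Hc; ring [Esec Ech].
Qed.

Lemma X_comm_13 e mu : op_eq (op_comm (X e mu G1) (X e mu G3)) (X e mu G2).
Proof.
  intros f Hf q1 q2 u Hc; rewrite X_comm by assumption.
  rewrite (X_unknown e mu G2 f Hf q1 q2 u Hc).
  cbn [dval ddiff atom_d atom_val X_formal unknown].
  abstract_derivatives Hc; ring [Esec Ech].
Qed.

Lemma X_comm_23 e mu : op_eq (op_comm (X e mu G2) (X e mu G3)) (X e mu G1).
Proof.
  intros f Hf q1 q2 u Hc; rewrite X_comm by assumption.
  rewrite (X_unknown e mu G1 f Hf q1 q2 u Hc).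
  cbn [dval ddiff atom_d atom_val X_formal unknown].
  abstract_derivatives Hc; ring [Esec Ech].
Qed.

Lemma KG_X_comm e mu m zeta A : op_eq (op_comm (KG e mu m zeta) (X e mu A)) op_zero.
Proof.
  intros f Hf q1 q2 u Hc; unfold op_comm, op_zero.
  rewrite (KG_chart_eq e mu m zeta _ _ (X_unknown e mu A f Hf) q1 q2 u Hc).
  rewrite (KG_dval e mu m zeta _ f Hf q1 q2 u Hc).
  rewrite (X_chart_eq e mu A _ _ (KG_unknown e mu m zeta f Hf) q1 q2 u Hc).
  rewrite (X_dval e mu A _ f Hf q1 q2 u Hc).
  destruct A; cbn [dval ddiff atom_d atom_val X_formal KG_formal Neg unknown];
    abstract_derivatives Hc;
    (* The real term e^2 mu^2 of [KG] is matched with products of two factors i e mu, one from each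
       operator. *)
    assert (ECi : (Ci * Ci)%C = (- (1))%C) by (apply injective_projections; simpl; ring).
  (* For [G1]: no coefficient of [KG] depends on q1. *)
  - ring.
  - ring [Esec Ech ECi].
  - ring [Esec Ech ECi].
Qed.

Lemma KG_X0_comm e mu m zeta : op_eq (op_comm (KG e mu m zeta) (X0 e)) op_zero.
Proof.
  intros f Hf q1 q2 u Hc; unfold op_comm, op_zero.
  rewrite (KG_chart_eq e mu m zeta _ _ (X0_unknown e f) q1 q2 u Hc).
  rewrite (KG_dval e mu m zeta _ f Hf q1 q2 u Hc).
  unfold X0; rewrite (KG_unknown e mu m zeta f Hf q1 q2 u Hc).
  cbn [dval ddiff atom_d atom_val KG_formal Neg unknown]; ring.
Qed.

(** * Geometry of the chart *)

Lemma cosh2_sinh2 x : cosh x ^ 2 - sinh x ^ 2 = 1.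
Proof.
  unfold cosh, sinh; assert (E : exp x * exp (- x) = 1) by (rewrite <- exp_plus, Rplus_opp_r; apply exp_0).
  nra.
Qed.

Lemma cos2_sin2 x : cos x ^ 2 + sin x ^ 2 = 1.
Proof. pose proof (sin2_cos2 x) as E; unfold Rsqr in E; lra. Qed.

Lemma embed_hyperboloid q1 q2 u :
  (embed 0 q1 q2 u) ^ 2 - (embed 1 q1 q2 u) ^ 2
     - (embed 2 q1 q2 u) ^ 2 - (embed 3 q1 q2 u) ^ 2 = -1.
Proof.
  pose proof (cosh2_sinh2 q1); pose proof (cos2_sin2 q2); pose proof (cos2_sin2 u).
  unfold embed.
  replace ((- (sin u * sinh q1 * cos q2)) ^ 2 - (sin u * cosh q1 * cos q2) ^ 2
     - (sin u * sin q2) ^ 2 - cos u ^ 2)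
    with (- (sin u ^ 2 * ((cosh q1 ^ 2 - sinh q1 ^ 2) * cos q2 ^ 2 + sin q2 ^ 2) + cos u ^ 2)) by ring.
  rewrite H, Rmult_1_l, H0, Rmult_1_r, Rplus_comm, H1; reflexivity.
Qed.

Definition d_embed (a : coord) (i : nat) : rfield := fun q1 q2 u =>
  match a, i with
  | Q1, 0%nat => - (sin u * cosh q1 * cos q2)
  | Q1, 1%nat => sin u * sinh q1 * cos q2
  | Q2, 0%nat => sin u * sinh q1 * sin q2
  | Q2, 1%nat => - (sin u * cosh q1 * sin q2)
  | Q2, 2%nat => sin u * cos q2
  | U1, 0%nat => - (cos u * sinh q1 * cos q2)
  | U1, 1%nat => cos u * cosh q1 * cos q2
  | U1, 2%nat => cos u * sin q2
  | U1, 3%nat => - sin u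
  | _, _ => 0
  end.

Lemma rpd_embed a i q1 q2 u : (i < 4)%nat -> rpd a (embed i) q1 q2 u = d_embed a i q1 q2 u.
Proof.
  intros Hi.
  destruct i as [|[|[|[|i]]]]; [ | | | | lia ]; destruct a; simpl;
    apply is_derive_unique; auto_derive; auto; ring.
Qed.

Lemma metric_induced a b q1 q2 u : metric a b q1 q2 u = induced_metric a b q1 q2 u.
Proof.
  unfold induced_metric; rewrite !rpd_embed by lia.
  pose proof (cosh2_sinh2 q1); pose proof (cos2_sin2 q2); pose proof (cos2_sin2 u).
  assert (Ec : cosh q1 ^ 2 = 1 + sinh q1 ^ 2) by lra.
  assert (Es : sin q2 ^ 2 = 1 - cos q2 ^ 2) by lra.
  assert (Eu : sin u ^ 2 = 1 - cos u ^ 2) by lra.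
  destruct a, b; unfold metric, d_embed; ring [Ec Es Eu].
Qed.

Lemma em_field_potential mu a b q1 q2 u :
  em_field mu a b q1 q2 u
     = rpd a (potential mu b) q1 q2 u - rpd b (potential mu a) q1 q2 u.
Proof.
  assert (E : Derive (fun t => - (mu * sin t)) q2 = - (mu * cos q2)).
  { apply is_derive_unique; auto_derive; auto; ring. }
  destruct a, b; simpl; rewrite ?Derive_const, ?E; ring.
Qed.

Definition d_metric (a b c : coord) : rfield := fun q1 q2 u =>
  match a, b, c with
  | Q2, Q1, Q1 => 2 * (sin u) ^ 2 * cos q2 * sin q2
  | U1, Q1, Q1 => - (2 * sin u * cos u * (cos q2) ^ 2)
  | U1, Q2, Q2 => 2 * sin u * cos u
  | _, _, _ => 0
  end.

Lemma rpd_metric a b c q1 q2 u : rpd a (metric b c) q1 q2 u = d_metric a b c q1 q2 u.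
Proof.
  destruct a, b, c; simpl; apply is_derive_unique; auto_derive; auto; ring.
Qed.

(* The coefficient of the first-order terms - g^{aa} Gamma^c_{aa} D_c. *)
Definition contracted_christoffel (c : coord) : rfield := fun q1 q2 u =>
  rsum3 (fun a => inv_metric a a q1 q2 u * christoffel c a a q1 q2 u).

Lemma contracted_christoffel_val c q1 q2 u : chart q1 q2 u ->
  contracted_christoffel c q1 q2 u =
  match c with
  | Q1 => 0
  | Q2 => tan q2 / (sin u) ^ 2
  | U1 => - (2 * (cos u / sin u))
  end.
Proof.
  intros Hc.
  pose proof (Rgt_not_eq _ _ (chart_cos _ _ _ Hc)) as Hcos.
  pose proof (Rgt_not_eq _ _ (chart_sin _ _ _ Hc)) as Hsin.
  unfold contracted_christoffel, christoffel, rsum3; rewrite !rpd_metric.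
  destruct c; unfold inv_metric, metric, coord_eqb, d_metric, tan; field; auto.
Qed.

Definition Dcov_formal (e mu : R) (a : coord) (s : dexpr) : dexpr :=
  match a with
  | Q1 => Add (ddiff Q1 s) (Mul (Mul (Const (Ci * RtoC e * RtoC mu)) (Atom At_sin)) s)
  | _ => ddiff a s
  end.

Lemma Dcov_dval e mu a f : chart_smooth f ->
  chart_eq (Dcov e mu a f) (dval f (Dcov_formal e mu a unknown)).
Proof.
  intros Hf q1 q2 u Hc; unfold Dcov.
  pose proof (pd_dval a unknown f Hf q1 q2 u Hc) as E.
  change (dval f unknown) with f in E; rewrite E.
  destruct a; simpl potential; cbn [Dcov_formal dval atom_val ddiff atom_d unknown].
  - rewrite RtoC_opp, RtoC_mult; simpl Nat.iter; ring.
  - ring.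
  - ring.
Qed.

(** A diagonal inverse metric leaves only the terms with a = b, and the connection enters through
    its trace alone. *)
Lemma KG_covariant_expand e mu m zeta f q1 q2 u :
  KG_covariant e mu m zeta f q1 q2 u =
  (csum3 (fun a => RtoC (inv_metric a a q1 q2 u) *
      (pd a (Dcov e mu a f) q1 q2 u
       - Ci * RtoC e * RtoC (potential mu a q1 q2 u) * Dcov e mu a f q1 q2 u))
   - csum3 (fun c => RtoC (contracted_christoffel c q1 q2 u) * Dcov e mu c f q1 q2 u)
   + RtoC (zeta * 6 + m ^ 2) * f q1 q2 u)%C.
Proof.
  unfold KG_covariant, Dcov2, csum3, contracted_christoffel, rsum3.
  assert (H : forall a b, coord_eqb a b = false -> inv_metric a b q1 q2 u = 0)
    by (intros a b E; unfold inv_metric; now rewrite E).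
  rewrite (H Q1 Q2), (H Q1 U1), (H Q2 Q1), (H Q2 U1), (H U1 Q1), (H U1 Q2) by reflexivity.
  rewrite !RtoC_plus, !RtoC_mult; ring.
Qed.

Lemma KG_covariant_eq e mu m zeta : op_eq (KG_covariant e mu m zeta) (KG e mu m zeta).
Proof.
  intros f Hf q1 q2 u Hc; rewrite KG_covariant_expand.
  pose proof (Rgt_not_eq _ _ (chart_cos _ _ _ Hc)) as Hcos.
  pose proof (Rgt_not_eq _ _ (chart_sin _ _ _ Hc)) as Hsin.
  unfold csum3; rewrite !contracted_christoffel_val by exact Hc.
  rewrite !(fun a => Dcov_dval e mu a f Hf q1 q2 u Hc),
    !(fun a b => pd_chart_eq b _ _ (Dcov_dval e mu a f Hf) q1 q2 u Hc),
    !(fun b s => pd_dval b s f Hf q1 q2 u Hc).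
  rewrite (KG_unknown e mu m zeta f Hf q1 q2 u Hc).
  unfold inv_metric, coord_eqb, metric, potential.
  replace (/ - (sin u ^ 2 * cos q2 ^ 2))
    with (- (/ sin u * / sin u * (/ cos q2 * / cos q2))) by (field; auto).
  replace (/ sin u ^ 2) with (/ sin u * / sin u) by (field; auto).
  replace (tan q2 / sin u ^ 2) with (tan q2 * (/ sin u * / sin u)) by (field; auto).
  cbn [Dcov_formal dval atom_val ddiff atom_d unknown KG_formal Neg].
  simpl Nat.iter.
  rewrite Rinv_1, !RtoC_opp, !RtoC_mult, (Rmult_comm zeta 6).
  (* The potential brings in sin q2 and [KG] has tan q2, so tan is rewritten as sin times sec and
     cos times sec is reduced to 1. *)
  assert (Et : RtoC (tan q2) = (RtoC (sin q2) * RtoC (/ cos q2))%C) by (rewrite <- RtoC_mult; reflexivity).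
  assert (Ec : (RtoC (cos q2) * RtoC (/ cos q2) = 1)%C) by (rewrite <- RtoC_mult, Rinv_r; auto).
  assert (ECi : (Ci * Ci)%C = (- (1))%C) by (apply injective_projections; simpl; ring).
  rewrite Et; ring [Ec ECi].
Qed.

(** * The symmetry algebra *)

Definition span_formal (e mu c0 c1 c2 c3 : R) (s : dexpr) : dexpr :=
  Add (Mul (Const (RtoC c0)) (Mul (Const (Ci * RtoC e)) s))
  (Add (Mul (Const (RtoC c1)) (X_formal e mu G1 s))
  (Add (Mul (Const (RtoC c2)) (X_formal e mu G2 s))
       (Mul (Const (RtoC c3)) (X_formal e mu G3 s)))).

Lemma X_span_dval e mu c0 c1 c2 c3 s f : chart_smooth f ->
  chart_eq (X_span e mu c0 c1 c2 c3 (dval f s)) (dval f (span_formal e mu c0 c1 c2 c3 s)).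
Proof.
  intros Hf q1 q2 u Hc; unfold X_span, op_add, op_scal.
  rewrite !(fun A => X_dval e mu A s f Hf q1 q2 u Hc); reflexivity.
Qed.

Lemma X_span_chart_eq e mu c0 c1 c2 c3 f g : chart_eq f g ->
  chart_eq (X_span e mu c0 c1 c2 c3 f) (X_span e mu c0 c1 c2 c3 g).
Proof.
  intros H q1 q2 u Hc; unfold X_span, op_add, op_scal, X0.
  rewrite !(fun A => X_chart_eq e mu A f g H q1 q2 u Hc), (H q1 q2 u Hc); reflexivity.
Qed.

Lemma X_span_comp e mu a0 a1 a2 a3 b0 b1 b2 b3 f : chart_smooth f ->
  chart_eq (X_span e mu a0 a1 a2 a3 (X_span e mu b0 b1 b2 b3 f))
    (dval f (span_formal e mu a0 a1 a2 a3 (span_formal e mu b0 b1 b2 b3 unknown))).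
Proof.
  intros Hf; eapply chart_eq_trans.
  - apply X_span_chart_eq; exact (X_span_dval e mu b0 b1 b2 b3 unknown f Hf).
  - now apply X_span_dval.
Qed.

Lemma X_span_comm e mu a0 a1 a2 a3 b0 b1 b2 b3 :
  op_eq (op_comm (X_span e mu a0 a1 a2 a3) (X_span e mu b0 b1 b2 b3))
    (X_span e mu 0 (a2 * b3 - a3 * b2) (a1 * b3 - a3 * b1) (a1 * b2 - a2 * b1)).
Proof.
  intros f Hf q1 q2 u Hc; unfold op_comm.
  rewrite !(fun a0 a1 a2 a3 b0 b1 b2 b3 => X_span_comp e mu a0 a1 a2 a3 b0 b1 b2 b3 f Hf q1 q2 u Hc).
  transitivity (dval f (span_formal e mu 0 (a2 * b3 - a3 * b2) (a1 * b3 - a3 * b1)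
     (a1 * b2 - a2 * b1) unknown) q1 q2 u);
    [ | symmetry; exact (X_span_dval e mu _ _ _ _ unknown f Hf q1 q2 u Hc) ].
  cbn [dval ddiff atom_d atom_val X_formal span_formal unknown].
  rewrite !RtoC_minus, !RtoC_mult.
  abstract_derivatives Hc; ring [Esec Ech].
Qed.

Lemma X_span_eq e mu c0 c1 c2 c3 c0' c1' c2' c3' :
  c0 = c0' -> c1 = c1' -> c2 = c2' -> c3 = c3' ->
  op_eq (X_span e mu c0 c1 c2 c3) (X_span e mu c0' c1' c2' c3').
Proof. intros -> -> -> -> f _ q1 q2 u _; reflexivity. Qed.

Lemma op_eq_trans A B D : op_eq A B -> op_eq B D -> op_eq A D.
Proof. intros H1 H2 f Hf q1 q2 u Hc; rewrite H1 by assumption; now apply H2. Qed.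

Lemma continuous_RtoC (h : R * R * R -> R) p :
  continuous h p -> continuous (fun p => RtoC (h p)) p.
Proof.
  intros H; apply filterlim_locally; intros eps.
  generalize (proj1 (filterlim_locally _ _) H eps); apply filter_imp; intros y Hy.
  split; [ exact Hy | apply ball_center ].
Qed.

Lemma chart_smooth_const c : chart_smooth (fun _ _ _ => c).
Proof.
  intros n; revert c; induction n as [|n IH]; intros c; (split; [ intros; apply continuous_const | ]); auto.
  intros a; split.
  - intros q1 q2 u _; apply (is_pd_ex _ _ _ _ _ 0); destruct a; exact (is_CDerive_const c _).
  - replace (pd a (fun _ _ _ => c)) with (fun _ _ _ : R => RtoC 0); [ apply IH | ].
    do 3 (apply functional_extensionality; intros ?).
    symmetry; apply is_pd_unique; destruct a; exact (is_CDerive_const c _).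
Qed.

Lemma chart_smooth_of_pd f (c : coord -> C) :
  (forall p, continuous (fun p : R * R * R => f (fst (fst p)) (snd (fst p)) (snd p)) p) ->
  (forall a q1 q2 u, is_pd a f q1 q2 u (c a)) -> chart_smooth f.
Proof.
  intros H0 H n; destruct n as [|n]; (split; [ intros; apply H0 | ]); auto.
  intros a; split.
  - intros q1 q2 u _; apply (is_pd_ex _ _ _ _ _ _ (H a q1 q2 u)).
  - replace (pd a f) with (fun _ _ _ : R => c a); [ apply chart_smooth_const | ].
    do 3 (apply functional_extensionality; intros ?); symmetry; apply is_pd_unique, H.
Qed.

(** The coordinate functions q1, q2 and the constant 1 detect the four coefficients of an element of
    the algebra. *)
Definition test_q1 : cfield := fun q1 q2 u => RtoC q1.
Definition test_q2 : cfield := fun q1 q2 u => RtoC q2.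

Lemma is_pd_test_q1 a q1 q2 u : is_pd a test_q1 q1 q2 u (match a with Q1 => 1 | _ => 0 end).
Proof.
  destruct a; [ | exact (is_CDerive_const _ _) .. ].
  exact (is_CDerive_RtoC _ _ _ (is_derive_id (K := R_AbsRing) q1)).
Qed.

Lemma is_pd_test_q2 a q1 q2 u : is_pd a test_q2 q1 q2 u (match a with Q2 => 1 | _ => 0 end).
Proof.
  destruct a; [ exact (is_CDerive_const _ _) | | exact (is_CDerive_const _ _) ].
  exact (is_CDerive_RtoC _ _ _ (is_derive_id (K := R_AbsRing) q2)).
Qed.

Lemma continuous_fst_fst (p : R * R * R) : continuous (fun p => fst (fst p)) p.
Proof. apply (continuous_comp fst fst); apply continuous_fst. Qed.

Lemma continuous_snd_fst (p : R * R * R) : continuous (fun p => snd (fst p)) p.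
Proof. apply (continuous_comp fst snd); [ apply continuous_fst | apply continuous_snd ]. Qed.

Lemma chart_smooth_test_q1 : chart_smooth test_q1.
Proof.
  eapply chart_smooth_of_pd; [ | intros; apply is_pd_test_q1 ].
  intros p; apply (continuous_RtoC (fun p => fst (fst p))), continuous_fst_fst.
Qed.

Lemma chart_smooth_test_q2 : chart_smooth test_q2.
Proof.
  eapply chart_smooth_of_pd; [ | intros; apply is_pd_test_q2 ].
  intros p; apply (continuous_RtoC (fun p => snd (fst p))), continuous_snd_fst.
Qed.

(** On q2 = 0 the tangent vanishes. There q1 gives c1, q2 gives c2 cosh q1 + c3 sinh q1 = 0 at q1 =
    0 and q1 = 1, and the constant 1 gives c0 e = 0; the last needs e <> 0, since otherwise X_0 is
    the zero operator. *)
Lemma X_span_inj e mu c0 c1 c2 c3 : e <> 0 ->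
  op_eq (X_span e mu c0 c1 c2 c3) op_zero -> c0 = 0 /\ c1 = 0 /\ c2 = 0 /\ c3 = 0.
Proof.
  intros He H; pose proof PI_RGT_0 as HPI.
  assert (Hc : forall q1, chart q1 0 (PI / 2)) by (intros q1; split; lra).
  assert (E1 : c1 = 0).
  { pose proof (H _ chart_smooth_test_q1 0 0 (PI / 2) (Hc 0)) as E.
    unfold X_span, op_add, op_scal, X0, X, op_zero in E.
    rewrite !(fun a => is_pd_unique _ _ _ _ _ _ (is_pd_test_q1 a _ _ _)) in E.
    unfold test_q1 in E; rewrite tan_0, sinh_0 in E.
    apply (f_equal Re) in E; simpl in E; lra. }
  assert (Eq2 : forall q1, c2 * cosh q1 + c3 * sinh q1 = 0).
  { intros q1; pose proof (H _ chart_smooth_test_q2 q1 0 (PI / 2) (Hc q1)) as E.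
    unfold X_span, op_add, op_scal, X0, X, op_zero in E.
    rewrite !(fun a => is_pd_unique _ _ _ _ _ _ (is_pd_test_q2 a _ _ _)) in E.
    unfold test_q2 in E; rewrite tan_0 in E.
    apply (f_equal Re) in E; simpl in E; lra. }
  assert (E2 : c2 = 0) by (pose proof (Eq2 0) as E; rewrite cosh_0, sinh_0 in E; lra).
  assert (E3 : c3 = 0).
  { pose proof (Eq2 1) as E; rewrite E2 in E.
    assert (Hs : 0 < sinh 1) by (rewrite <- sinh_0; apply sinh_lt; lra).
    assert (E' : c3 * sinh 1 = 0) by lra.
    apply Rmult_integral in E'; lra. }
  assert (E0 : c0 = 0).
  { pose proof (H _ (chart_smooth_const 1) 0 0 (PI / 2) (Hc 0)) as E.
    rewrite E1, E2, E3 in E; unfold X_span, op_add, op_scal, X0, op_zero in E.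
    apply (f_equal Im) in E; simpl in E.
    assert (E' : c0 * e = 0) by lra.
    apply Rmult_integral in E'; tauto. }
  auto.
Qed.

Lemma so12_entries M : so12 M ->
  M G1 G1 = 0 /\ M G2 G2 = 0 /\ M G3 G3 = 0 /\
  M G2 G1 = M G1 G2 /\ M G3 G1 = M G1 G3 /\ M G3 G2 = - M G2 G3.
Proof.
  intros H.
  pose proof (H G1 G1); pose proof (H G2 G2); pose proof (H G3 G3).
  pose proof (H G1 G2); pose proof (H G1 G3); pose proof (H G2 G3).
  simpl in *; lra.
Qed.

(** The index [G1] is timelike, so X_1 and X_3 correspond to boosts and X_2 to the rotation, as in
    [one_param]. *)
Definition so12_mat (c1 c2 c3 : R) : mat3 := fun i j =>
  match i, j with
  | G1, G2 | G2, G1 => c1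
  | G1, G3 | G3, G1 => c3
  | G2, G3 => c2
  | G3, G2 => - c2
  | _, _ => 0
  end.

Lemma so12_mat_so12 c1 c2 c3 : so12 (so12_mat c1 c2 c3).
Proof. intros i j; destruct i, j; simpl; ring. Qed.

Lemma symmetry_algebra_iso e mu : e <> 0 -> iso_so12_R e mu.
Proof.
  intros He.
  exists (fun M s => X_span e mu s (M G1 G2) (M G2 G3) (M G1 G3)).
  split; [ | split; [ | split; [ | split ] ] ].
  - intros a M s b N t _ _ f _ q1 q2 u _.
    unfold X_span, op_add, op_scal, mat_lin; rewrite !RtoC_plus, !RtoC_mult; ring.
  - intros M s N t HM HN.
    eapply op_eq_trans; [ apply X_span_comm | ].
    destruct (so12_entries M HM) as (M11 & M22 & M33 & M21 & M31 & M32).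
    destruct (so12_entries N HN) as (N11 & N22 & N33 & N21 & N31 & N32).
    apply X_span_eq; unfold mat_bracket, mat_mul, sum_gen;
      rewrite ?M11, ?M22, ?M33, ?M21, ?M31, ?M32, ?N11, ?N22, ?N33, ?N21, ?N31, ?N32; ring.
  - intros M s HM H.
    destruct (so12_entries M HM) as (M11 & M22 & M33 & M21 & M31 & M32).
    destruct (X_span_inj _ _ _ _ _ _ He H) as (E0 & E1 & E2 & E3).
    split; [ | exact E0 ].
    intros i j; destruct i, j; lra.
  - intros M s _; exists s, (M G1 G2), (M G2 G3), (M G1 G3).
    intros f _ q1 q2 u _; reflexivity.
  - intros c0 c1 c2 c3; exists (so12_mat c1 c2 c3), c0; split; [ apply so12_mat_so12 | ].
    intros f _ q1 q2 u _; reflexivity.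
Qed.

(** * The kernel of the general solution *)

(** The kernel depends on q1, q2 and l but not on u. *)
Inductive kvar := KQ1 | KQ2 | KL.

Definition d_base1 (a : kvar) (q1 q2 l : R) : R :=
  match a with
  | KQ1 => (exp q1 + l ^ 2 * exp (- q1)) * cos q2
  | KQ2 => 2 * l * cos q2 - (exp q1 - l ^ 2 * exp (- q1)) * sin q2
  | KL => 2 * sin q2 - 2 * l * exp (- q1) * cos q2
  end.

Definition dd_base1 (a : kvar) (q1 q2 l : R) : R :=
  match a with
  | KQ1 => (exp q1 - l ^ 2 * exp (- q1)) * cos q2
  | KQ2 => - base1 q1 q2 l
  | KL => - 2 * exp (- q1) * cos q2
  end.

(* Numerators of the logarithmic derivatives of [base2], the denominator being
   [base1]. *)
Definition dlog_base2 (a : kvar) (q1 q2 l : R) : R :=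
  match a with
  | KQ1 => - 2 * l
  | KQ2 => - (l ^ 2 * exp (- q1) + exp q1)
  | KL => 2
  end.

Definition kslice {T} (a : kvar) (f : R -> R -> R -> T) (q1 q2 l : R) : R -> T :=
  match a with
  | KQ1 => fun t => f t q2 l
  | KQ2 => fun t => f q1 t l
  | KL => fun t => f q1 q2 t
  end.

Definition kcoord (a : kvar) (q1 q2 l : R) : R :=
  match a with KQ1 => q1 | KQ2 => q2 | KL => l end.

Lemma is_derive_base1 a q1 q2 l :
  is_derive (kslice a base1 q1 q2 l) (kcoord a q1 q2 l) (d_base1 a q1 q2 l).
Proof. destruct a; simpl; unfold base1; auto_derive; auto; ring. Qed.

Lemma is_derive_d_base1 a q1 q2 l :
  is_derive (kslice a (d_base1 a) q1 q2 l) (kcoord a q1 q2 l) (dd_base1 a q1 q2 l).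
Proof. destruct a; simpl; unfold base1; auto_derive; auto; ring. Qed.

Lemma is_derive_dlog_base2 a q1 q2 l :
  is_derive (kslice a (dlog_base2 a) q1 q2 l) (kcoord a q1 q2 l) 0.
Proof. destruct a; simpl; auto_derive; auto; ring. Qed.

Definition kregular (q1 q2 l : R) : Prop := - (PI / 2) < q2 < PI / 2 /\ base1 q1 q2 l <> 0.

Definition num2 (q1 q2 l : R) : R := l * exp (- q1) * cos q2 + 1 - sin q2.
Definition den2 (q1 q2 l : R) : R := cos q2 - l * exp (- q1) * (1 - sin q2).

Lemma exp_mul_neg x : exp x * exp (- x) = 1.
Proof. rewrite <- exp_plus, Rplus_opp_r; apply exp_0. Qed.

Lemma num2_den2 q1 q2 l :
  num2 q1 q2 l * den2 q1 q2 l = (1 - sin q2) * exp (- q1) * base1 q1 q2 l.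
Proof.
  unfold num2, den2, base1.
  pose proof (cos2_sin2 q2) as Hs; pose proof (exp_mul_neg q1) as He.
  assert (Es : sin q2 ^ 2 = 1 - cos q2 ^ 2) by lra.
  ring [Es He].
Qed.

Lemma one_minus_sin q2 : - (PI / 2) < q2 < PI / 2 -> 0 < 1 - sin q2.
Proof.
  intros H; assert (Hc : 0 < cos q2) by (apply cos_gt_0; lra).
  pose proof (cos2_sin2 q2); nra.
Qed.

Lemma kregular_num2_den2 q1 q2 l : kregular q1 q2 l -> num2 q1 q2 l <> 0 /\ den2 q1 q2 l <> 0.
Proof.
  intros [Hq HB]; pose proof (one_minus_sin _ Hq) as Hs; pose proof (exp_pos (- q1)) as He.
  pose proof (num2_den2 q1 q2 l) as E.
  assert (Hne : num2 q1 q2 l * den2 q1 q2 l <> 0).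
  { rewrite E; repeat apply Rmult_integral_contrapositive_currified; lra. }
  split; intros E0; rewrite E0 in Hne; apply Hne; ring.
Qed.

(** With [base2] = N/D, the logarithmic derivative is (N'D - ND')/(ND). Numerator and denominator
    share the factor (1 - sin q2) e^(-q1), and [base1] is what remains of ND. *)
Lemma is_derive_base2 a q1 q2 l : kregular q1 q2 l -> exists d,
  is_derive (kslice a base2 q1 q2 l) (kcoord a q1 q2 l) d /\
  d / base2 q1 q2 l = dlog_base2 a q1 q2 l / base1 q1 q2 l.
Proof.
  intros Hr; destruct (kregular_num2_den2 _ _ _ Hr) as [HN HD]; destruct Hr as [Hq HB].
  pose proof (one_minus_sin _ Hq) as Hs; pose proof (exp_pos (- q1)) as He.
  assert (Hquot : forall N' D' : R,
     N' * den2 q1 q2 l - num2 q1 q2 l * D' = (1 - sin q2) * exp (- q1) * dlog_base2 a q1 q2 l ->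
     ((N' * den2 q1 q2 l - num2 q1 q2 l * D') / den2 q1 q2 l ^ 2) / base2 q1 q2 l
     = dlog_base2 a q1 q2 l / base1 q1 q2 l).
  { intros N' D' E; change (base2 q1 q2 l) with (num2 q1 q2 l / den2 q1 q2 l).
    rewrite E; pose proof (num2_den2 q1 q2 l) as E2.
    transitivity ((1 - sin q2) * exp (- q1) * dlog_base2 a q1 q2 l / (num2 q1 q2 l * den2 q1 q2 l)).
    - field; auto.
    - rewrite E2; field; repeat split; auto; lra. }
  pose proof (cos2_sin2 q2) as Hcs; pose proof (exp_mul_neg q1) as Hx.
  assert (Es : sin q2 ^ 2 = 1 - cos q2 ^ 2) by lra.
  destruct a; simpl kslice; simpl kcoord; eexists; (split;
    [ apply (is_derive_div (fun t => num2 _ _ _) (fun t => den2 _ _ _));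
      [ unfold num2; auto_derive; [ auto | reflexivity ]
      | unfold den2; auto_derive; [ auto | reflexivity ] | exact HD ]
    | apply Hquot; unfold num2, den2, dlog_base2; ring [Es Hx] ]).
Qed.

Definition alpha (J : R) : C := (- (Ci * RtoC J) - 1 / 2)%C.
Definition beta (e mu : R) : C := (Ci * RtoC (e * mu))%C.

Definition dlog_kernel (e mu J : R) (a : kvar) (q1 q2 l : R) : C :=
  ((alpha J * RtoC (d_base1 a q1 q2 l) + beta e mu * RtoC (dlog_base2 a q1 q2 l))
   / RtoC (base1 q1 q2 l))%C.

Lemma RtoC_neq_0 x : x <> 0 -> RtoC x <> 0.
Proof. intros H E; apply RtoC_inj in E; auto. Qed.

Lemma is_CDerive_kernel e mu J a q1 q2 l : kregular q1 q2 l ->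
  is_CDerive (kslice a (kernel e mu J) q1 q2 l) (kcoord a q1 q2 l)
    (dlog_kernel e mu J a q1 q2 l * kernel e mu J q1 q2 l)%C.
Proof.
  intros Hr; destruct (kregular_num2_den2 _ _ _ Hr) as [HN HD].
  destruct (is_derive_base2 a _ _ _ Hr) as (d2 & H2 & E2).
  pose proof (is_derive_base1 a q1 q2 l) as H1.
  assert (Hb2 : base2 q1 q2 l <> 0).
  { change (num2 q1 q2 l / den2 q1 q2 l <> 0).
    apply Rmult_integral_contrapositive_currified; auto; now apply Rinv_neq_0_compat. }
  destruct Hr as [_ HB].
  assert (HK : forall (g1 g2 : R -> R) x,
    is_derive g1 x (d_base1 a q1 q2 l) -> is_derive g2 x d2 ->
    g1 x = base1 q1 q2 l -> g2 x = base2 q1 q2 l ->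
    is_CDerive (fun t => Rcpow (g1 t) (alpha J) * Rcpow (g2 t) (beta e mu))%C x
     (dlog_kernel e mu J a q1 q2 l
      * (Rcpow (g1 x) (alpha J) * Rcpow (g2 x) (beta e mu)))%C).
  { intros g1 g2 x Hg1 Hg2 Eg1 Eg2; eapply is_CDerive_eq.
    - apply is_CDerive_mult; apply is_CDerive_Rcpow;
        [ exact Hg1 | now rewrite Eg1 | exact Hg2 | now rewrite Eg2 ].
    - cbv beta; rewrite Eg1, Eg2, E2; unfold dlog_kernel.
      rewrite !RtoC_div by exact HB; field; now apply RtoC_neq_0. }
  destruct a; exact (HK _ _ _ H1 H2 eq_refl eq_refl).
Qed.

Lemma kregular_locally a q1 q2 l : kregular q1 q2 l ->
  locally (kcoord a q1 q2 l) (kslice a kregular q1 q2 l).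
Proof.
  intros [Hq HB].
  assert (H1 : locally (kcoord a q1 q2 l) (fun t => kslice a base1 q1 q2 l t <> 0)).
  { assert (Hc : continuous (kslice a base1 q1 q2 l) (kcoord a q1 q2 l)).
    { apply (ex_derive_continuous (V := R_NormedModule)); eexists; apply is_derive_base1. }
    assert (E : kslice a base1 q1 q2 l (kcoord a q1 q2 l) = base1 q1 q2 l) by now destruct a.
    rewrite <- E in HB; apply Rabs_pos_lt in HB.
    generalize (proj1 (filterlim_locally _ _) Hc (mkposreal _ HB)); apply filter_imp.
    intros t Ht E0; rewrite E0 in Ht.
    change (Rabs (0 + - kslice a base1 q1 q2 l (kcoord a q1 q2 l)) <
      Rabs (kslice a base1 q1 q2 l (kcoord a q1 q2 l))) in Ht.
    rewrite Rplus_0_l, Rabs_Ropp in Ht; lra. }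
  assert (H2 : locally q2 (fun t => - (PI / 2) < t < PI / 2))
    by (apply locally_R_between with (- (PI / 2)) (PI / 2); auto).
  destruct a; simpl in *.
  - revert H1; apply filter_imp; intros t Ht; now split.
  - generalize (filter_and _ _ H1 H2); apply filter_imp; intros t [Ht Ht']; now split.
  - revert H1; apply filter_imp; intros t Ht; now split.
Qed.

(** K''/K = k^2 + k', where k = K'/K = (alpha B' + beta d)/B. The numerator d is constant in the
    variable of differentiation ([is_derive_dlog_base2]), so k' = alpha B''/B - k B'/B. *)
Definition dlog2_kernel (e mu J : R) (a : kvar) (q1 q2 l : R) : C :=
  (dlog_kernel e mu J a q1 q2 l * dlog_kernel e mu J a q1 q2 l
   + alpha J * RtoC (dd_base1 a q1 q2 l) / RtoC (base1 q1 q2 l)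
   - dlog_kernel e mu J a q1 q2 l * RtoC (d_base1 a q1 q2 l) / RtoC (base1 q1 q2 l))%C.

Lemma is_CDerive_RtoC_inv (g : R -> R) x d : is_derive g x d -> g x <> 0 ->
  is_CDerive (fun t => / RtoC (g t))%C x (- RtoC d / (RtoC (g x) * RtoC (g x)))%C.
Proof.
  intros Hg H0; apply is_CDerive_ext_loc with (fun t => RtoC (/ g t)).
  - assert (Hc : continuous g x) by (apply (ex_derive_continuous (V := R_NormedModule)); now exists d).
    apply Rabs_pos_lt in H0.
    generalize (proj1 (filterlim_locally _ _) Hc (mkposreal _ H0)); apply filter_imp.
    intros t Ht; apply RtoC_inv; intros E0; rewrite E0 in Ht.
    change (Rabs (0 + - g x) < Rabs (g x)) in Ht; rewrite Rplus_0_l, Rabs_Ropp in Ht; lra.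
  - eapply is_CDerive_eq; [ exact (is_CDerive_RtoC _ _ _ (is_derive_inv g x d Hg H0)) | ].
    rewrite <- RtoC_opp, <- RtoC_mult, <- RtoC_div.
    + f_equal; field; exact H0.
    + now apply Rmult_integral_contrapositive_currified.
Qed.

Lemma is_CDerive_dkernel e mu J a q1 q2 l : kregular q1 q2 l ->
  is_CDerive (kslice a (fun q1 q2 l => dlog_kernel e mu J a q1 q2 l * kernel e mu J q1 q2 l)%C q1 q2 l)
    (kcoord a q1 q2 l) (dlog2_kernel e mu J a q1 q2 l * kernel e mu J q1 q2 l)%C.
Proof.
  intros Hr; pose proof (is_CDerive_kernel e mu J a q1 q2 l Hr) as HK.
  pose proof (is_derive_base1 a q1 q2 l) as H1.
  pose proof (is_derive_d_base1 a q1 q2 l) as H2.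
  pose proof (is_derive_dlog_base2 a q1 q2 l) as H3.
  destruct Hr as [_ HB].
  assert (H : forall (k : R -> C) (g1 g2 g3 : R -> R) x,
    is_CDerive k x (dlog_kernel e mu J a q1 q2 l * kernel e mu J q1 q2 l)%C ->
    is_derive g1 x (d_base1 a q1 q2 l) -> is_derive g2 x (dd_base1 a q1 q2 l) ->
    is_derive g3 x 0 -> k x = kernel e mu J q1 q2 l ->
    g1 x = base1 q1 q2 l -> g2 x = d_base1 a q1 q2 l -> g3 x = dlog_base2 a q1 q2 l ->
    is_CDerive (fun t => ((alpha J * RtoC (g2 t) + beta e mu * RtoC (g3 t)) / RtoC (g1 t)) * k t)%C x
     (dlog2_kernel e mu J a q1 q2 l * kernel e mu J q1 q2 l)%C).
  { intros k g1 g2 g3 x Hk Hg1 Hg2 Hg3 Ek E1 E2 E3; unfold Cdiv; eapply is_CDerive_eq.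
    - apply is_CDerive_mult; [ apply is_CDerive_mult | exact Hk ].
      + apply is_CDerive_plus; apply is_CDerive_scal, is_CDerive_RtoC; [ exact Hg2 | exact Hg3 ].
      + apply is_CDerive_RtoC_inv; [ exact Hg1 | now rewrite E1 ].
    - cbv beta; rewrite Ek, E1, E2, E3; unfold dlog2_kernel, dlog_kernel.
      field; now apply RtoC_neq_0. }
  destruct a; exact (H _ _ _ _ _ HK H1 H2 H3 eq_refl eq_refl eq_refl eq_refl).
Qed.

Lemma Ci_sqr : (Ci * Ci = - (1))%C.
Proof. apply injective_projections; simpl; ring. Qed.

(* X_A K = - ell_A K, divided by the kernel K. *)
Lemma kernel_system e mu J A q1 q2 l : kregular q1 q2 l ->
  (match A with
   | G1 => dlog_kernel e mu J KQ1 q1 q2 l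
   | G2 => RtoC (sinh q1 * tan q2) * dlog_kernel e mu J KQ1 q1 q2 l
           + RtoC (cosh q1) * dlog_kernel e mu J KQ2 q1 q2 l
           + Ci * RtoC (e * mu * sinh q1 / cos q2)
   | G3 => RtoC (cosh q1 * tan q2) * dlog_kernel e mu J KQ1 q1 q2 l
           + RtoC (sinh q1) * dlog_kernel e mu J KQ2 q1 q2 l
           + Ci * RtoC (e * mu * cosh q1 / cos q2)
   end
   = - (RtoC (ell_vec A l) * dlog_kernel e mu J KL q1 q2 l
        + ell_weight J * RtoC (ell_div A l)))%C.
Proof.
  intros [Hq HB].
  assert (Hcos : cos q2 <> 0) by (apply Rgt_not_eq, cos_gt_0; lra).
  pose proof (cos2_sin2 q2) as Hcs; pose proof (exp_mul_neg q1) as Hx.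
  assert (Es : sin q2 ^ 2 = 1 - cos q2 ^ 2) by lra.
  (* The identity is affine in alpha and beta: it amounts to two real ones. *)
  assert (HR : forall v1 v2 w vl dv : R,
     (v1 * d_base1 KQ1 q1 q2 l + v2 * d_base1 KQ2 q1 q2 l + vl * d_base1 KL q1 q2 l)
       = dv * base1 q1 q2 l ->
     (v1 * dlog_base2 KQ1 q1 q2 l + v2 * dlog_base2 KQ2 q1 q2 l + vl * dlog_base2 KL q1 q2 l)
       = - w * base1 q1 q2 l ->
     (RtoC v1 * dlog_kernel e mu J KQ1 q1 q2 l + RtoC v2 * dlog_kernel e mu J KQ2 q1 q2 l
      + Ci * RtoC (e * mu * w)
      = - (RtoC vl * dlog_kernel e mu J KL q1 q2 l + ell_weight J * RtoC dv))%C).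
  { intros v1 v2 w vl dv E1 E2.
    apply (f_equal RtoC) in E1, E2; rewrite !RtoC_plus, !RtoC_mult in E1, E2.
    rewrite RtoC_opp in E2.
    assert (HB' := RtoC_neq_0 _ HB).
    assert (E : ell_weight J = (- alpha J)%C) by (unfold ell_weight, alpha; ring).
    rewrite E; replace (Ci * RtoC (e * mu * w))%C with (beta e mu * RtoC w)%C
      by (unfold beta; rewrite !RtoC_mult; ring).
    unfold dlog_kernel.
    match goal with |- ?L = ?Rr => assert (E0 : ((L - Rr) * RtoC (base1 q1 q2 l))%C = 0) end.
    { transitivity (alpha J * ((RtoC v1 * RtoC (d_base1 KQ1 q1 q2 l)
          + RtoC v2 * RtoC (d_base1 KQ2 q1 q2 l) + RtoC vl * RtoC (d_base1 KL q1 q2 l))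
          - RtoC dv * RtoC (base1 q1 q2 l))
        + beta e mu * ((RtoC v1 * RtoC (dlog_base2 KQ1 q1 q2 l)
          + RtoC v2 * RtoC (dlog_base2 KQ2 q1 q2 l) + RtoC vl * RtoC (dlog_base2 KL q1 q2 l))
          + RtoC w * RtoC (base1 q1 q2 l)))%C.
      - field; exact HB'.
      - rewrite E1, E2; ring. }
    apply Cmult_integral in E0; destruct E0 as [E0|E0]; [ | contradiction ].
    match type of E0 with (?L - ?Rr)%C = _ =>
      transitivity ((L - Rr) + Rr)%C; [ ring | rewrite E0; ring ] end. }
  destruct A; unfold ell_vec, ell_div.
  - pose proof (HR 1 0 0 l 1) as H; rewrite !Rmult_0_r in H.
    rewrite <- H; [ ring | | ]; unfold d_base1, dlog_base2, base1; ring.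
  - unfold Rdiv at 1; rewrite Rmult_assoc; change (sinh q1 * / cos q2) with (sinh q1 / cos q2).
    apply HR; unfold d_base1, dlog_base2, base1, sinh, cosh, tan.
    + field_simplify_eq; auto; ring [Es Hx].
    + field_simplify_eq; auto; ring [Es Hx].
  - unfold Rdiv at 1; rewrite Rmult_assoc; change (cosh q1 * / cos q2) with (cosh q1 / cos q2).
    apply HR; unfold d_base1, dlog_base2, base1, sinh, cosh, tan.
    + field_simplify_eq; auto; ring [Es Hx].
    + field_simplify_eq; auto; ring [Es Hx].
Qed.

(** The angular part of [KG] applied to the kernel and divided by it. Here x and E stand for e^q1
    and e^(-q1), s and c for sin q2 and cos q2. Over abstract complex numbers only xE = 1 and s^2 +
    c^2 = 1 are needed, and the quotient comes out as a scalar, as expected of a Casimir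
    operator. *)
Lemma kernel_KG_identity (a b x E s c l B : C) :
  (x * E = 1)%C -> (s ^ 2 = 1 - c ^ 2)%C -> (B = 2 * l * s + (x - l ^ 2 * E) * c)%C ->
  B <> 0 -> c <> 0 ->
  let B1 := ((x + l ^ 2 * E) * c)%C in
  let B2 := (2 * l * c - (x - l ^ 2 * E) * s)%C in
  let k1 := ((a * B1 + b * (- (2) * l)) / B)%C in
  let k2 := ((a * B2 + b * (- (l ^ 2 * E + x))) / B)%C in
  let k11 := (k1 * k1 + a * ((x - l ^ 2 * E) * c) / B - k1 * B1 / B)%C in
  let k22 := (k2 * k2 + a * (- B) / B - k2 * B2 / B)%C in
  (- (1 / c ^ 2 * k11 - k22 + s / c * k2) - 2 * b * (s / c ^ 2) * k1 - b ^ 2 * (s ^ 2 / c ^ 2)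
   = - (a * a + a) + b * b)%C.
Proof.
  intros Hx Es EB HB Hc B1 B2 k1 k2 k11 k22; unfold k11, k22, k1, k2, B1, B2.
  field_simplify_eq; [ | auto ].
  rewrite EB.
  ring [Hx Es].
Qed.

Ltac push_RtoC := repeat rewrite ?RtoC_plus, ?RtoC_minus, ?RtoC_opp, ?RtoC_mult, ?RtoC_pow.

Lemma kernel_KG_angular e mu J q1 q2 l : kregular q1 q2 l ->
  (- (RtoC (1 / (cos q2) ^ 2) * dlog2_kernel e mu J KQ1 q1 q2 l
      - dlog2_kernel e mu J KQ2 q1 q2 l
      + RtoC (tan q2) * dlog_kernel e mu J KQ2 q1 q2 l)
   - 2 * Ci * RtoC (e * mu * tan q2 / cos q2) * dlog_kernel e mu J KQ1 q1 q2 l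
   + RtoC (e ^ 2 * mu ^ 2 * (tan q2) ^ 2)
   = RtoC (J ^ 2 - e ^ 2 * mu ^ 2 + 1 / 4))%C.
Proof.
  intros [Hq HB].
  assert (Hcos : cos q2 <> 0) by (apply Rgt_not_eq, cos_gt_0; lra).
  pose proof (cos2_sin2 q2) as Hcs; pose proof (exp_mul_neg q1) as Hx.
  assert (Es : sin q2 ^ 2 = 1 - cos q2 ^ 2) by lra.
  pose proof (kernel_KG_identity (alpha J) (beta e mu) (RtoC (exp q1)) (RtoC (exp (- q1)))
    (RtoC (sin q2)) (RtoC (cos q2)) (RtoC l) (RtoC (base1 q1 q2 l))) as H.
  cbv zeta in H.
  assert (Hpow : forall x : R, (RtoC x ^ 2)%C = RtoC (x ^ 2)) by (intros x; now rewrite RtoC_pow).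
  (* Since alpha = -(iJ + 1/2) and alpha + 1 = 1/2 - iJ, the product -alpha(alpha + 1) is J^2 +
     1/4. *)
  transitivity (- (alpha J * alpha J + alpha J) + beta e mu * beta e mu)%C.
  - rewrite <- H; clear H.
    + unfold dlog2_kernel, dlog_kernel.
      assert (E1 : RtoC (d_base1 KQ1 q1 q2 l)
        = ((RtoC (exp q1) + RtoC l ^ 2 * RtoC (exp (- q1))) * RtoC (cos q2))%C).
      { unfold d_base1; push_RtoC; ring. }
      assert (E2 : RtoC (d_base1 KQ2 q1 q2 l)
        = (2 * RtoC l * RtoC (cos q2)
           - (RtoC (exp q1) - RtoC l ^ 2 * RtoC (exp (- q1))) * RtoC (sin q2))%C).
      { unfold d_base1; push_RtoC; ring. }
      assert (E3 : RtoC (dd_base1 KQ1 q1 q2 l)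
        = ((RtoC (exp q1) - RtoC l ^ 2 * RtoC (exp (- q1))) * RtoC (cos q2))%C).
      { unfold dd_base1; push_RtoC; ring. }
      assert (E4 : RtoC (dd_base1 KQ2 q1 q2 l) = (- RtoC (base1 q1 q2 l))%C).
      { unfold dd_base1; push_RtoC; ring. }
      assert (E5 : RtoC (dlog_base2 KQ1 q1 q2 l) = (- (2) * RtoC l)%C).
      { apply injective_projections; simpl; ring. }
      assert (E6 : RtoC (dlog_base2 KQ2 q1 q2 l)
        = (- (RtoC l ^ 2 * RtoC (exp (- q1)) + RtoC (exp q1)))%C).
      { unfold dlog_base2; push_RtoC; ring. }
      assert (E7 : RtoC (1 / cos q2 ^ 2) = (1 / RtoC (cos q2) ^ 2)%C).
      { rewrite RtoC_div by (now apply pow_nonzero); push_RtoC; reflexivity. }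
      assert (E8 : RtoC (tan q2) = (RtoC (sin q2) / RtoC (cos q2))%C).
      { unfold tan; now rewrite RtoC_div. }
      assert (E9 : (Ci * RtoC (e * mu * tan q2 / cos q2)
         = beta e mu * (RtoC (sin q2) / RtoC (cos q2) ^ 2))%C).
      { unfold tan, beta; rewrite !RtoC_div, !RtoC_mult, RtoC_div by exact Hcos.
        field; now apply RtoC_neq_0. }
      assert (E10 : RtoC (e ^ 2 * mu ^ 2 * tan q2 ^ 2)
         = (- (beta e mu ^ 2 * (RtoC (sin q2) ^ 2 / RtoC (cos q2) ^ 2)))%C).
      { replace (beta e mu ^ 2)%C with (- (RtoC (e * mu) * RtoC (e * mu)))%C.
        2:{ unfold beta; apply injective_projections; simpl; ring. }
        push_RtoC; rewrite E8; field; now apply RtoC_neq_0. }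
      rewrite <- (Cmult_assoc 2 Ci), E1, E2, E3, E4, E5, E6, E7, E8, E9, E10.
      ring.
    + now rewrite <- RtoC_mult, Hx.
    + rewrite !Hpow, Es, RtoC_minus; reflexivity.
    + unfold base1; rewrite Hpow, RtoC_plus, !RtoC_mult, RtoC_minus, !RtoC_mult; reflexivity.
    + now apply RtoC_neq_0.
    + now apply RtoC_neq_0.
  - unfold alpha, beta; apply injective_projections; simpl; field.
Qed.

Lemma kernel_neq_0 e mu J q1 q2 l : kernel e mu J q1 q2 l <> 0.
Proof. apply Cmult_neq_0; apply Rcpow_neq_0. Qed.

Lemma KG_phiJ e mu m zeta J Phi q1 q2 u l : regular q1 q2 u l -> twice_diff Phi u ->
  KG e mu m zeta (fun q1 q2 u => phiJ e mu J Phi q1 q2 u l) q1 q2 u =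
  (kernel e mu J q1 q2 l *
   (CDerive (CDerive Phi) u
   + RtoC (2 * (cos u / sin u)) * CDerive Phi u
   + RtoC (m ^ 2 + 6 * zeta + (J ^ 2 - e ^ 2 * mu ^ 2 + 1 / 4) / (sin u) ^ 2) * Phi u))%C.
Proof.
  intros [Hc HB] [HP1 HP2].
  assert (Hr : kregular q1 q2 l) by (split; [ apply Hc | exact HB ]).
  pose proof (Rgt_not_eq _ _ (chart_cos _ _ _ Hc)) as Hcos.
  pose proof (Rgt_not_eq _ _ (chart_sin _ _ _ Hc)) as Hsin.
  unfold phiJ; set (f := fun q1 q2 u => (Phi u * kernel e mu J q1 q2 l)%C).
  assert (D1 : forall q1 q2, kregular q1 q2 l ->
    pd Q1 f q1 q2 u = (Phi u * (dlog_kernel e mu J KQ1 q1 q2 l * kernel e mu J q1 q2 l))%C).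
  { intros x y H; apply is_CDerive_unique, is_CDerive_scal, (is_CDerive_kernel e mu J KQ1 _ _ _ H). }
  assert (D2 : forall q1 q2, kregular q1 q2 l ->
    pd Q2 f q1 q2 u = (Phi u * (dlog_kernel e mu J KQ2 q1 q2 l * kernel e mu J q1 q2 l))%C).
  { intros x y H; apply is_CDerive_unique, is_CDerive_scal, (is_CDerive_kernel e mu J KQ2 _ _ _ H). }
  assert (D11 : pd Q1 (pd Q1 f) q1 q2 u
    = (Phi u * (dlog2_kernel e mu J KQ1 q1 q2 l * kernel e mu J q1 q2 l))%C).
  (* The first derivative is known only at regular points; these form a neighbourhood, which is
     enough to differentiate again. *)
  { apply is_CDerive_unique; eapply is_CDerive_ext_loc.
    - generalize (kregular_locally KQ1 _ _ _ Hr); apply filter_imp; intros t Ht; symmetry; apply D1, Ht.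
    - apply is_CDerive_scal, (is_CDerive_dkernel e mu J KQ1), Hr. }
  assert (D22 : pd Q2 (pd Q2 f) q1 q2 u
    = (Phi u * (dlog2_kernel e mu J KQ2 q1 q2 l * kernel e mu J q1 q2 l))%C).
  { apply is_CDerive_unique; eapply is_CDerive_ext_loc.
    - generalize (kregular_locally KQ2 _ _ _ Hr); apply filter_imp; intros t Ht; symmetry; apply D2, Ht.
    - apply is_CDerive_scal, (is_CDerive_dkernel e mu J KQ2), Hr. }
  assert (HU : forall g t, ex_CDerive g t ->
    CDerive (fun v => g v * kernel e mu J q1 q2 l)%C t = (CDerive g t * kernel e mu J q1 q2 l)%C).
  { intros g t Hg; apply is_CDerive_unique; eapply is_CDerive_eq.
    - apply is_CDerive_mult; [ apply ex_CDerive_correct, Hg | apply is_CDerive_const ].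
    - cbv beta; ring. }
  assert (D3 : pd U1 f q1 q2 u = (CDerive Phi u * kernel e mu J q1 q2 l)%C).
  { apply HU; exact (locally_singleton _ _ HP1). }
  assert (D33 : pd U1 (pd U1 f) q1 q2 u = (CDerive (CDerive Phi) u * kernel e mu J q1 q2 l)%C).
  { rewrite <- (HU _ _ HP2); apply CDerive_ext_loc.
    revert HP1; apply filter_imp; intros t Ht; apply HU, Ht. }
  unfold KG; rewrite D11, D22, D33, (D1 _ _ Hr), (D2 _ _ Hr), D3; unfold f.
  pose proof (kernel_KG_angular e mu J q1 q2 l Hr) as HA.
  replace (m ^ 2 + 6 * zeta + (J ^ 2 - e ^ 2 * mu ^ 2 + 1 / 4) / sin u ^ 2)
    with ((6 * zeta + m ^ 2) + 1 / sin u ^ 2 * (J ^ 2 - e ^ 2 * mu ^ 2 + 1 / 4)) by (field; auto).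
  replace (e * mu * tan q2 / (sin u ^ 2 * cos q2))
    with (1 / sin u ^ 2 * (e * mu * tan q2 / cos q2)) by (field; auto).
  replace (e ^ 2 * mu ^ 2 * tan q2 ^ 2 / sin u ^ 2)
    with (1 / sin u ^ 2 * (e ^ 2 * mu ^ 2 * tan q2 ^ 2)) by (field; auto).
  rewrite (RtoC_plus (6 * zeta + m ^ 2)), !(RtoC_mult (1 / sin u ^ 2)), <- HA.
  ring.
Qed.

Lemma KG_phiJ_iff e mu m zeta J Phi q1 q2 u l : regular q1 q2 u l -> twice_diff Phi u ->
  (KG e mu m zeta (fun q1 q2 u => phiJ e mu J Phi q1 q2 u l) q1 q2 u = RtoC 0
      <-> reduced_eq e mu m zeta J Phi u).
Proof.
  intros Hr HP; rewrite KG_phiJ by assumption; unfold reduced_eq; split; intros H.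
  - apply Cmult_integral in H; destruct H as [H|H]; [ | exact H ].
    exfalso; exact (kernel_neq_0 _ _ _ _ _ _ H).
  - rewrite H; ring.
Qed.

(** * General solution of the first-order system *)

Lemma admissible_section_cube (D : R * R * R * R -> Prop) q1 q2 u l :
  open D -> D (q1, q2, u, l) -> exists d : posreal, forall x y z,
    Rabs (x - q1) < d -> Rabs (y - q2) < d -> Rabs (z - l) < d -> D (x, y, u, z).
Proof.
  intros HD Hp; destruct (HD _ Hp) as [d Hd]; exists d; intros x y z Hx Hy Hz.
  apply Hd; exact (conj (conj (conj Hx Hy) (Rabs_minus_same u d)) Hz).
Qed.

Lemma X_phi_expand e mu A (F : cfield) q1 q2 u d1 d2 :
  is_pd Q1 F q1 q2 u d1 -> is_pd Q2 F q1 q2 u d2 ->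
  X e mu A F q1 q2 u =
  match A with
  | G1 => d1
  | G2 => (RtoC (sinh q1 * tan q2) * d1 + RtoC (cosh q1) * d2
           + Ci * RtoC (e * mu * sinh q1 / cos q2) * F q1 q2 u)%C
  | G3 => (RtoC (cosh q1 * tan q2) * d1 + RtoC (sinh q1) * d2
           + Ci * RtoC (e * mu * cosh q1 / cos q2) * F q1 q2 u)%C
  end.
Proof.
  intros H1 H2; apply is_pd_unique in H1, H2; destruct A; simpl; simpl in H1, H2; now rewrite H1, ?H2.
Qed.

Lemma phiJ_solves e mu J D phi Phi : admissible D ->
  (forall q1 q2 u l, D (q1, q2, u, l) -> phi q1 q2 u l = phiJ e mu J Phi q1 q2 u l) ->
  solves_system e mu J D phi.
Proof.
  intros (HD & Hreg & _) Hphi q1 q2 u l Hp.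
  destruct (Hreg _ _ _ _ Hp) as [Hc HB].
  assert (Hr : kregular q1 q2 l) by (split; [ apply Hc | exact HB ]).
  destruct (admissible_section_cube D _ _ _ _ HD Hp) as [d Hd].
  assert (Hk : forall a, is_CDerive (kslice a (fun q1 q2 l => phi q1 q2 u l) q1 q2 l) (kcoord a q1 q2 l)
    (dlog_kernel e mu J a q1 q2 l * phi q1 q2 u l)%C).
  { intros a; eapply is_CDerive_ext_loc with
      (fun t => (Phi u * kslice a (kernel e mu J) q1 q2 l t)%C).
    - destruct a; (exists d; intros t Ht; symmetry; simpl; apply Hphi, Hd;
        first [ exact Ht | apply Rabs_minus_same ]).
    - eapply is_CDerive_eq; [ apply is_CDerive_scal, is_CDerive_kernel, Hr | ].
      rewrite (Hphi _ _ _ _ Hp); unfold phiJ; ring. }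
  pose proof (Hk KQ1) as H1; pose proof (Hk KQ2) as H2; pose proof (Hk KL) as H3.
  split; [ | split; [ | split ] ].
  - exact (is_CDerive_ex _ _ _ H1).
  - exact (is_CDerive_ex _ _ _ H2).
  - exact (is_CDerive_ex _ _ _ H3).
  - intros A.
    rewrite (X_phi_expand e mu A (fun q1 q2 u => phi q1 q2 u l) q1 q2 u _ _ H1 H2).
    rewrite ell_expand, (is_CDerive_unique (phi q1 q2 u) l _ H3).
    pose proof (kernel_system e mu J A q1 q2 l Hr) as E.
    apply (f_equal (fun z => z * phi q1 q2 u l)%C) in E.
    transitivity (- (RtoC (ell_vec A l) * dlog_kernel e mu J KL q1 q2 l
       + ell_weight J * RtoC (ell_div A l)) * phi q1 q2 u l)%C; [ rewrite <- E | ring ].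
    destruct A; ring.
Qed.

(* The three equations determine the first derivatives of phi in (q1, q2, l):
   the determinant of their principal part is a multiple of [base1]. *)
Lemma system_log_derivatives e mu J (A1 A2 A3 F : C) q1 q2 l : kregular q1 q2 l ->
  A1 = (- (RtoC l * A3 + ell_weight J * F))%C ->
  (RtoC (sinh q1 * tan q2) * A1 + RtoC (cosh q1) * A2
     + Ci * RtoC (e * mu * sinh q1 / cos q2) * F)%C
   = (- (RtoC ((l ^ 2 + 1) / 2) * A3 + ell_weight J * RtoC l * F))%C ->
  (RtoC (cosh q1 * tan q2) * A1 + RtoC (sinh q1) * A2
     + Ci * RtoC (e * mu * cosh q1 / cos q2) * F)%C
   = (- (RtoC ((l ^ 2 - 1) / 2) * A3 + ell_weight J * RtoC l * F))%C ->
  A1 = (dlog_kernel e mu J KQ1 q1 q2 l * F)%C /\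
  A2 = (dlog_kernel e mu J KQ2 q1 q2 l * F)%C /\
  A3 = (dlog_kernel e mu J KL q1 q2 l * F)%C.
Proof.
  intros Hr E1 E2 E3.
  pose proof (kernel_system e mu J G1 q1 q2 l Hr) as K1.
  pose proof (kernel_system e mu J G2 q1 q2 l Hr) as K2.
  pose proof (kernel_system e mu J G3 q1 q2 l Hr) as K3.
  unfold ell_vec, ell_div in K1, K2, K3.
  destruct Hr as [Hq HB].
  assert (Hcos : cos q2 <> 0) by (apply Rgt_not_eq, cos_gt_0; lra).
  set (k1 := dlog_kernel e mu J KQ1 q1 q2 l) in *.
  set (k2 := dlog_kernel e mu J KQ2 q1 q2 l) in *.
  set (k3 := dlog_kernel e mu J KL q1 q2 l) in *.
  (* Subtracting the derivatives of a multiple of the kernel makes the system homogeneous in [D1],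
     [D2], [D3]. *)
  set (D1 := (A1 - k1 * F)%C); set (D2 := (A2 - k2 * F)%C); set (D3 := (A3 - k3 * F)%C).
  assert (H1 : D1 = (- (RtoC l * D3))%C) by (unfold D1, D3; rewrite E1, K1; ring).
  assert (H2 : (RtoC (sinh q1 * tan q2) * D1 + RtoC (cosh q1) * D2
      + RtoC ((l ^ 2 + 1) / 2) * D3 = 0)%C).
  { transitivity ((RtoC (sinh q1 * tan q2) * A1 + RtoC (cosh q1) * A2
     + Ci * RtoC (e * mu * sinh q1 / cos q2) * F + RtoC ((l ^ 2 + 1) / 2) * A3)
     - (RtoC (sinh q1 * tan q2) * k1 + RtoC (cosh q1) * k2
     + Ci * RtoC (e * mu * sinh q1 / cos q2)) * F - RtoC ((l ^ 2 + 1) / 2) * k3 * F)%C.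
    - unfold D1, D2, D3; ring.
    - rewrite E2, K2; ring. }
  assert (H3 : (RtoC (cosh q1 * tan q2) * D1 + RtoC (sinh q1) * D2
      + RtoC ((l ^ 2 - 1) / 2) * D3 = 0)%C).
  { transitivity ((RtoC (cosh q1 * tan q2) * A1 + RtoC (sinh q1) * A2
     + Ci * RtoC (e * mu * cosh q1 / cos q2) * F + RtoC ((l ^ 2 - 1) / 2) * A3)
     - (RtoC (cosh q1 * tan q2) * k1 + RtoC (sinh q1) * k2
     + Ci * RtoC (e * mu * cosh q1 / cos q2)) * F - RtoC ((l ^ 2 - 1) / 2) * k3 * F)%C.
    - unfold D1, D2, D3; ring.
    - rewrite E3, K3; ring. }
  assert (HD3 : D3 = 0).
  (* cosh q1 times the third equation minus sinh q1 times the second eliminates [D2]; then [D1] = -l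
     [D3] leaves the determinant times [D3]. *)
  { assert (E : (RtoC (- (base1 q1 q2 l / (2 * cos q2))) * D3 = 0)%C).
    { transitivity (RtoC (cosh q1) * (RtoC (cosh q1 * tan q2) * D1 + RtoC (sinh q1) * D2
         + RtoC ((l ^ 2 - 1) / 2) * D3)
        - RtoC (sinh q1) * (RtoC (sinh q1 * tan q2) * D1 + RtoC (cosh q1) * D2
         + RtoC ((l ^ 2 + 1) / 2) * D3))%C; [ | rewrite H2, H3; ring ].
      rewrite H1.
      transitivity (RtoC (- l * tan q2 * (cosh q1 * cosh q1 - sinh q1 * sinh q1)
         + cosh q1 * ((l ^ 2 - 1) / 2) - sinh q1 * ((l ^ 2 + 1) / 2)) * D3)%C.
      - f_equal; f_equal.
        pose proof (exp_mul_neg q1) as Hx.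
        unfold base1, tan, cosh, sinh; field_simplify_eq; auto.
        ring [Hx].
      - rewrite !RtoC_minus, !RtoC_plus, !RtoC_mult, RtoC_minus, RtoC_opp, !RtoC_mult; ring. }
    apply Cmult_integral in E; destruct E as [E|E]; auto.
    exfalso; apply RtoC_inj in E; apply HB.
    assert (E' : base1 q1 q2 l = - (- (base1 q1 q2 l / (2 * cos q2))) * (2 * cos q2)) by (field; auto).
    rewrite E', E; ring. }
  rewrite HD3 in H1, H2, H3.
  assert (HD1 : D1 = 0) by (rewrite H1; ring).
  assert (HD2 : D2 = 0).
  { rewrite HD1 in H2.
    assert (E : (RtoC (cosh q1) * D2 = 0)%C) by (rewrite <- H2; ring).
    apply Cmult_integral in E; destruct E as [E|E]; auto.
    exfalso; apply RtoC_inj in E; pose proof (cosh2_sinh2 q1) as Hch; rewrite E in Hch; nra. }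
  assert (Hsub : forall a b : C, (a - b)%C = 0 -> a = b).
  { intros a b E; transitivity ((a - b) + b)%C; [ ring | rewrite E; ring ]. }
  repeat split; apply Hsub; assumption.
Qed.

Lemma CDerive_0_const_ball (f : R -> C) x d : 0 < d ->
  (forall t, Rabs (t - x) < d -> is_CDerive f t 0) ->
  forall y, Rabs (y - x) < d -> f y = f x.
Proof.
  intros Hd H y Hy.
  assert (Hseg : forall t, Rmin x y <= t <= Rmax x y -> Rabs (t - x) < d).
  { intros t Ht; apply Rle_lt_trans with (Rabs (y - x)); auto.
    unfold Rmin, Rmax in Ht; destruct (Rle_dec x y).
    - rewrite !Rabs_right; lra.
    - rewrite !Rabs_left1; lra. }
  assert (Hc : forall g : R -> R, (forall t, Rabs (t - x) < d -> is_derive g t 0) -> g y = g x).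
  { intros g Hg; destruct (Rtotal_order x y) as [Hxy|[->|Hxy]]; auto; [ symmetry | ];
    apply (eq_is_derive (V := R_NormedModule) g); auto; intros t Ht; apply Hg, Hseg;
    unfold Rmin, Rmax; destruct (Rle_dec x y); lra. }
  apply injective_projections.
  - apply (Hc (fun t => Re (f t))); intros t Ht; apply (proj1 (H t Ht)).
  - apply (Hc (fun t => Im (f t))); intros t Ht; apply (proj2 (H t Ht)).
Qed.

Lemma solves_log_derivatives e mu J D phi q1 q2 u l : admissible D ->
  solves_system e mu J D phi -> D (q1, q2, u, l) -> forall a,
  is_CDerive (kslice a (fun q1 q2 l => phi q1 q2 u l) q1 q2 l) (kcoord a q1 q2 l)
    (dlog_kernel e mu J a q1 q2 l * phi q1 q2 u l)%C.
Proof.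
  intros (HD & Hreg & _) Hs Hp.
  destruct (Hreg _ _ _ _ Hp) as [Hc HB].
  assert (Hr : kregular q1 q2 l) by (split; [ apply Hc | exact HB ]).
  destruct (Hs _ _ _ _ Hp) as (X1 & X2 & X3 & HX).
  apply (ex_pd_correct Q1) in X1; apply (ex_pd_correct Q2) in X2; apply ex_CDerive_correct in X3.
  set (F := fun q1 q2 u => phi q1 q2 u l) in *.
  pose proof (HX G1) as E1; pose proof (HX G2) as E2; pose proof (HX G3) as E3.
  rewrite ell_expand, (fun A => X_phi_expand e mu A F q1 q2 u _ _ X1 X2) in E1.
  rewrite ell_expand, (fun A => X_phi_expand e mu A F q1 q2 u _ _ X1 X2) in E2.
  rewrite ell_expand, (fun A => X_phi_expand e mu A F q1 q2 u _ _ X1 X2) in E3.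
  unfold ell_vec, ell_div in E1, E2, E3; rewrite Cmult_1_r in E1.
  destruct (system_log_derivatives e mu J _ _ _ (phi q1 q2 u l) q1 q2 l Hr
    E1 E2 E3) as (A1 & A2 & A3).
  intros a; destruct a.
  - exact (is_CDerive_eq _ _ _ _ X1 A1).
  - exact (is_CDerive_eq _ _ _ _ X2 A2).
  - exact (is_CDerive_eq _ _ _ _ X3 A3).
Qed.

(** In logarithmic form, w becomes -w; for two functions with the same w the quotient then has
    derivative 0. *)
Lemma is_CDerive_inv (f : R -> C) x w : f x <> 0 ->
  is_CDerive f x (w * f x)%C -> is_CDerive (fun t => / f t)%C x (- w * / f x)%C.
Proof.
  intros H0 [H1 H2].
  set (n := fun t => Re (f t) ^ 2 + Im (f t) ^ 2).
  assert (Hn0 : n x <> 0).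
  { unfold n; intros E; apply H0; apply injective_projections; simpl; unfold Re, Im in E; nra. }
  assert (Hn : is_derive n x (2 * (Re (f x) * Re (w * f x) + Im (f x) * Im (w * f x)))).
  { unfold n; evar_last.
    - apply (is_derive_plus (V := R_NormedModule)).
      + apply is_derive_ext with (fun t => Re (f t) * Re (f t)); [ intros; eqR; ring | ].
        apply (is_derive_Rmult _ _ _ _ _ H1 H1).
      + apply is_derive_ext with (fun t => Im (f t) * Im (f t)); [ intros; eqR; ring | ].
        apply (is_derive_Rmult _ _ _ _ _ H2 H2).
    - unfold plus; simpl; ring. }
  unfold n in Hn0; split; simpl.
  - evar_last; [ apply (is_derive_div _ n _ _ _ H1 Hn Hn0) | ].
    unfold n; simpl; unfold Re, Im in *; field; intros E; apply Hn0; rewrite <- E; ring.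
  - evar_last; [ apply (is_derive_div _ n _ _ _ (is_derive_opp (V := R_NormedModule) _ _ _ H2) Hn Hn0) | ].
    unfold n; change opp with Ropp; simpl; unfold Re, Im in *; field; intros E; apply Hn0; rewrite <- E; ring.
Qed.

(** For each u, [psi] is constant on the section of [D]; choosing these constants for all u at once
    gives [Phi]. Over an empty section any constant serves. *)
Lemma solves_phiJ e mu J D phi : admissible D -> solves_system e mu J D phi ->
  exists Phi : R -> C, forall q1 q2 u l, D (q1, q2, u, l) ->
    phi q1 q2 u l = phiJ e mu J Phi q1 q2 u l.
Proof.
  intros Hadm Hs; pose proof Hadm as (HD & Hreg & Hconn).
  set (psi := fun u q1 q2 l => (phi q1 q2 u l * / kernel e mu J q1 q2 l)%C).
  assert (Hpsi : forall q1 q2 u l, D (q1, q2, u, l) -> forall a,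
     is_CDerive (kslice a (psi u) q1 q2 l) (kcoord a q1 q2 l) 0).
  { intros q1 q2 u l Hp a.
    destruct (Hreg _ _ _ _ Hp) as [Hc HB].
    assert (Hr : kregular q1 q2 l) by (split; [ apply Hc | exact HB ]).
    pose proof (solves_log_derivatives _ _ _ _ _ _ _ _ _ Hadm Hs Hp a) as H1.
    pose proof (is_CDerive_kernel e mu J a _ _ _ Hr) as H2.
    pose proof (kernel_neq_0 e mu J q1 q2 l) as HK.
    assert (H : forall (f k : R -> C) x w fx kx, is_CDerive f x (w * fx)%C ->
      is_CDerive k x (w * kx)%C -> kx <> 0 -> f x = fx -> k x = kx ->
      is_CDerive (fun t => f t * / k t)%C x 0).
    { intros f k x w fx kx Hf Hk' Hk <- <-; eapply is_CDerive_eq.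
      - apply is_CDerive_mult; [ exact Hf | apply is_CDerive_inv; eassumption ].
      - cbv beta; ring. }
    destruct a; exact (H _ _ _ _ _ _ H1 H2 HK eq_refl eq_refl). }
  assert (Hcube : forall q1 q2 u l, D (q1, q2, u, l) -> exists d : posreal, forall x y z,
     Rabs (x - q1) < d -> Rabs (y - q2) < d -> Rabs (z - l) < d ->
     D (x, y, u, z) /\ psi u x y z = psi u q1 q2 l).
  { intros q1 q2 u l Hp.
    destruct (admissible_section_cube D _ _ _ _ HD Hp) as [d Hd].
    pose proof (cond_pos d) as Hd0.
    exists d; intros x y z Hx Hy Hz; split; [ now apply Hd | ].
    (* Inside the cube any two points are joined by three segments parallel to the axes. *)
    transitivity (psi u x y l); [ | transitivity (psi u x q2 l) ].
    - apply (CDerive_0_const_ball (fun t => psi u x y t) l d Hd0); auto.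
      intros t Ht; refine (Hpsi x y u t _ KL); now apply Hd.
    - apply (CDerive_0_const_ball (fun t => psi u x t l) q2 d Hd0); auto.
      intros t Ht; refine (Hpsi x t u l _ KQ2); apply Hd; auto using Rabs_minus_same.
    - apply (CDerive_0_const_ball (fun t => psi u t q2 l) q1 d Hd0); auto.
      intros t Ht; refine (Hpsi t q2 u l _ KQ1); apply Hd; auto using Rabs_minus_same. }
  assert (Hex : forall u, exists c : C, forall q1 q2 l, D (q1, q2, u, l) -> psi u q1 q2 l = c).
  { intros u; destruct (classic (exists q1 q2 l, D (q1, q2, u, l))) as [(a & b & c & Hp)|Hno].
    2:{ exists 0%C; intros q1 q2 l Hp; exfalso; apply Hno; now exists q1, q2, l. }
    exists (psi u a b c).
    (* A level set of [psi] in the section. It is open, and so is its complement in the section,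
       because [psi] is locally constant. *)
    set (E := fun p : R * R * R => D (fst (fst p), snd (fst p), u, snd p)
       /\ psi u (fst (fst p)) (snd (fst p)) (snd p) = psi u a b c).
    assert (HE : forall q1 q2 l, D (q1, q2, u, l) -> E (q1, q2, l)).
    { apply Hconn.
      - intros [[q1 q2] l] [Hq Hv]; simpl in *.
        destruct (Hcube _ _ _ _ Hq) as [d Hd]; exists d; intros [[x y] z] [[Hx Hy] Hz].
        destruct (Hd x y z Hx Hy Hz) as [H1 H2]; split; simpl; [ exact H1 | now rewrite H2 ].
      - intros [[q1 q2] l] [Hq Hv]; simpl in *.
        destruct (Hcube _ _ _ _ Hq) as [d Hd]; exists d; intros [[x y] z] [[Hx Hy] Hz].
        destruct (Hd x y z Hx Hy Hz) as [H1 H2]; simpl; split; [ exact H1 | ].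
        intros [_ H3]; apply Hv; split; simpl in *; [ exact Hq | now rewrite <- H2 ].
      - exists a, b, c; split; [ exact Hp | split; simpl; auto ]. }
    intros q1 q2 l Hq; exact (proj2 (HE _ _ _ Hq)). }
  exists (fun u => proj1_sig (constructive_indefinite_description _ (Hex u))).
  intros q1 q2 u l Hp; unfold phiJ.
  destruct (constructive_indefinite_description _ (Hex u)) as [c Hcst]; simpl.
  rewrite <- (Hcst _ _ _ Hp); unfold psi; field; apply kernel_neq_0.
Qed.

Lemma general_solution e mu J D : admissible D -> forall phi,
  solves_system e mu J D phi <->
  exists Phi : R -> C, forall q1 q2 u l, D (q1, q2, u, l) ->
    phi q1 q2 u l = phiJ e mu J Phi q1 q2 u l.
Proof.
  intros HD phi; split; [ now apply solves_phiJ | intros [Phi H]; now apply phiJ_solves with Phi ].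
Qed.

(** * Complex power series and the hypergeometric equation *)

Definition is_CSeries (u : nat -> C) (l : C) : Prop :=
  is_series (fun n => Re (u n)) (Re l) /\ is_series (fun n => Im (u n)) (Im l).

Lemma is_CSeries_unique u l l' : is_CSeries u l -> is_CSeries u l' -> l = l'.
Proof.
  intros [H1 H2] [H3 H4].
  apply injective_projections.
  - transitivity (Series (fun n => Re (u n))); [ symmetry | ]; apply is_series_unique; assumption.
  - transitivity (Series (fun n => Im (u n))); [ symmetry | ]; apply is_series_unique; assumption.
Qed.

Lemma is_CSeries_ext u w l : (forall n, u n = w n) -> is_CSeries u l -> is_CSeries w l.
Proof.
  intros E [H1 H2]; split.
  - eapply is_series_ext; [ | exact H1 ]; intros n; simpl; now rewrite E.
  - eapply is_series_ext; [ | exact H2 ]; intros n; simpl; now rewrite E.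
Qed.

Lemma is_CSeries_eq u l l' : is_CSeries u l -> l = l' -> is_CSeries u l'.
Proof. now intros H <-. Qed.

Lemma is_CSeries_plus u w l l' : is_CSeries u l -> is_CSeries w l' ->
  is_CSeries (fun n => u n + w n)%C (l + l')%C.
Proof.
  intros [H1 H2] [H3 H4]; split.
  - exact (is_series_plus (V := R_NormedModule) _ _ _ _ H1 H3).
  - exact (is_series_plus (V := R_NormedModule) _ _ _ _ H2 H4).
Qed.

Lemma is_CSeries_scal c u l : is_CSeries u l -> is_CSeries (fun n => c * u n)%C (c * l)%C.
Proof.
  intros [H1 H2]; split; simpl.
  - exact (is_series_minus (V := R_NormedModule) _ _ _ _
      (is_series_scal (V := R_NormedModule) (fst c) _ _ H1)
      (is_series_scal (V := R_NormedModule) (snd c) _ _ H2)).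
  - exact (is_series_plus (V := R_NormedModule) _ _ _ _
      (is_series_scal (V := R_NormedModule) (fst c) _ _ H2)
      (is_series_scal (V := R_NormedModule) (snd c) _ _ H1)).
Qed.

Lemma is_CSeries_shift (u : nat -> C) (l : C) : u 0%nat = 0 -> is_CSeries (fun n => u (S n)) l -> is_CSeries u l.
Proof.
  intros E [H1 H2]; split; apply (is_series_decr_1 (V := R_NormedModule)); cbv beta; rewrite E;
  change (fst (RtoC 0)) with 0; unfold plus, opp; simpl; rewrite Ropp_0, Rplus_0_r; assumption.
Qed.

Lemma is_CSeries_zero : is_CSeries (fun _ => 0) 0.
Proof.
  assert (H : is_series (fun _ : nat => 0) 0).
  { apply filterlim_ext with (fun _ : nat => 0).
    - intros n; symmetry; rewrite sum_n_const; eqR; ring.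
    - apply filterlim_const. }
  split; exact H.
Qed.

Definition unit_disk_convergent (t : nat -> C) : Prop := forall x, Rabs x < 1 ->
  Rbar_lt (Rabs x) (CV_radius (fun n => Re (t n))) /\
  Rbar_lt (Rabs x) (CV_radius (fun n => Im (t n))).

Lemma CV_radius_ge (a : nat -> R) r : 
  (exists M, forall n, Rabs (a n * r ^ n) <= M) -> Rbar_le r (CV_radius a).
Proof. intros H; now apply (proj1 (CV_radius_bounded a)). Qed.

Lemma unit_disk_convergent_bounded t :
  (forall r, 0 <= r < 1 -> exists M, forall n, Cmod (t n) * r ^ n <= M) ->
  unit_disk_convergent t.
Proof.
  intros H x Hx.
  pose proof (Rabs_pos x) as Hx0.
  (* A radius strictly between |x| and 1. *)
  destruct (H ((1 + Rabs x) / 2)) as [M HM]; [ lra | ].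
  assert (Hr : forall n, 0 <= ((1 + Rabs x) / 2) ^ n) by (intros n; apply pow_le; lra).
  assert (Hlt : Rbar_lt (Rabs x) ((1 + Rabs x) / 2)) by (simpl; lra).
  split; apply Rbar_lt_le_trans with (1 := Hlt); apply CV_radius_ge; exists M; intros n;
    rewrite Rabs_mult, (Rabs_right (_ ^ n)) by (apply Rle_ge, Hr);
    (eapply Rle_trans; [ | apply HM ]); apply Rmult_le_compat_r; try apply Hr.
  - apply re_le_Cmod.
  - apply Rle_trans with (2 := Rmax_Cmod (t n)); apply Rmax_r.
Qed.

Definition Cpower_series (t : nat -> C) (x : R) : C := CSeries (fun n => t n * RtoC (x ^ n))%C.

Lemma Cpower_series_PSeries t x :
  Cpower_series t x = (PSeries (fun n => Re (t n)) x, PSeries (fun n => Im (t n)) x).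
Proof.
  unfold Cpower_series, CSeries, PSeries; f_equal; apply Series_ext; intros n; simpl;
  unfold Re, Im; ring.
Qed.

Lemma is_CSeries_power_series t x : unit_disk_convergent t -> Rabs x < 1 ->
  is_CSeries (fun n => t n * RtoC (x ^ n))%C (Cpower_series t x).
Proof.
  intros Ht Hx; destruct (Ht x Hx) as [H1 H2].
  rewrite Cpower_series_PSeries.
  apply CV_disk_inside, ex_series_Rabs, Series_correct in H1.
  apply CV_disk_inside, ex_series_Rabs, Series_correct in H2.
  split; simpl.
  - eapply is_series_ext; [ | exact H1 ]; intros n; simpl; unfold Re, Im; ring.
  - eapply is_series_ext; [ | exact H2 ]; intros n; simpl; unfold Re, Im; ring.
Qed.

Definition CPS_derive (t : nat -> C) : nat -> C := fun n => (RtoC (INR (S n)) * t (S n))%C.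

Lemma unit_disk_convergent_derive t : unit_disk_convergent t -> unit_disk_convergent (CPS_derive t).
Proof.
  intros Ht x Hx; destruct (Ht x Hx) as [H1 H2].
  rewrite <- CV_radius_derive in H1; rewrite <- CV_radius_derive in H2.
  unfold PS_derive in H1, H2.
  split.
  - erewrite CV_radius_ext; [ exact H1 | ]; intros n; unfold CPS_derive, Re, Cmult, RtoC; cbn [fst snd]; ring.
  - erewrite CV_radius_ext; [ exact H2 | ]; intros n; unfold CPS_derive, Im, Cmult, RtoC; cbn [fst snd]; ring.
Qed.

Lemma is_CDerive_power_series t x : unit_disk_convergent t -> Rabs x < 1 ->
  is_CDerive (Cpower_series t) x (Cpower_series (CPS_derive t) x).
Proof.
  intros Ht Hx; destruct (Ht x Hx) as [H1 H2].
  split.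
  - eapply is_derive_ext; [ intros y; rewrite Cpower_series_PSeries; reflexivity | ].
    evar_last; [ now apply is_derive_PSeries | ].
    rewrite Cpower_series_PSeries; unfold Re, Im; cbn [fst snd]; apply PSeries_ext; intros n.
    unfold PS_derive, CPS_derive, Re, Cmult, RtoC; cbn [fst snd]; ring.
  - eapply is_derive_ext; [ intros y; rewrite Cpower_series_PSeries; reflexivity | ].
    evar_last; [ now apply is_derive_PSeries | ].
    rewrite Cpower_series_PSeries; unfold Re, Im; cbn [fst snd]; apply PSeries_ext; intros n.
    unfold PS_derive, CPS_derive, Im, Cmult, RtoC; cbn [fst snd]; ring.
Qed.

(** * The hypergeometric series and its equation *)

Definition hyp_coef (a b c : C) (n : nat) : C :=
  (Cpoch a n * Cpoch b n / (Cpoch c n * RtoC (INR (fact n))))%C.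

Lemma Hyp2F1_power_series a b c x : Hyp2F1 a b c x = Cpower_series (hyp_coef a b c) x.
Proof. reflexivity. Qed.

Lemma Cpoch_pos (c : R) n : 0 < c -> Cpoch (RtoC c) n <> 0.
Proof.
  intros Hc; induction n as [|n IH]; simpl.
  - apply RtoC_neq_0; lra.
  - apply Cmult_neq_0; auto; rewrite <- RtoC_plus; apply RtoC_neq_0.
    pose proof (pos_INR n); lra.
Qed.

Lemma hyp_coef_rec a b (c : R) n : 0 < c ->
  (hyp_coef a b (RtoC c) (S n) * ((RtoC c + RtoC (INR n)) * RtoC (INR (S n)))
   = (a + RtoC (INR n)) * (b + RtoC (INR n)) * hyp_coef a b (RtoC c) n)%C.
Proof.
  intros Hc; unfold hyp_coef; simpl Cpoch.
  rewrite fact_simpl, mult_INR, RtoC_mult.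
  pose proof (pos_INR n).
  field; repeat split;
    first [ now apply Cpoch_pos
          | now apply RtoC_neq_0, INR_fact_neq_0
          | now apply RtoC_neq_0, not_0_INR
          | rewrite <- RtoC_plus; apply RtoC_neq_0; lra ].
Qed.

Lemma eventually_nonincreasing_bounded (w : nat -> R) N :
  (forall n, (N <= n)%nat -> w (S n) <= w n) -> exists M, forall n, w n <= M.
Proof.
  intros H.
  assert (HN : exists M, forall n, (n <= N)%nat -> w n <= M).
  { clear H; induction N as [|N [M HM]].
    - exists (w 0%nat); intros n Hn; replace n with 0%nat by lia; lra.
    - exists (Rmax M (w (S N))); intros n Hn; destruct (Nat.eq_dec n (S N)) as [->|Hne].
      + apply Rmax_r.
      + apply Rle_trans with (2 := Rmax_l _ _); apply HM; lia. }
  destruct HN as [M HM]; exists M; intros n.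
  destruct (Nat.le_gt_cases n N) as [Hn|Hn]; auto.
  apply Rle_trans with (w N); auto.
  replace n with (N + (n - N))%nat by lia; induction (n - N)%nat as [|k IH].
  - rewrite Nat.add_0_r; lra.
  - rewrite Nat.add_succ_r; apply Rle_trans with (2 := IH); apply H; lia.
Qed.

(** Ratio test: for r < 1 the sequence |t_n| r^n is eventually nonincreasing. *)
Lemma hyp_coef_convergent a b (c : R) : 0 < c -> unit_disk_convergent (hyp_coef a b (RtoC c)).
Proof.
  intros Hc; apply unit_disk_convergent_bounded; intros r Hr.
  set (A := Cmod a); set (B := Cmod b).
  pose proof (Cmod_ge_0 a) as HA; pose proof (Cmod_ge_0 b) as HB; fold A in HA; fold B in HB.
  (* With x = n it suffices that (A + x)(B + x) r <= (c + x)(x + 1). For x >= 1 the left side is at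
     most r x^2 + (A + B + AB) x, hence at most x^2 as soon as A + B + AB <= x (1 - r). *)
  destruct (INR_unbounded (Rmax 1 ((A + B + A * B) / (1 - r)))) as [N HN].
  apply eventually_nonincreasing_bounded with N; intros n Hn.
  set (x := INR n).
  assert (Hx : Rmax 1 ((A + B + A * B) / (1 - r)) < x) by (apply Rlt_le_trans with (1 := HN), le_INR, Hn).
  assert (Hx1 : 1 < x) by (apply Rle_lt_trans with (2 := Hx), Rmax_l).
  assert (Hx2 : A + B + A * B <= x * (1 - r)).
  { apply Rmult_le_reg_r with (/ (1 - r)); [ apply Rinv_0_lt_compat; lra | ].
    rewrite Rmult_assoc, Rinv_r, Rmult_1_r by lra.
    apply Rlt_le, Rle_lt_trans with (2 := Hx), Rmax_r. }
  pose proof (hyp_coef_rec a b c n Hc) as E; apply (f_equal Cmod) in E.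
  rewrite !Cmod_mult, <- RtoC_plus, !Cmod_R in E.
  rewrite (Rabs_right (INR (S n))) in E by (apply Rle_ge, pos_INR).
  fold x in E; rewrite (Rabs_right (c + x)) in E by lra.
  assert (ES : INR (S n) = x + 1) by apply S_INR; rewrite ES in E.
  assert (Ha : Cmod (a + RtoC x) <= A + x).
  { eapply Rle_trans; [ apply Cmod_triangle | ]; rewrite Cmod_R, Rabs_right by lra; unfold A; lra. }
  assert (Hb : Cmod (b + RtoC x) <= B + x).
  { eapply Rle_trans; [ apply Cmod_triangle | ]; rewrite Cmod_R, Rabs_right by lra; unfold B; lra. }
  set (t0 := Cmod (hyp_coef a b c n)) in *; set (t1 := Cmod (hyp_coef a b c (S n))) in *.
  assert (Ht0 : 0 <= t0) by apply Cmod_ge_0.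
  assert (Hab : Cmod (a + RtoC x) * Cmod (b + RtoC x) <= (A + x) * (B + x)).
  { apply Rmult_le_compat; auto using Cmod_ge_0. }
  assert (Hkey : (A + x) * (B + x) * r <= (c + x) * (x + 1)).
  { assert (r * (A * B + (A + B) * x) <= (A + B + A * B) * x).
    { assert (0 <= A * B) by now apply Rmult_le_pos.
      assert (A * B <= A * B * x) by nra. 
      assert (0 <= (A + B) * x) by (apply Rmult_le_pos; lra).
      nra. }
    nra. }
  assert (Hpos : 0 < (c + x) * (x + 1)) by (apply Rmult_lt_0_compat; lra).
  change (t1 * r ^ S n <= t0 * r ^ n).
  simpl pow; rewrite <- Rmult_assoc; apply Rmult_le_compat_r; [ apply pow_le; lra | ].
  apply Rmult_le_reg_r with ((c + x) * (x + 1)); [ exact Hpos | ].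
  replace (t1 * r * ((c + x) * (x + 1))) with (t1 * ((c + x) * (x + 1)) * r) by ring.
  rewrite E.
  apply Rle_trans with (t0 * ((A + x) * (B + x) * r)).
  - replace (Cmod (a + x) * Cmod (b + x) * t0 * r) with (t0 * (Cmod (a + x) * Cmod (b + x) * r)) by ring.
    apply Rmult_le_compat_l; auto; apply Rmult_le_compat_r; lra.
  - now apply Rmult_le_compat_l.
Qed.

(** Term-by-term differentiation on |x| < 1; the coefficient of x^n in the equation is the
    recurrence [hyp_coef_rec]. *)
Lemma Hyp2F1_ode a b (c : R) : 0 < c -> exists G1 G2 : R -> C, forall x, Rabs x < 1 ->
  is_CDerive (Hyp2F1 a b (RtoC c)) x (G1 x) /\ is_CDerive G1 x (G2 x) /\
  (RtoC x * (1 - RtoC x) * G2 x + (RtoC c - (a + b + 1) * RtoC x) * G1 x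
   - a * b * Hyp2F1 a b (RtoC c) x = 0)%C.
Proof.
  intros Hc; set (t := hyp_coef a b (RtoC c)).
  assert (H0 : unit_disk_convergent t) by now apply hyp_coef_convergent.
  pose proof (unit_disk_convergent_derive _ H0) as H1.
  pose proof (unit_disk_convergent_derive _ H1) as H2.
  exists (Cpower_series (CPS_derive t)), (Cpower_series (CPS_derive (CPS_derive t))).
  intros x Hx; split; [ now apply is_CDerive_power_series | split; [ now apply is_CDerive_power_series | ] ].
  change (Hyp2F1 a b c x) with (Cpower_series t x).
  pose proof (is_CSeries_power_series _ _ H0 Hx) as S0.
  pose proof (is_CSeries_power_series _ _ H1 Hx) as S1.
  pose proof (is_CSeries_power_series _ _ H2 Hx) as S2.
  set (g0 := Cpower_series t x) in *; set (g1 := Cpower_series (CPS_derive t) x) in *;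
  set (g2 := Cpower_series (CPS_derive (CPS_derive t)) x) in *.
  assert (Sx1 : is_CSeries (fun n => RtoC (INR n) * t n * RtoC (x ^ n))%C (RtoC x * g1)%C).
  { apply is_CSeries_shift; [ simpl; ring | ].
    eapply is_CSeries_ext; [ | apply (is_CSeries_scal (RtoC x) _ _ S1) ].
    intros n; unfold CPS_derive; simpl pow; rewrite RtoC_mult; ring. }
  assert (Sx2 : is_CSeries (fun n => RtoC (INR n) * RtoC (INR (S n)) * t (S n) * RtoC (x ^ n))%C
     (RtoC x * g2)%C).
  { apply is_CSeries_shift; [ simpl; ring | ].
    eapply is_CSeries_ext; [ | apply (is_CSeries_scal (RtoC x) _ _ S2) ].
    intros n; unfold CPS_derive; change (x ^ S n) with (x * x ^ n); rewrite RtoC_mult; ring. }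
  (* At n = 0 the value [pred 0] = 0 is harmless: the coefficient n (n - 1) vanishes anyway. *)
  assert (Sxx2 : is_CSeries (fun n => RtoC (INR (pred n)) * RtoC (INR n) * t n * RtoC (x ^ n))%C
     (RtoC x * (RtoC x * g2))%C).
  { apply is_CSeries_shift; [ simpl; ring | ].
    eapply is_CSeries_ext; [ | apply (is_CSeries_scal (RtoC x) _ _ Sx2) ].
    intros n; simpl pred; change (x ^ S n) with (x * x ^ n); rewrite RtoC_mult; ring. }
  apply (is_CSeries_unique (fun _ => 0)); [ | apply is_CSeries_zero ].
  pose proof (is_CSeries_plus _ _ _ _ Sx2 (is_CSeries_plus _ _ _ _ (is_CSeries_scal (- (1)) _ _ Sxx2)
    (is_CSeries_plus _ _ _ _ (is_CSeries_scal (RtoC c) _ _ S1)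
    (is_CSeries_plus _ _ _ _ (is_CSeries_scal (- (a + b + 1)) _ _ Sx1)
      (is_CSeries_scal (- (a * b)) _ _ S0))))) as Ssum.
  eapply is_CSeries_ext; [ | eapply is_CSeries_eq; [ exact Ssum | ring ] ].
  intros n; cbv beta.
  pose proof (hyp_coef_rec a b c n Hc) as E; fold t in E.
  unfold CPS_derive.
  transitivity (RtoC (x ^ n) * (t (S n) * ((RtoC c + RtoC (INR n)) * RtoC (INR (S n)))
     - (a + RtoC (INR n)) * (b + RtoC (INR n)) * t n))%C; [ | rewrite E; ring ].
  destruct n as [|n]; simpl pred.
  - simpl; ring.
  - rewrite (S_INR n), RtoC_plus; ring.
Qed.

(** * Solutions of the reduced equation *)

Definition reduced_coef (e mu m zeta J v : R) : R :=
  m ^ 2 + 6 * zeta + (J ^ 2 - e ^ 2 * mu ^ 2 + 1 / 4) / (sin v) ^ 2.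

(** Explicit derivatives [y1], [y2] in place of iterated [CDerive] make linear combinations and
    products immediate; [reduced_solution_solves] converts back. *)
Definition reduced_solution (e mu m zeta J : R) (y : R -> C) : Prop :=
  exists y1 y2 : R -> C, forall v, 0 < v < PI ->
    is_CDerive y v (y1 v) /\ is_CDerive y1 v (y2 v) /\
    (y2 v + RtoC (2 * (cos v / sin v)) * y1 v + RtoC (reduced_coef e mu m zeta J v) * y v = 0)%C.

Lemma reduced_solution_solves e mu m zeta J y :
  reduced_solution e mu m zeta J y -> solves_reduced e mu m zeta J y.
Proof.
  intros (y1 & y2 & H) v Hv.
  assert (Hloc : locally v (fun t => 0 < t < PI)) by now apply locally_R_between with 0 PI.
  assert (E1 : forall t, 0 < t < PI -> CDerive y t = y1 t)
    by (intros t Ht; apply is_CDerive_unique, H, Ht).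
  assert (D2 : is_CDerive (CDerive y) v (y2 v)).
  { apply is_CDerive_ext_loc with y1; [ | apply H, Hv ].
    revert Hloc; apply filter_imp; intros t Ht; symmetry; now apply E1. }
  split; [ split | ].
  - revert Hloc; apply filter_imp; intros t Ht; exact (is_CDerive_ex _ _ _ (proj1 (H t Ht))).
  - exact (is_CDerive_ex _ _ _ D2).
  - unfold reduced_eq; rewrite (is_CDerive_unique _ _ _ D2), E1 by exact Hv; apply (H v Hv).
Qed.

Lemma reduced_solution_lin e mu m zeta J (a b : C) y w :
  reduced_solution e mu m zeta J y -> reduced_solution e mu m zeta J w ->
  reduced_solution e mu m zeta J (fun v => a * y v + b * w v)%C.
Proof.
  intros (y1 & y2 & Hy) (w1 & w2 & Hw).
  exists (fun v => a * y1 v + b * w1 v)%C, (fun v => a * y2 v + b * w2 v)%C.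
  intros v Hv; destruct (Hy v Hv) as (A1 & A2 & A3); destruct (Hw v Hv) as (B1 & B2 & B3).
  split; [ | split ].
  - now apply is_CDerive_plus; apply is_CDerive_scal.
  - now apply is_CDerive_plus; apply is_CDerive_scal.
  - transitivity (a * (y2 v + RtoC (2 * (cos v / sin v)) * y1 v + RtoC (reduced_coef e mu m zeta J v) * y v)
      + b * (w2 v + RtoC (2 * (cos v / sin v)) * w1 v + RtoC (reduced_coef e mu m zeta J v) * w v))%C.
    + ring.
    + rewrite A3, B3; ring.
Qed.

(** On the chart this is (sin v)^(-s-1/2), split as in [Phi1] and [Phi2]: the weight 1/sqrt(sin v)
    and the factor (1 - x^2)^(-s/2) of the Ferrers functions at x = cos v. *)
Definition prefactor (s : C) (v : R) : C :=
  (RtoC (1 / sqrt (sin v)) * Rcpow (1 - cos v ^ 2) (- (s / 2)))%C.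

Lemma is_CDerive_prefactor s v : 0 < sin v ->
  is_CDerive (prefactor s) v (- ((s + 1 / 2) * RtoC (cos v / sin v)) * prefactor s v)%C.
Proof.
  intros Hs.
  assert (Hsq : 0 < sqrt (sin v)) by now apply sqrt_lt_R0.
  assert (E : sqrt (sin v) * sqrt (sin v) = sin v) by (apply sqrt_sqrt; lra).
  pose proof (cos2_sin2 v) as Hcs.
  assert (Hz : 1 - cos v ^ 2 = sin v ^ 2) by lra.
  assert (D1 : is_derive (fun v => 1 / sqrt (sin v)) v (- (1 / 2) * (cos v / sin v) * (1 / sqrt (sin v)))).
  { auto_derive; [ repeat split; lra | ].
    rewrite E; field; lra. }
  assert (D2 : is_derive (fun v => 1 - cos v ^ 2) v (2 * sin v * cos v)).
  { auto_derive; auto; ring. }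
  unfold prefactor; eapply is_CDerive_eq.
  - apply is_CDerive_mult; [ exact (is_CDerive_RtoC _ _ _ D1) | ].
    apply is_CDerive_Rcpow; [ exact D2 | ].
    rewrite Hz; apply pow_nonzero; lra.
  - cbv beta; rewrite Hz.
    replace (2 * sin v * cos v / sin v ^ 2) with (2 * (cos v / sin v)) by (field; lra).
    rewrite !RtoC_mult, RtoC_opp, RtoC_div by lra; field; apply RtoC_neq_0; lra.
Qed.

Lemma reduced_solution_prefactor e mu m zeta J (nu : R) (s : C) (H H1 H2 : R -> C) :
  (s * s = RtoC (e ^ 2 * mu ^ 2 - J ^ 2))%C ->
  (nu + 1 / 2) ^ 2 = 1 + m ^ 2 + 6 * zeta ->
  (forall v, 0 < v < PI -> is_CDerive H v (H1 v) /\ is_CDerive H1 v (H2 v) /\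
     (H2 v + (1 - 2 * s) * RtoC (cos v / sin v) * H1 v
      + (RtoC nu + s) * (RtoC nu - s + 1) * H v = 0)%C) ->
  reduced_solution e mu m zeta J (fun v => prefactor s v * H v)%C.
Proof.
  intros Es Enu HH.
  set (k := (s + 1 / 2)%C); set (cot := fun v => RtoC (cos v / sin v)).
  exists (fun v => prefactor s v * (H1 v - k * cot v * H v))%C,
    (fun v => prefactor s v * ((H2 v + k * RtoC (/ sin v * / sin v) * H v - k * cot v * H1 v)
       - k * cot v * (H1 v - k * cot v * H v)))%C.
  intros v Hv; destruct (HH v Hv) as (D1 & D2 & EH).
  assert (Hs : 0 < sin v) by (apply sin_gt_0; lra).
  pose proof (is_CDerive_prefactor s v Hs) as DS; fold k in DS.
  change (RtoC (cos v / sin v)) with (cot v) in *.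
  assert (Dcot : is_CDerive cot v (- RtoC (/ sin v * / sin v))).
  { eapply is_CDerive_eq; [ apply is_CDerive_RtoC, is_derive_cot; lra | apply RtoC_opp ]. }
  split; [ | split ].
  - eapply is_CDerive_eq; [ exact (is_CDerive_mult _ _ _ _ _ DS D1) | cbv beta; ring ].
  - eapply is_CDerive_eq.
    + apply is_CDerive_mult; [ exact DS | apply is_CDerive_minus; [ exact D2 | ] ].
      apply is_CDerive_mult; [ apply is_CDerive_scal, Dcot | exact D1 ].
    + cbv beta; ring.
  - assert (Ecot : (RtoC (/ sin v * / sin v) = 1 + cot v * cot v)%C).
    { unfold cot; rewrite <- RtoC_mult, <- RtoC_plus; f_equal.
      transitivity ((cos v ^ 2 + sin v ^ 2) / sin v ^ 2); [ rewrite cos2_sin2 | ]; field; lra. }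
    (* The coefficient in terms of nu and s: m^2 + 6 zeta = (nu + 1/2)^2 - 1 and J^2 - e^2 mu^2 +
       1/4 = 1/4 - s^2. *)
    assert (Ecoef : RtoC (reduced_coef e mu m zeta J v)
       = ((RtoC nu + 1 / 2) * (RtoC nu + 1 / 2) - 1 + (1 / 4 - s * s) * RtoC (/ sin v * / sin v))%C).
    { unfold reduced_coef.
      replace (m ^ 2 + 6 * zeta + (J ^ 2 - e ^ 2 * mu ^ 2 + 1 / 4) / sin v ^ 2)
        with ((nu + 1 / 2) * (nu + 1 / 2) - 1
          + (1 / 4 - (e ^ 2 * mu ^ 2 - J ^ 2)) * (/ sin v * / sin v)).
      2:{ replace ((nu + 1 / 2) * (nu + 1 / 2)) with ((nu + 1 / 2) ^ 2) by ring; rewrite Enu; field; lra. }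
      set (w := e ^ 2 * mu ^ 2 - J ^ 2) in *.
      rewrite RtoC_plus, !RtoC_mult, !RtoC_minus, <- Es, !RtoC_mult, RtoC_plus.
      replace (RtoC (1 / 2)) with (1 / 2)%C by (apply injective_projections; simpl; field).
      replace (RtoC (1 / 4)) with (1 / 4)%C by (apply injective_projections; simpl; field).
      reflexivity. }
    rewrite Ecoef, Ecot, (RtoC_mult 2).
    change (RtoC (cos v / sin v)) with (cot v).
    transitivity (prefactor s v * (H2 v + (1 - 2 * s) * cot v * H1 v
      + (RtoC nu + s) * (RtoC nu - s + 1) * H v))%C; [ | rewrite EH; ring ].
    unfold k; field.
Qed.

Lemma cos_sqr_lt_1 v : 0 < sin v -> Rabs (cos v ^ 2) < 1.
Proof.
  intros Hs; pose proof (cos2_sin2 v).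
  rewrite Rabs_right by (apply Rle_ge, pow2_ge_0); nra.
Qed.

Definition even_angular (nu s : C) (v : R) : C :=
  Hyp2F1 (- (nu / 2) - s / 2) (nu / 2 - s / 2 + 1 / 2) (1 / 2) (cos v ^ 2).

Definition odd_angular (nu s : C) (v : R) : C :=
  (RtoC (cos v) * Hyp2F1 (1 / 2 - nu / 2 - s / 2) (nu / 2 - s / 2 + 1) (3 / 2) (cos v ^ 2)%R)%C.

Lemma is_derive_cos_sqr v : is_derive (fun v => cos v ^ 2) v (- (2 * sin v * cos v)).
Proof. auto_derive; auto; ring. Qed.

Lemma RtoC_half : RtoC (1 / 2) = (1 / 2)%C.
Proof. apply injective_projections; simpl; field. Qed.

Lemma RtoC_three_half : RtoC (3 / 2) = (3 / 2)%C.
Proof. apply injective_projections; simpl; field. Qed.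

Lemma is_CDerive_cos_sqr_comp (G G1 G2 : R -> C) :
  (forall x, Rabs x < 1 -> is_CDerive G x (G1 x) /\ is_CDerive G1 x (G2 x)) ->
  forall v, 0 < sin v ->
  is_CDerive (fun v => G (cos v ^ 2)%R) v (- (2 * RtoC (sin v) * RtoC (cos v)) * G1 (cos v ^ 2)%R)%C /\
  is_CDerive (fun v => G1 (cos v ^ 2)%R) v (- (2 * RtoC (sin v) * RtoC (cos v)) * G2 (cos v ^ 2)%R)%C.
Proof.
  intros HG v Hs; destruct (HG _ (cos_sqr_lt_1 v Hs)) as [D1 D2].
  split; eapply is_CDerive_eq;
    [ exact (is_CDerive_comp _ _ _ _ _ D1 (is_derive_cos_sqr v)) | |
      exact (is_CDerive_comp _ _ _ _ _ D2 (is_derive_cos_sqr v)) | ];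
    rewrite RtoC_opp, !RtoC_mult; ring.
Qed.

Lemma is_CDerive_sin v : is_CDerive (fun v => RtoC (sin v)) v (RtoC (cos v)).
Proof. apply is_CDerive_RtoC, is_derive_sin. Qed.

Lemma is_CDerive_cos v : is_CDerive (fun v => RtoC (cos v)) v (- RtoC (sin v)).
Proof. eapply is_CDerive_eq; [ apply is_CDerive_RtoC, is_derive_cos | apply RtoC_opp ]. Qed.

(** Under x = cos^2 v the hypergeometric equation with c = 1/2 becomes the angular one. *)
Lemma even_angular_ode (nu : C) (s : C) : exists H1 H2 : R -> C, forall v, 0 < v < PI ->
  is_CDerive (even_angular nu s) v (H1 v) /\ is_CDerive H1 v (H2 v) /\
  (H2 v + (1 - 2 * s) * RtoC (cos v / sin v) * H1 v
   + (nu + s) * (nu - s + 1) * even_angular nu s v = 0)%C.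
Proof.
  destruct (Hyp2F1_ode (- (nu / 2) - s / 2) (nu / 2 - s / 2 + 1 / 2) (1 / 2)) as (G1 & G2 & HG); [ lra | ].
  rewrite RtoC_half in HG.
  exists (fun v => - (2 * RtoC (sin v) * RtoC (cos v)) * G1 (cos v ^ 2)%R)%C.
  (* The second derivative is left open and determined by the product rule below. *)
  eexists (fun v => _); intros v Hv.
  assert (Hs : 0 < sin v) by (apply sin_gt_0; lra).
  destruct (is_CDerive_cos_sqr_comp _ G1 G2 (fun x Hx => conj (proj1 (HG x Hx)) (proj1 (proj2 (HG x Hx)))) v Hs)
    as [D1 D2].
  split; [ exact D1 | split ].
  - apply is_CDerive_mult; [ | exact D2 ].
    apply is_CDerive_opp, is_CDerive_mult; [ apply is_CDerive_scal, is_CDerive_sin | apply is_CDerive_cos ].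
  - destruct (HG _ (cos_sqr_lt_1 v Hs)) as (_ & _ & E).
    unfold even_angular; cbv beta.
    assert (Hs0 : RtoC (sin v) <> 0) by (apply RtoC_neq_0; lra).
    assert (Ecs : (RtoC (sin v) * RtoC (sin v) = 1 - RtoC (cos v) * RtoC (cos v))%C).
    { rewrite <- !RtoC_mult, <- RtoC_minus; f_equal; pose proof (cos2_sin2 v); lra. }
    rewrite RtoC_div by lra.
    replace (RtoC (cos v ^ 2)) with (RtoC (cos v) * RtoC (cos v))%C in E
      by (rewrite <- RtoC_mult; f_equal; ring).
    set (F := Hyp2F1 _ _ _ _) in *.
    set (g1 := G1 (cos v ^ 2)%R) in *; set (g2 := G2 (cos v ^ 2)%R) in *.
    set (x := RtoC (cos v)) in *; set (y := RtoC (sin v)) in *.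
    (* The factor 4 comes from (dx/dv)^2 = 4 sin^2 v cos^2 v = 4x(1 - x); in this step the name [x]
       stands for cos v. *)
    transitivity (4 * (x * x * (1 - x * x) * g2
      + (1 / 2 - (- (nu / 2) - s / 2 + (nu / 2 - s / 2 + 1 / 2) + 1) * (x * x)) * g1
      - (- (nu / 2) - s / 2) * (nu / 2 - s / 2 + 1 / 2) * F))%C; [ | rewrite E; ring ].
    field_simplify_eq; [ | auto ].
    cbv beta; ring [Ecs].
Qed.

Lemma odd_angular_ode (nu : C) (s : C) : exists H1 H2 : R -> C, forall v, 0 < v < PI ->
  is_CDerive (odd_angular nu s) v (H1 v) /\ is_CDerive H1 v (H2 v) /\
  (H2 v + (1 - 2 * s) * RtoC (cos v / sin v) * H1 v
   + (nu + s) * (nu - s + 1) * odd_angular nu s v = 0)%C.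
Proof.
  destruct (Hyp2F1_ode (1 / 2 - nu / 2 - s / 2) (nu / 2 - s / 2 + 1) (3 / 2)) as (G1 & G2 & HG); [ lra | ].
  rewrite RtoC_three_half in HG.
  set (G := Hyp2F1 (1 / 2 - nu / 2 - s / 2) (nu / 2 - s / 2 + 1) (3 / 2)) in *.
  exists (fun v => - RtoC (sin v) * G (cos v ^ 2)%R
    + RtoC (cos v) * (- (2 * RtoC (sin v) * RtoC (cos v)) * G1 (cos v ^ 2)%R))%C.
  eexists (fun v => _); intros v Hv.
  assert (Hs : 0 < sin v) by (apply sin_gt_0; lra).
  destruct (is_CDerive_cos_sqr_comp G G1 G2 (fun x Hx => conj (proj1 (HG x Hx)) (proj1 (proj2 (HG x Hx)))) v Hs)
    as [D1 D2].
  split; [ exact (is_CDerive_mult _ _ _ _ _ (is_CDerive_cos v) D1) | split ].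
  - apply is_CDerive_plus.
    + apply is_CDerive_mult; [ apply is_CDerive_opp, is_CDerive_sin | exact D1 ].
    + apply is_CDerive_mult; [ apply is_CDerive_cos | ].
      apply is_CDerive_mult; [ | exact D2 ].
      apply is_CDerive_opp, is_CDerive_mult; [ apply is_CDerive_scal, is_CDerive_sin | apply is_CDerive_cos ].
  - destruct (HG _ (cos_sqr_lt_1 v Hs)) as (_ & _ & E).
    unfold odd_angular; fold G; cbv beta.
    assert (Hs0 : RtoC (sin v) <> 0) by (apply RtoC_neq_0; lra).
    assert (Ecs : (RtoC (sin v) * RtoC (sin v) = 1 - RtoC (cos v) * RtoC (cos v))%C).
    { rewrite <- !RtoC_mult, <- RtoC_minus; f_equal; pose proof (cos2_sin2 v); lra. }
    rewrite RtoC_div by lra.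
    replace (RtoC (cos v ^ 2)) with (RtoC (cos v) * RtoC (cos v))%C in E
      by (rewrite <- RtoC_mult; f_equal; ring).
    set (F := G (cos v ^ 2)%R) in *.
    set (g1 := G1 (cos v ^ 2)%R) in *; set (g2 := G2 (cos v ^ 2)%R) in *.
    set (x := RtoC (cos v)) in *; set (y := RtoC (sin v)) in *.
    transitivity (4 * x * (x * x * (1 - x * x) * g2
      + (3 / 2 - (1 / 2 - nu / 2 - s / 2 + (nu / 2 - s / 2 + 1) + 1) * (x * x)) * g1
      - (1 / 2 - nu / 2 - s / 2) * (nu / 2 - s / 2 + 1) * F))%C; [ | rewrite E; ring ].
    field_simplify_eq; [ | auto ].
    cbv beta; ring [Ecs].
Qed.

Lemma Rcsqrt_sqr x : (Rcsqrt x * Rcsqrt x)%C = RtoC x.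
Proof.
  unfold Rcsqrt; destruct (Rle_dec 0 x) as [H|H].
  - rewrite <- RtoC_mult, sqrt_sqrt by lra; reflexivity.
  - transitivity (Ci * Ci * (RtoC (sqrt (- x)) * RtoC (sqrt (- x))))%C; [ ring | ].
    rewrite Ci_sqr, <- RtoC_mult, sqrt_sqrt by lra; apply injective_projections; simpl; ring.
Qed.

Definition Phi_even (e mu m zeta J v : R) : C :=
  (prefactor (ord e mu J) v * even_angular (RtoC (deg m zeta)) (ord e mu J) v)%C.
Definition Phi_odd (e mu m zeta J v : R) : C :=
  (prefactor (ord e mu J) v * odd_angular (RtoC (deg m zeta)) (ord e mu J) v)%C.

Lemma deg_sqr m zeta : 0 <= 1 + m ^ 2 + 6 * zeta -> (deg m zeta + 1 / 2) ^ 2 = 1 + m ^ 2 + 6 * zeta.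
Proof.
  intros H; unfold deg.
  replace (sqrt (1 + m ^ 2 + 6 * zeta) - 1 / 2 + 1 / 2) with (sqrt (1 + m ^ 2 + 6 * zeta)) by ring.
  now apply pow2_sqrt.
Qed.

Lemma Phi_even_solution e mu m zeta J : 0 <= 1 + m ^ 2 + 6 * zeta ->
  reduced_solution e mu m zeta J (Phi_even e mu m zeta J).
Proof.
  intros H; destruct (even_angular_ode (RtoC (deg m zeta)) (ord e mu J)) as (H1 & H2 & HH).
  exact (reduced_solution_prefactor e mu m zeta J (deg m zeta) (ord e mu J) _ H1 H2
    (Rcsqrt_sqr _) (deg_sqr _ _ H) HH).
Qed.

Lemma Phi_odd_solution e mu m zeta J : 0 <= 1 + m ^ 2 + 6 * zeta ->
  reduced_solution e mu m zeta J (Phi_odd e mu m zeta J).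
Proof.
  intros H; destruct (odd_angular_ode (RtoC (deg m zeta)) (ord e mu J)) as (H1 & H2 & HH).
  exact (reduced_solution_prefactor e mu m zeta J (deg m zeta) (ord e mu J) _ H1 H2
    (Rcsqrt_sqr _) (deg_sqr _ _ H) HH).
Qed.

(** * The Ferrers functions in the basis of even and odd solutions *)

Definition W1_const (nu s : C) : C :=
  (Rcpow 2 s / RtoC (sqrt PI)
   * (CGamma (nu / 2 + s / 2 + 1 / 2) * rGamma (nu / 2 - s / 2 + 1)))%C.
Definition W2_const (nu s : C) : C :=
  (Rcpow 2 (s + 1) / RtoC (sqrt PI)
   * (CGamma (nu / 2 + s / 2 + 1) * rGamma (nu / 2 - s / 2 + 1 / 2)))%C.

Definition theta (nu s : C) : C := ((nu + s) / 2 * RtoC PI)%C.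

Lemma Phi1_even_odd e mu m zeta J (nu := RtoC (deg m zeta)) (s := ord e mu J) v :
  Phi1 e mu m zeta J v =
  (Ccos (theta nu s) * W1_const nu s * Phi_even e mu m zeta J v
   + Csin (theta nu s) * W2_const nu s * Phi_odd e mu m zeta J v)%C.
Proof.
  unfold Phi1, LegendreP, legW1, legW2, Phi_even, Phi_odd, prefactor, W1_const, W2_const,
    even_angular, odd_angular, theta; fold nu s; unfold Rdiv, Cdiv; ring.
Qed.

Lemma Phi2_even_odd e mu m zeta J (nu := RtoC (deg m zeta)) (s := ord e mu J) v :
  Phi2 e mu m zeta J v =
  (- (RtoC (PI / 2) * Csin (theta nu s) * W1_const nu s) * Phi_even e mu m zeta J v
   + RtoC (PI / 2) * Ccos (theta nu s) * W2_const nu s * Phi_odd e mu m zeta J v)%C.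
Proof.
  unfold Phi2, LegendreQ, legW1, legW2, Phi_even, Phi_odd, prefactor, W1_const, W2_const,
    even_angular, odd_angular, theta; fold nu s; unfold Rdiv, Cdiv; ring.
Qed.

Lemma Phi1_solves e mu m zeta J : 0 <= 1 + m ^ 2 + 6 * zeta ->
  solves_reduced e mu m zeta J (Phi1 e mu m zeta J).
Proof.
  intros H; apply reduced_solution_solves.
  rewrite (functional_extensionality _ _ (Phi1_even_odd e mu m zeta J)).
  exact (reduced_solution_lin e mu m zeta J _ _ _ _ (Phi_even_solution _ _ _ _ _ H)
    (Phi_odd_solution _ _ _ _ _ H)).
Qed.

Lemma Phi2_solves e mu m zeta J : 0 <= 1 + m ^ 2 + 6 * zeta ->
  solves_reduced e mu m zeta J (Phi2 e mu m zeta J).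
Proof.
  intros H; apply reduced_solution_solves.
  rewrite (functional_extensionality _ _ (Phi2_even_odd e mu m zeta J)).
  exact (reduced_solution_lin e mu m zeta J _ _ _ _ (Phi_even_solution _ _ _ _ _ H)
    (Phi_odd_solution _ _ _ _ _ H)).
Qed.

(** * Non-vanishing of 1/Gamma and linear independence *)

Lemma Cmod_le_Re_Im z : Cmod z <= Rabs (Re z) + Rabs (Im z).
Proof.
  replace z with (RtoC (Re z) + Ci * RtoC (Im z))%C at 1.
  2:{ apply injective_projections; simpl; unfold Re, Im; ring. }
  eapply Rle_trans; [ apply Cmod_triangle | ].
  rewrite Cmod_mult, !Cmod_R, Cmod_Ci; lra.
Qed.

Lemma im_le_Cmod z : Rabs (Im z) <= Cmod z.
Proof. apply Rle_trans with (2 := Rmax_Cmod z), Rmax_r. Qed.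

Lemma is_derive_le_bound (f df : R -> R) (t K : R) : 0 <= t ->
  (forall x, 0 <= x <= t -> is_derive f x (df x)) ->
  (forall x, 0 <= x <= t -> Rabs (df x) <= K) -> Rabs (f t - f 0) <= K * t.
Proof.
  intros Ht Hd HK.
  assert (E : Rmin 0 t = 0) by now apply Rmin_left.
  assert (E' : Rmax 0 t = t) by now apply Rmax_right.
  destruct (MVT_gen f 0 t df) as [c [Hc Hf]]; rewrite ?E, ?E' in *.
  - intros x Hx; apply Hd; lra.
  - intros x Hx; apply continuity_pt_filterlim, (ex_derive_continuous (V := R_NormedModule)).
    eexists; apply Hd, Hx.
  - rewrite Hf, Rminus_0_r, Rabs_mult, (Rabs_right t) by lra.
    apply Rmult_le_compat_r; auto.
Qed.

(** The mean value theorem applies to the real and imaginary parts separately; adding the two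
    estimates costs the factor 2. *)
Lemma is_CDerive_le_bound (f df : R -> C) (t K : R) : 0 <= t ->
  (forall x, 0 <= x <= t -> is_CDerive f x (df x)) ->
  (forall x, 0 <= x <= t -> Cmod (df x) <= K) -> Cmod (f t - f 0) <= 2 * K * t.
Proof.
  intros Ht Hd HK.
  assert (H1 : Rabs (Re (f t) - Re (f 0)) <= K * t).
  { apply (is_derive_le_bound (fun x => Re (f x)) (fun x => Re (df x))); auto.
    - intros x Hx; apply (proj1 (Hd x Hx)).
    - intros x Hx; eapply Rle_trans; [ apply re_le_Cmod | now apply HK ]. }
  assert (H2 : Rabs (Im (f t) - Im (f 0)) <= K * t).
  { apply (is_derive_le_bound (fun x => Im (f x)) (fun x => Im (df x))); auto.
    - intros x Hx; apply (proj2 (Hd x Hx)).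
    - intros x Hx; eapply Rle_trans; [ apply im_le_Cmod | now apply HK ]. }
  eapply Rle_trans; [ apply Cmod_le_Re_Im | ].
  change (Rabs (Re (f t) - Re (f 0)) + Rabs (Im (f t) - Im (f 0)) <= 2 * K * t); lra.
Qed.

Lemma Cmod_Cexp z : Cmod (Cexp z) = exp (Re z).
Proof.
  replace (Cexp z) with (RtoC (exp (Re z)) * (cos (Im z), sin (Im z)))%C.
  2:{ apply injective_projections; simpl; ring. }
  rewrite Cmod_mult, Cmod_R, Rabs_right by (apply Rle_ge, Rlt_le, exp_pos).
  unfold Cmod; simpl fst; simpl snd; rewrite cos2_sin2, sqrt_1; ring.
Qed.

Lemma Cmod_Cexp_le z : Cmod (Cexp z) <= exp (Cmod z).
Proof.
  rewrite Cmod_Cexp; pose proof (re_le_Cmod z) as H.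
  pose proof (Rle_abs (Re z)).
  destruct (Req_dec (Re z) (Cmod z)) as [->|Hne]; [ lra | ].
  apply Rlt_le, exp_increasing; lra.
Qed.

(** (1 + zt)(1 - t)^z: at t = 1/(n+1) it is the quotient of consecutive terms in Gauss's limit for
    1/Gamma ([gauss_seq_step]). *)
Definition gauss_factor (z : C) (t : R) : C := ((1 + z * RtoC t) * Cexp (z * RtoC (ln (1 - t))))%C.

(** The derivative is -z(1+z) t/(1-t) (1-t)^z. It vanishes at t = 0, so the deviation from 1 is
    quadratic. *)
Lemma gauss_factor_bound z : exists K, 0 < K /\ forall t, 0 <= t <= 1 / 2 ->
  Cmod (gauss_factor z t - 1) <= K * t ^ 2.
Proof.
  (* For t <= 1/2, x/(1-x) <= 2t accounts for the 2, and |ln(1-x)| <= 1 for exp |z|. The final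
     constant 2K + 1 includes the factor 2 of [is_CDerive_le_bound] and is positive even when K =
     0. *)
  set (K := 2 * Cmod (z * (1 + z)) * exp (Cmod z)).
  assert (HK : 0 <= K).
  { unfold K; pose proof (exp_pos (Cmod z)); pose proof (Cmod_ge_0 (z * (1 + z))).
    apply Rmult_le_pos; lra. }
  exists (2 * K + 1); split; [ lra | ]; intros t Ht.
  assert (E0 : gauss_factor z 0 = 1).
  { unfold gauss_factor; rewrite Rminus_0_r, ln_1, !Cmult_0_r, Cexp_0; ring. }
  assert (H : Cmod (gauss_factor z t - gauss_factor z 0) <= 2 * (K * t) * t).
  { apply (is_CDerive_le_bound (gauss_factor z)
      (fun x => - (z * (1 + z)) * RtoC (x / (1 - x)) * Cexp (z * RtoC (ln (1 - x))))%C); [ lra | | ].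
    - intros x Hx; unfold gauss_factor.
      assert (D : is_derive (fun t => ln (1 - t)) x (- / (1 - x))) by (auto_derive; [ lra | field; lra ]).
      eapply is_CDerive_eq.
      + apply is_CDerive_mult.
        * apply is_CDerive_plus; [ apply is_CDerive_const | ].
          apply is_CDerive_scal, is_CDerive_RtoC, (is_derive_id (K := R_AbsRing)).
        * apply is_CDerive_Cexp, is_CDerive_scal, is_CDerive_RtoC, D.
      + cbv beta; change (RtoC (@one R_AbsRing)) with (RtoC 1).
        rewrite RtoC_opp, RtoC_inv, RtoC_div, RtoC_minus by lra.
        field; intros E; apply (RtoC_neq_0 (1 - x)); [ lra | rewrite <- E, RtoC_minus; ring ].
    - intros x Hx.
      rewrite !Cmod_mult, Cmod_opp, Cmod_R.
      assert (Hq : 0 <= x / (1 - x) <= 2 * t).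
      { split; [ apply Rmult_le_pos; [ lra | apply Rlt_le, Rinv_0_lt_compat; lra ] | ].
        apply Rmult_le_reg_r with (1 - x); [ lra | ].
        unfold Rdiv; rewrite Rmult_assoc, Rinv_l, Rmult_1_r by lra; nra. }
      rewrite (Rabs_right (x / (1 - x))) by lra.
      assert (Hln : 0 <= - ln (1 - x) <= 1).
      { split.
        - assert (ln (1 - x) <= ln 1) by (apply ln_le; lra); rewrite ln_1 in *; lra.
        - assert (Hl : ln (/ 2) <= ln (1 - x)) by (apply ln_le; lra).
          rewrite ln_Rinv in Hl by lra; pose proof ln_lt_2.
          assert (ln 2 <= 1).
          { rewrite <- (ln_exp 1); apply ln_le; [ lra | ]; pose proof (exp_ineq1 1); lra. }
          lra. }
      assert (Hexp : Cmod (Cexp (z * RtoC (ln (1 - x)))) <= exp (Cmod z)).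
      { eapply Rle_trans; [ apply Cmod_Cexp_le | ].
        assert (Hz : Cmod (z * RtoC (ln (1 - x))) <= Cmod z).
        { rewrite Cmod_mult, Cmod_R, Rabs_left1 by lra.
          pose proof (Cmod_ge_0 z); nra. }
        destruct Hz as [Hz|Hz]; [ now apply Rlt_le, exp_increasing | rewrite Hz; lra ]. }
      apply Rle_trans with (Cmod (z * (1 + z)) * (2 * t) * exp (Cmod z)).
      + apply Rmult_le_compat; auto using Cmod_ge_0.
        * apply Rmult_le_pos; [ apply Cmod_ge_0 | lra ].
        * apply Rmult_le_compat_l; [ apply Cmod_ge_0 | lra ].
      + unfold K; right; ring. }
  rewrite E0 in H; eapply Rle_trans; [ exact H | ]; nra.
Qed.

(* The bounds c (1 + 2M/n) <= |P n| <= c' (2 - 2M/n) are inductive, which keeps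
   the products away from 0 and infinity without logarithms. *)
Lemma infinite_product_limit (P : nat -> C) (N : nat) (M : R) : 0 < M -> 2 * M <= INR N ->
  (forall n, (N <= n)%nat -> P n <> 0) ->
  (forall n, (N <= n)%nat -> exists w, P (S n) = (P n * (1 + w))%C /\ Cmod w <= M / INR (S n) ^ 2) ->
  exists l : C, l <> 0 /\
    is_lim_seq (fun n => Re (P n)) (Re l) /\ is_lim_seq (fun n => Im (P n)) (Im l).
Proof.
  intros HM HN Hne Hstep.
  assert (HINR : forall n, (N <= n)%nat -> 2 * M <= INR n) by (intros n Hn; apply le_INR in Hn; lra).
  set (c := Cmod (P N)).
  assert (Hc : 0 < c) by (apply Cmod_gt_0, Hne; lia).
  assert (Hlow : forall n, (N <= n)%nat -> c / 2 * (1 + 2 * M / INR n) <= Cmod (P n)).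
  { intros n Hn; induction Hn as [|n Hn IH].
    - fold c; assert (H : 2 * M / INR N <= 1).
      { apply Rmult_le_reg_r with (INR N); [ lra | ].
        unfold Rdiv; rewrite Rmult_assoc, Rinv_l by lra; lra. }
      nra.
    - destruct (Hstep n Hn) as (w & Ew & Hw); rewrite Ew, Cmod_mult.
      pose proof (HINR n Hn) as Hx; set (x := INR n) in *.
      rewrite S_INR in *; fold x in Hw |- *.
      assert (Hw1 : 1 - M / (x + 1) ^ 2 <= Cmod (1 + w)).
      { assert (H : Cmod 1 <= Cmod (1 + w) + Cmod (- w)).
        { eapply Rle_trans; [ | apply Cmod_triangle ]; right; f_equal; ring. }
        rewrite Cmod_1, Cmod_opp in H; lra. }
      assert (Hpos : 0 < M / (x + 1) ^ 2 <= 1).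
      { split; [ apply Rdiv_lt_0_compat; [ lra | apply pow_lt; lra ] | ].
        apply Rmult_le_reg_r with ((x + 1) ^ 2); [ apply pow_lt; lra | ].
        unfold Rdiv; rewrite Rmult_assoc, Rinv_l by (apply pow_nonzero; lra); nra. }
      apply Rle_trans with (c / 2 * (1 + 2 * M / x) * (1 - M / (x + 1) ^ 2)).
      + rewrite Rmult_assoc; apply Rmult_le_compat_l; [ lra | ].
        apply Rminus_le_0.
        replace ((1 + 2 * M / x) * (1 - M / (x + 1) ^ 2) - (1 + 2 * M / (x + 1)))
          with (M * (x + 2 - 2 * M) / (x * (x + 1) ^ 2)) by (field; lra).
        apply Rmult_le_pos; [ nra | ].
        apply Rlt_le, Rinv_0_lt_compat, Rmult_lt_0_compat; [ lra | apply pow_lt; lra ].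
      + apply Rmult_le_compat; auto; [ | lra ].
        apply Rmult_le_pos; [ lra | ].
        assert (0 < 2 * M / x) by (apply Rdiv_lt_0_compat; lra); lra. }
  assert (Hup : forall n, (N <= n)%nat -> Cmod (P n) <= c * (2 - 2 * M / INR n)).
  { intros n Hn; induction Hn as [|n Hn IH].
    - fold c; assert (H : 2 * M / INR N <= 1).
      { apply Rmult_le_reg_r with (INR N); [ lra | ].
        unfold Rdiv; rewrite Rmult_assoc, Rinv_l by lra; lra. }
      nra.
    - destruct (Hstep n Hn) as (w & Ew & Hw); rewrite Ew, Cmod_mult.
      pose proof (HINR n Hn) as Hx; set (x := INR n) in *.
      rewrite S_INR in *; fold x in Hw |- *.
      assert (Hw1 : Cmod (1 + w) <= 1 + M / (x + 1) ^ 2).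
      { eapply Rle_trans; [ apply Cmod_triangle | ]; rewrite Cmod_1; lra. }
      apply Rle_trans with (c * (2 - 2 * M / x) * (1 + M / (x + 1) ^ 2)).
      + apply Rmult_le_compat; auto using Cmod_ge_0.
      + rewrite Rmult_assoc; apply Rmult_le_compat_l; [ lra | ].
        apply Rminus_le_0.
        replace ((2 - 2 * M / (x + 1)) - (2 - 2 * M / x) * (1 + M / (x + 1) ^ 2))
          with (2 * M * (1 + M) / (x * (x + 1) ^ 2)) by (field; lra).
        apply Rmult_le_pos; [ nra | ].
        apply Rlt_le, Rinv_0_lt_compat, Rmult_lt_0_compat; [ lra | apply pow_lt; lra ]. }
  assert (Hdiff : forall n k, (N <= n)%nat ->
     Cmod (P (n + k)%nat - P n) <= 2 * c * M * (/ INR n - / INR (n + k))).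
  { intros n k Hn; induction k as [|k IH].
    - rewrite Nat.add_0_r; replace (P n - P n)%C with (RtoC 0) by ring; rewrite Cmod_0; lra.
    - rewrite Nat.add_succ_r; destruct (Hstep (n + k)%nat) as (w & Ew & Hw); [ lia | ].
      replace (P (S (n + k)) - P n)%C with ((P (n + k)%nat - P n) + P (n + k)%nat * w)%C
        by (rewrite Ew; ring).
      eapply Rle_trans; [ apply Cmod_triangle | ]; rewrite Cmod_mult.
      pose proof (HINR (n + k)%nat ltac:(lia)) as Hx.
      pose proof (Hup (n + k)%nat ltac:(lia)) as HP.
      set (x := INR (n + k)) in *; rewrite S_INR in *; fold x in Hw |- *.
      assert (Hpx : 0 < 2 * M / x) by (apply Rdiv_lt_0_compat; lra).
      assert (HPw : Cmod (P (n + k)%nat) * Cmod w <= 2 * c * (M / (x + 1) ^ 2)).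
      { apply Rmult_le_compat; auto using Cmod_ge_0; nra. }
      (* The increments are dominated by a telescoping difference; together with |P| <= 2c this
         makes the sequence Cauchy. *)
      assert (Hq : M / (x + 1) ^ 2 <= M * (/ x - / (x + 1))).
      { apply Rminus_le_0.
        replace (M * (/ x - / (x + 1)) - M / (x + 1) ^ 2) with (M / (x * (x + 1) ^ 2)) by (field; lra).
        apply Rlt_le, Rdiv_lt_0_compat; [ lra | apply Rmult_lt_0_compat; [ lra | apply pow_lt; lra ] ]. }
      nra. }
  assert (Hcauchy : forall eps : posreal, exists N', forall n m, (N' <= n)%nat -> (N' <= m)%nat ->
     Cmod (P n - P m) < eps).
  { intros eps; pose proof (cond_pos eps) as He.
    destruct (INR_unbounded (2 * (2 * c * M) / eps)) as [N1 HN1].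
    assert (HcM : 0 < 2 * c * M) by (repeat apply Rmult_lt_0_compat; lra).
    assert (Hone : forall n, (N1 <= n)%nat -> 2 * c * M * / INR n < eps / 2).
    { intros n Hn; apply le_INR in Hn.
      assert (0 < 2 * (2 * c * M) / eps) by (apply Rdiv_lt_0_compat; lra).
      apply Rmult_lt_reg_r with (INR n); [ lra | ].
      rewrite Rmult_assoc, Rinv_l, Rmult_1_r by lra.
      apply Rmult_lt_reg_r with (/ eps); [ now apply Rinv_0_lt_compat | ].
      replace (eps / 2 * INR n * / eps) with (INR n / 2) by (field; lra).
      unfold Rdiv in *; lra. }
    exists (N + N1)%nat; intros n m Hn Hm.
    assert (Hmain : forall p, (N + N1 <= p)%nat -> Cmod (P p - P (N + N1)%nat) < eps / 2).
    { intros p Hp; replace p with (N + N1 + (p - (N + N1)))%nat at 1 by lia.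
      eapply Rle_lt_trans; [ apply Hdiff; lia | ].
      apply Rle_lt_trans with (2 * c * M * / INR (N + N1)); [ | apply Hone; lia ].
      apply Rmult_le_compat_l; [ lra | ].
      assert (0 < / INR (N + N1 + (p - (N + N1)))); [ | lra ].
      apply Rinv_0_lt_compat; pose proof (HINR (N + N1 + (p - (N + N1)))%nat ltac:(lia)); lra. }
    replace (P n - P m)%C with ((P n - P (N + N1)%nat) + - (P m - P (N + N1)%nat))%C by ring.
    eapply Rle_lt_trans; [ apply Cmod_triangle | ]; rewrite Cmod_opp.
    pose proof (Hmain n Hn); pose proof (Hmain m Hm); lra. }
  assert (HRe : ex_finite_lim_seq (fun n => Re (P n))).
  { apply ex_lim_seq_cauchy_corr; intros eps; destruct (Hcauchy eps) as [N' HN'].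
    exists N'; intros n m Hn Hm; eapply Rle_lt_trans; [ | exact (HN' n m Hn Hm) ].
    exact (re_le_Cmod (P n - P m)). }
  assert (HIm : ex_finite_lim_seq (fun n => Im (P n))).
  { apply ex_lim_seq_cauchy_corr; intros eps; destruct (Hcauchy eps) as [N' HN'].
    exists N'; intros n m Hn Hm; eapply Rle_lt_trans; [ | exact (HN' n m Hn Hm) ].
    exact (im_le_Cmod (P n - P m)). }
  destruct HRe as [x Hx]; destruct HIm as [y Hy].
  exists (x, y); split; [ | split; assumption ].
  intros E; injection E as -> ->.
  (* If the limit were 0, both components would eventually be smaller than c/4, against |P n| >
     c/2. *)
  assert (H4 : 0 < c / 4) by lra.
  destruct (proj2 (is_lim_seq_spec _ _) Hx (mkposreal _ H4)) as [N1 HN1].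
  destruct (proj2 (is_lim_seq_spec _ _) Hy (mkposreal _ H4)) as [N2 HN2].
  set (n := (N + N1 + N2)%nat).
  specialize (HN1 n ltac:(unfold n; lia)); specialize (HN2 n ltac:(unfold n; lia)).
  rewrite Rminus_0_r in HN1, HN2; simpl in HN1, HN2.
  pose proof (Hlow n ltac:(unfold n; lia)) as HL; pose proof (Cmod_le_Re_Im (P n)).
  pose proof (HINR n ltac:(unfold n; lia)) as Hn.
  assert (0 < 2 * M / INR n) by (apply Rdiv_lt_0_compat; lra).
  nra.
Qed.

(** * Zeros of 1/Gamma from Gauss's limit *)

Definition gauss_seq (z : C) (n : nat) : C :=
  (Cpoch z (S n) / (RtoC (INR (fact n)) * Rcpow (INR n) z))%C.

Lemma Rcpow_pos x w : 0 < x -> Rcpow x w = Cexp (w * RtoC (ln x)).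
Proof.
  intros Hx; unfold Rcpow, Rlog; destruct (Rlt_dec x 0) as [H|_]; [ lra | ].
  now rewrite Rabs_right by lra.
Qed.

Lemma gauss_seq_step z n : (1 <= n)%nat ->
  gauss_seq z (S n) = (gauss_seq z n * gauss_factor z (/ INR (S n)))%C.
Proof.
  intros Hn; unfold gauss_seq, gauss_factor.
  assert (H0 : 0 < INR n) by (apply lt_0_INR; lia).
  pose proof (S_INR n) as ES.
  assert (HS : 0 < INR (S n)) by lra.
  rewrite !Rcpow_pos by assumption.
  replace (1 - / INR (S n)) with (INR n / INR (S n)) by (rewrite ES; field; lra).
  rewrite ln_div, RtoC_minus by assumption.
  replace (z * (RtoC (ln (INR n)) - RtoC (ln (INR (S n)))))%C
    with (z * RtoC (ln (INR n)) + - (z * RtoC (ln (INR (S n)))))%C by ring.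
  rewrite Cexp_plus.
  assert (EN : (Cexp (- (z * RtoC (ln (INR (S n))))) * Cexp (z * RtoC (ln (INR (S n)))) = 1)%C).
  { rewrite <- Cexp_plus; replace (- (z * RtoC (ln (INR (S n)))) + z * RtoC (ln (INR (S n))))%C
      with (RtoC 0) by ring; apply Cexp_0. }
  pose proof (Cexp_neq_0 (z * RtoC (ln (INR (S n))))) as N1.
  pose proof (Cexp_neq_0 (z * RtoC (ln (INR n)))) as N2.
  set (E1 := Cexp (z * RtoC (ln (INR (S n))))) in *.
  set (E2 := Cexp (z * RtoC (ln (INR n)))) in *.
  assert (EN' : Cexp (- (z * RtoC (ln (INR (S n))))) = (/ E1)%C).
  { transitivity (Cexp (- (z * RtoC (ln (INR (S n))))) * E1 * / E1)%C; [ field; auto | rewrite EN; ring ]. }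
  rewrite EN', fact_simpl, mult_INR, RtoC_mult, RtoC_inv by lra.
  change (Cpoch z (S (S n))) with (Cpoch z (S n) * (z + RtoC (INR (S n))))%C.
  field; repeat split; auto; apply RtoC_neq_0; try apply INR_fact_neq_0; lra.
Qed.

Lemma Cpoch_neq_0 z n : (forall k, (z + RtoC (INR k))%C <> 0) -> Cpoch z n <> 0.
Proof.
  intros Hz; induction n as [|n IH]; simpl; [ apply RtoC_neq_0; lra | ].
  apply Cmult_neq_0; auto.
Qed.

Lemma Cinv_neq_0 (z : C) : z <> 0 -> (/ z)%C <> 0.
Proof.
  intros Hz E; apply (RtoC_neq_0 1); [ lra | ].
  transitivity (z * / z)%C; [ field; exact Hz | rewrite E; ring ].
Qed.

(** The terms of Gauss's sequence are nonzero because no z + k vanishes, and their quotients are 1 +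
    O(1/n^2). The limit thus exists, so [CLim_seq] returns a genuine limit, and it is nonzero. *)
Lemma rGamma_neq_0 z : (forall k, (z + RtoC (INR k))%C <> 0) -> rGamma z <> 0.
Proof.
  intros Hz; destruct (gauss_factor_bound z) as (K & HK & Hbound).
  (* N > 2K + 1 meets the condition 2K <= N and also gives n >= 1, hence 1/(n+1) <= 1/2. *)
  destruct (INR_unbounded (2 * K + 1)) as [N HN].
  destruct (infinite_product_limit (gauss_seq z) N K) as (l & Hl & H1 & H2); [ exact HK | lra | | | ].
  - intros n _; unfold gauss_seq, Cdiv; apply Cmult_neq_0; [ now apply Cpoch_neq_0 | ].
    apply Cinv_neq_0, Cmult_neq_0; [ apply RtoC_neq_0, INR_fact_neq_0 | apply Rcpow_neq_0 ].
  - intros n Hn; exists (gauss_factor z (/ INR (S n)) - 1)%C; split.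
    + assert (Hn1 : (1 <= n)%nat).
      { apply INR_le; apply le_INR in Hn; simpl; lra. }
      rewrite gauss_seq_step by exact Hn1; ring.
    + assert (H0 : 1 <= INR n) by (apply le_INR in Hn; lra).
      rewrite S_INR; set (x := INR n + 1).
      assert (Hx : 2 <= x) by (unfold x; lra).
      unfold Rdiv; rewrite <- pow_inv; apply Hbound; split.
      * apply Rlt_le, Rinv_0_lt_compat; lra.
      * unfold Rdiv; rewrite Rmult_1_l; apply Rinv_le_contravar; lra.
  - unfold rGamma, CLim_seq.
    assert (E1 : Lim_seq (fun n => Re (gauss_seq z n)) = Re l) by now apply is_lim_seq_unique.
    assert (E2 : Lim_seq (fun n => Im (gauss_seq z n)) = Im l) by now apply is_lim_seq_unique.
    unfold gauss_seq in E1, E2; rewrite E1, E2.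
    intros E; apply Hl; rewrite <- E; now destruct l.
Qed.

Lemma Ccos_Csin_sqr z : (Ccos z * Ccos z + Csin z * Csin z = 1)%C.
Proof.
  unfold Ccos, Csin.
  assert (E : (Cexp (Ci * z) * Cexp (- (Ci * z)) = 1)%C).
  { rewrite <- Cexp_plus; replace (Ci * z + - (Ci * z))%C with (RtoC 0) by ring; apply Cexp_0. }
  assert (HCi : Ci <> 0) by (intros H; injection H; lra).
  set (a := Cexp (Ci * z)) in *; set (b := Cexp (- (Ci * z))) in *.
  transitivity ((a * b) * 1)%C; [ | rewrite E; ring ].
  pose proof Ci_sqr as ECi.
  field_simplify_eq; [ | auto ].
  cbv beta; ring [ECi].
Qed.

Lemma Hyp2F1_0 a b c : Hyp2F1 a b c 0 = 1.
Proof.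
  rewrite Hyp2F1_power_series, Cpower_series_PSeries, !PSeries_0.
  assert (E : hyp_coef a b c 0 = 1).
  { unfold hyp_coef; simpl; field; apply RtoC_neq_0; lra. }
  rewrite E; reflexivity.
Qed.

Lemma is_CDerive_odd_angular_half_pi nu s : is_CDerive (odd_angular nu s) (PI / 2) (- (1)).
Proof.
  destruct (Hyp2F1_ode (1 / 2 - nu / 2 - s / 2) (nu / 2 - s / 2 + 1) (3 / 2)) as (G1 & G2 & HG); [ lra | ].
  rewrite RtoC_three_half in HG.
  assert (Hs : 0 < sin (PI / 2)) by (rewrite sin_PI2; lra).
  destruct (is_CDerive_cos_sqr_comp _ G1 G2 (fun x Hx => conj (proj1 (HG x Hx)) (proj1 (proj2 (HG x Hx)))) _ Hs)
    as [D1 _].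
  eapply is_CDerive_eq; [ exact (is_CDerive_mult _ _ _ _ _ (is_CDerive_cos _) D1) | ].
  cbv beta; rewrite cos_PI2, sin_PI2.
  replace (0 ^ 2) with 0 by ring; rewrite Hyp2F1_0; ring.
Qed.

Lemma prefactor_neq_0 s v : 0 < sin v -> prefactor s v <> 0.
Proof.
  intros Hs; apply Cmult_neq_0; [ | apply Rcpow_neq_0 ].
  apply RtoC_neq_0, Rgt_not_eq, Rdiv_lt_0_compat; [ lra | now apply sqrt_lt_R0 ].
Qed.

(** At v = pi/2, where cos v = 0, the even angular function is 1 while the odd one is 0 with slope
    -1: the value gives A = 0 and the derivative B = 0. *)
Lemma Phi_even_odd_indep e mu m zeta J (A B : C) :
  (forall v, 0 < v < PI ->
     (A * Phi_even e mu m zeta J v + B * Phi_odd e mu m zeta J v = 0)%C) ->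
  A = 0 /\ B = 0.
Proof.
  intros H; pose proof PI_RGT_0 as HPI.
  set (s := ord e mu J) in *; set (nu := RtoC (deg m zeta)) in *.
  assert (H' : forall v, 0 < v < PI -> (A * even_angular nu s v + B * odd_angular nu s v = 0)%C).
  { intros v Hv; pose proof (H v Hv) as E; unfold Phi_even, Phi_odd in E; fold s nu in E.
    assert (E' : (prefactor s v * (A * even_angular nu s v + B * odd_angular nu s v) = 0)%C).
    { rewrite <- E; ring. }
    apply Cmult_integral in E'; destruct E' as [E'|E']; auto.
    exfalso; revert E'; apply prefactor_neq_0, sin_gt_0; lra. }
  assert (HA : A = 0).
  { pose proof (H' (PI / 2) ltac:(lra)) as E; unfold even_angular, odd_angular in E.
    rewrite cos_PI2 in E; replace (0 ^ 2) with 0 in E by ring; rewrite !Hyp2F1_0 in E.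
    rewrite <- E; ring. }
  split; [ exact HA | ].
  assert (D : is_CDerive (fun v => B * odd_angular nu s v)%C (PI / 2) 0).
  { apply is_CDerive_ext_loc with (fun _ => RtoC 0); [ | apply is_CDerive_const ].
    apply locally_R_between with 0 PI; [ lra | ]; intros t Ht.
    rewrite <- (H' t Ht), HA; ring. }
  apply is_CDerive_unique in D.
  rewrite (is_CDerive_unique _ _ _ (is_CDerive_scal B _ _ _ (is_CDerive_odd_angular_half_pi nu s))) in D.
  transitivity (- (B * - (1)))%C; [ ring | rewrite D; ring ].
Qed.

Lemma Re_Rcsqrt_nonneg x : 0 <= Re (Rcsqrt x).
Proof.
  unfold Rcsqrt; destruct (Rle_dec 0 x); simpl; [ apply sqrt_pos | lra ].
Qed.

(** The real part is positive, so the Gamma factors of the Ferrers functions are evaluated away from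
    their poles. *)
Lemma half_sum_neq_0 (nu : R) (s : C) (c : R) : 0 < nu -> 0 <= Re s -> 0 < c ->
  forall k, (RtoC nu / 2 + s / 2 + RtoC c + RtoC (INR k))%C <> 0.
Proof.
  intros Hnu Hs Hc k E; pose proof (pos_INR k).
  apply (f_equal Re) in E; simpl in E; unfold Re in Hs; simpl in E.
  assert (nu / 2 + fst s / 2 + c + INR k = 0) by (rewrite <- E; field). lra.
Qed.

(** A zero would mean s = nu + 1 + (2k + j). The case j = 0 serves [W2_const] and j = 1 serves
    [W1_const]; together they account for every excluded order. *)
Lemma half_diff_neq_0 (nu : R) (s : C) (j : nat) :
  (forall k : nat, s <> RtoC (nu + 1 + INR k)) ->
  forall k, (RtoC nu / 2 - s / 2 + RtoC (1 / 2 * INR (S j)) + RtoC (INR k))%C <> 0.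
Proof.
  intros Hs k E; apply (Hs (2 * k + j)%nat).
  transitivity (s + 2 * (RtoC nu / 2 - s / 2 + RtoC (1 / 2 * INR (S j)) + RtoC (INR k)))%C;
    [ rewrite E; ring | ].
  rewrite plus_INR, mult_INR, S_INR; simpl (INR 2).
  rewrite !RtoC_plus, !RtoC_mult, !RtoC_plus, RtoC_half; field.
Qed.

(** The matrix from the even and odd solutions to [Phi1], [Phi2] has determinant (pi/2) W1 W2 (cos^2
    + sin^2) of the angle [theta], that is (pi/2) W1 W2; so only the two Gamma constants have to be
    nonzero. *)
Lemma Phi1_Phi2_indep e mu m zeta J : 0 < deg m zeta ->
  (forall k : nat, ord e mu J <> RtoC (deg m zeta + 1 + INR k)) ->
  lin_indep (Phi1 e mu m zeta J) (Phi2 e mu m zeta J).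
Proof.
  intros Hdeg Hord a b H.
  set (s := ord e mu J); set (nu := RtoC (deg m zeta)).
  assert (Hs : 0 <= Re s) by apply Re_Rcsqrt_nonneg.
  assert (HsPI : RtoC (sqrt PI) <> 0).
  { apply RtoC_neq_0, Rgt_not_eq, sqrt_lt_R0, PI_RGT_0. }
  assert (HP2 : RtoC (PI / 2) <> 0) by (pose proof PI_RGT_0; apply RtoC_neq_0; lra).
  assert (HW1 : W1_const nu s <> 0).
  { unfold W1_const, Cdiv at 1, CGamma.
    apply Cmult_neq_0; [ apply Cmult_neq_0; [ apply Rcpow_neq_0 | now apply Cinv_neq_0 ] | apply Cmult_neq_0 ].
    - apply Cinv_neq_0, rGamma_neq_0; intros k; rewrite <- RtoC_half.
      apply half_sum_neq_0; auto; lra.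
    - apply rGamma_neq_0; intros k; pose proof (half_diff_neq_0 _ _ 1 Hord k) as E.
      replace (1 / 2 * INR 2) with 1 in E by (simpl; field); exact E. }
  assert (HW2 : W2_const nu s <> 0).
  { unfold W2_const, Cdiv at 1, CGamma.
    apply Cmult_neq_0; [ apply Cmult_neq_0; [ apply Rcpow_neq_0 | now apply Cinv_neq_0 ] | apply Cmult_neq_0 ].
    - apply Cinv_neq_0, rGamma_neq_0; intros k; apply half_sum_neq_0; auto; lra.
    - apply rGamma_neq_0; intros k; pose proof (half_diff_neq_0 _ _ 0 Hord k) as E.
      replace (1 / 2 * INR 1) with (1 / 2) in E by (simpl; field); rewrite RtoC_half in E; exact E. }
  set (c := Ccos (theta nu s)); set (d := Csin (theta nu s)).
  assert (Hcd : (c * c + d * d = 1)%C) by apply Ccos_Csin_sqr.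
  destruct (Phi_even_odd_indep e mu m zeta J
    ((a * c - b * RtoC (PI / 2) * d) * W1_const nu s)%C
    ((a * d + b * RtoC (PI / 2) * c) * W2_const nu s)%C) as [E1 E2].
  { intros v Hv; rewrite <- (H v Hv), Phi1_even_odd, Phi2_even_odd; fold s nu c d; ring. }
  apply Cmult_integral in E1; destruct E1 as [E1|E1]; [ | contradiction ].
  apply Cmult_integral in E2; destruct E2 as [E2|E2]; [ | contradiction ].
  split.
  - transitivity (a * (c * c + d * d))%C; [ rewrite Hcd; ring | ].
    transitivity ((a * c - b * RtoC (PI / 2) * d) * c + (a * d + b * RtoC (PI / 2) * c) * d)%C; [ ring | ].
    rewrite E1, E2; ring.
  - assert (E : (RtoC (PI / 2) * b = 0)%C).
    { transitivity (RtoC (PI / 2) * b * (c * c + d * d))%C; [ rewrite Hcd; ring | ].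
      transitivity ((a * d + b * RtoC (PI / 2) * c) * c - (a * c - b * RtoC (PI / 2) * d) * d)%C; [ ring | ].
      rewrite E1, E2; ring. }
    apply Cmult_integral in E; destruct E as [E|E]; [ contradiction | exact E ].
Qed.

Theorem mainTheorem9 (e mu m zeta J : R)
    (hzeta : zeta = 0 \/ zeta = (3 - 1) / (4 * 3)) (hJ : 0 <= J) :
  (* the chart, its metric, and the electromagnetic field *)
  (forall q1 q2 u,
     (embed 0 q1 q2 u) ^ 2 - (embed 1 q1 q2 u) ^ 2
     - (embed 2 q1 q2 u) ^ 2 - (embed 3 q1 q2 u) ^ 2 = -1) /\
  (forall a b q1 q2 u, chart q1 q2 u ->
     metric a b q1 q2 u = induced_metric a b q1 q2 u) /\
  (forall a b q1 q2 u, chart q1 q2 u ->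
     em_field mu a b q1 q2 u
     = rpd a (potential mu b) q1 q2 u - rpd b (potential mu a) q1 q2 u) /\
  (* the Klein-Gordon operator in coordinates *)
  op_eq (KG_covariant e mu m zeta) (KG e mu m zeta) /\
  (* symmetry operators and the symmetry algebra *)
  (forall A, op_eq (op_comm (KG e mu m zeta) (X e mu A)) op_zero) /\
  op_eq (op_comm (KG e mu m zeta) (X0 e)) op_zero /\
  op_eq (op_comm (X e mu G1) (X e mu G2)) (X e mu G3) /\
  op_eq (op_comm (X e mu G1) (X e mu G3)) (X e mu G2) /\
  op_eq (op_comm (X e mu G2) (X e mu G3)) (X e mu G1) /\
  (e <> 0 -> iso_so12_R e mu) /\
  (* the lambda-representation *)
  lop_eq (lop_comm (ell J G1) (ell J G2)) (ell J G3) /\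
  lop_eq (lop_comm (ell J G1) (ell J G3)) (ell J G2) /\
  lop_eq (lop_comm (ell J G2) (ell J G3)) (ell J G1) /\
  operator_irreducible (ell J) /\
  continuous_series J /\
  (forall A, skew_symmetric (ell J A)) /\
  (* (a) *)
  (forall D, admissible D -> forall phi,
     solves_system e mu J D phi <->
     exists Phi : R -> C, forall q1 q2 u l, D (q1, q2, u, l) ->
       phi q1 q2 u l = phiJ e mu J Phi q1 q2 u l) /\
  (* (b) *)
  (forall Phi q1 q2 u l, regular q1 q2 u l -> twice_diff Phi u ->
     (KG e mu m zeta (fun q1 q2 u => phiJ e mu J Phi q1 q2 u l) q1 q2 u = RtoC 0
      <-> reduced_eq e mu m zeta J Phi u)) /\
  (* (c) *)
  solves_reduced e mu m zeta J (Phi1 e mu m zeta J) /\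
  solves_reduced e mu m zeta J (Phi2 e mu m zeta J) /\
  ((forall k : nat, ord e mu J <> RtoC (deg m zeta + 1 + INR k)) ->
   lin_indep (Phi1 e mu m zeta J) (Phi2 e mu m zeta J)).
Proof.
  assert (Hz : 0 <= zeta) by (destruct hzeta; lra).
  (* Both values of zeta are nonnegative, hence the square root is at least 1 and nu >= 1/2. *)
  assert (Hm : 1 <= 1 + m ^ 2 + 6 * zeta) by (pose proof (pow2_ge_0 m); lra).
  assert (Hdeg : 0 < deg m zeta).
  { unfold deg; pose proof (sqrt_le_1_alt _ _ Hm) as H; rewrite sqrt_1 in H; lra. }
  split; [ exact embed_hyperboloid | ].
  split; [ intros; apply metric_induced | ].
  split; [ intros; apply em_field_potential | ].
  split; [ apply KG_covariant_eq | ].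
  split; [ apply KG_X_comm | ].
  split; [ apply KG_X0_comm | ].
  split; [ apply X_comm_12 | ].
  split; [ apply X_comm_13 | ].
  split; [ apply X_comm_23 | ].
  split; [ apply symmetry_algebra_iso | ].
  split; [ apply ell_comm_12 | ].
  split; [ apply ell_comm_13 | ].
  split; [ apply ell_comm_23 | ].
  split; [ apply ell_irreducible | ].
  split; [ apply ell_continuous_series | ].
  split; [ apply ell_skew | ].
  split; [ apply general_solution | ].
  split; [ intros; now apply KG_phiJ_iff | ].
  split; [ apply Phi1_solves; lra | ].
  split; [ apply Phi2_solves; lra | ].
  now apply Phi1_Phi2_indep.
Qed.
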